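(* Assume that $f:BUC_\eta\to\mathbb{R}^n$ is Lipschitz on bounded sets, that $f(0_{BUC_\eta})=0_{\mathbb{R}^n}$, and that $f$ is continuously differentiable locally around $0_{BUC_\eta}$. Let $\widehat{L}=Df(0)$ and, for $\lambda\in\Omega$, $\Delta(\lambda)=\lambda I-\widehat{L}(e^{\lambda\cdot}I)$. The equilibrium $0_X$ of the abstract Cauchy problem $$\frac{dU(t)x}{dt}=AU(t)x+F(U(t)x),\ t\ge 0,\qquad U(0)x=x\in X_0,$$ is asymptotically stable if for each $\lambda\in\Omega$, $$\det(\Delta(\lambda))=0\ \Rightarrow\ \mathrm{Re}(\lambda)<0 .$$ More precisely, if this condition is satisfied, there exist constants $M\ge 1$, $\delta>0$ and $\varepsilon>0$ such that for each $x\in X_0$ with $\|x\|\le\varepsilon$ the solution $U(t)x$ is defined for all $t\ge0$ and $$\|U(t)x\|\le Me^{-\delta t}\|x\|,\qquad \forall t\ge 0 .$$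
   Context: Fix an integer $n\ge1$ and a real $\eta>0$. $BUC_\eta$ is the Banach space of all $\varphi\in C((-\infty,0],\mathbb{R}^n)$ such that $\theta\mapsto e^{\eta\theta}\varphi(\theta)$ is bounded and uniformly continuous, with norm $\|\varphi\|_\eta=\sup_{\theta\le0}e^{\eta\theta}\|\varphi(\theta)\|$. $BUC_\eta^1=\{\varphi\in C^1((-\infty,0],\mathbb{R}^n):\varphi,\varphi'\in BUC_\eta\}$. $X=\mathbb{R}^n\times BUC_\eta$ with norm $\|(\alpha,\varphi)\|=\|\alpha\|+\|\varphi\|_\eta$; $X_0=\{0_{\mathbb{R}^n}\}\times BUC_\eta$. The operator $A:D(A)\subset X\to X$ is $A(0,\varphi)=(-\varphi'(0),\varphi')$ with $D(A)=\{0_{\mathbb{R}^n}\}\times BUC^1_\eta$. $F:X_0\to X$ is $F(0,\varphi)=(f(\varphi),0)$. $f$ is Lipschitz on bounded sets if for each $\xi>0$ there is $\kappa(\xi)$ with $\|f(\varphi)-f(\psi)\|\le\kappa(\xi)\|\varphi-\psi\|_\eta$ whenever $\|\varphi\|_\eta,\|\psi\|_\eta\le\xi$. For $x=(0,\varphi)\in X_0$, $t\mapsto U(t)x$ denotes the unique maximal mild solution, i.e. the maximal continuous $X_0$-valued function with $\int_0^tU(l)x\,dl\in D(A)$ and $U(t)x=x+A\int_0^tU(l)x\,dl+\int_0^tF(U(l)x)\,dl$. Equivalently $U(t)x=(0,x_t)$, where (with $x_t(\theta)=x(t+\theta)$, $\theta\le0$) $x(\cdot)$ is the maximal continuous solution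 of $x(t)=\varphi(0)+\int_0^tf(x_s)\,ds$ for $t\ge0$, $x(t)=\varphi(t)$ for $t\le0$. $\Omega=\{\lambda\in\mathbb{C}:\mathrm{Re}(\lambda)>-\eta\}$. $\widehat L$ is extended complex-linearly to $\mathbb{C}^n$-valued functions, and $\widehat L(e^{\lambda\cdot}I)$ is the $n\times n$ complex matrix $v\mapsto\widehat L(\theta\mapsto e^{\lambda\theta}v)$. *)

(* Defs.v *)
From HB Require Import structures.
From mathcomp Require Import all_boot all_order all_algebra.
From mathcomp.real_closed Require Import complex.
From mathcomp Require Import all_classical all_reals all_analysis.

Set Implicit Arguments.
Unset Strict Implicit.
Unset Printing Implicit Defensive.

Import Order.TTheory GRing.Theory Num.Theory.
Import numFieldNormedType.Exports.

Local Open Scope classical_set_scope.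
Local Open Scope ring_scope.

(* A function on (-oo, 0] is represented by its extension to R that is constant
   on [0, +oo); this makes the representation unique. *)
Definition is_buc (R : realType) (n : nat) (eta : R) (phi : R -> 'cV[R]_n) :=
  [/\ forall theta, 0 <= theta -> phi theta = phi 0,
      {within [set theta | theta <= 0], continuous phi},
      exists M, forall theta, theta <= 0 ->
        `|expR (eta * theta) *: phi theta| <= M &
      forall e, 0 < e -> exists2 d, 0 < d &
        forall s t, s <= 0 -> t <= 0 -> `|s - t| < d ->
          `|expR (eta * s) *: phi s - expR (eta * t) *: phi t| < e].

Definition buc_pred (R : realType) (n : nat) (eta : R) :
  {pred R -> 'cV[R]_n} := mem [set phi | is_buc eta phi].

Record BUC (R : realType) (n : nat) (eta : R) := MkBUC {
  buc_fun :> R -> 'cV[R]_n;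
  buc_funP : buc_fun \in @buc_pred R n eta }.

Section BUCNormedModule.
Context (R : realType) (n : nat) (eta : R).
Local Notation B := (BUC n eta).

HB.instance Definition _ := [isSub for @buc_fun R n eta].
HB.instance Definition _ := gen_eqMixin B.
HB.instance Definition _ := gen_choiceMixin B.

Fact buc_submod_closed : submod_closed (@buc_pred R n eta).
Proof.
split.
  rewrite inE; split => //=.
  - by move=> x; exact: cvg_cst.
  - by exists 0 => t _; rewrite scaler0 normr0.
  - by move=> e e0; exists 1 => // s t _ _ _; rewrite !scaler0 subr0 normr0.
move=> a f g; rewrite !inE => -[f1 f2 [Mf f3] f4] [g1 g2 [Mg g3] g4]; split.
- by move=> t t0 /=; rewrite !fctE f1// g1.
- by move=> x; apply: cvgD; [apply: cvgZl_tmp; exact: f2|exact: g2].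
- exists (`|a| * Mf + Mg) => t t0; rewrite !fctE scalerDr.
  rewrite (le_trans (ler_normD _ _))// lerD ?g3// scalerA mulrC -scalerA.
  by rewrite normrZ ler_wpM2l ?f3.
- move=> e e0.
  have a0 : 0 < `|a| + 1 by rewrite ltr_wpDl.
  have [|d1 d10 H1] := f4 (e / 2 / (`|a| + 1)); first by rewrite !divr_gt0.
  have [|d2 d20 H2] := g4 (e / 2); first by rewrite divr_gt0.
  exists (Num.min d1 d2); first by rewrite lt_min d10.
  move=> s t s0 t0; rewrite lt_min => /andP[st1 st2]; rewrite !fctE.
  rewrite !scalerDr opprD addrACA !scalerA ![expR _ * a]mulrC -!scalerA.
  rewrite -scalerBr (le_lt_trans (ler_normD _ _))// [ltRHS](splitr e).
  rewrite ler_ltD ?H2// normrZ.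
  rewrite (@le_trans _ _ ((`|a| + 1) * (e / 2 / (`|a| + 1))))//; last first.
    by rewrite mulrC divfK ?gt_eqF.
  by rewrite ler_pM// ?lerDl// ltW// H1.
Qed.

HB.instance Definition _ := GRing.isSubmodClosed.Build R (R -> 'cV[R]_n)
  (@buc_pred R n eta) buc_submod_closed.
HB.instance Definition _ := [SubChoice_isSubLmodule of B by <:].

Definition buc_norm (phi : B) : R :=
  sup [set expR (eta * theta) * `|phi theta| | theta in [set t | t <= 0]].

Fact buc_norm_has_sup (phi : B) : has_sup
  [set expR (eta * theta) * `|phi theta| | theta in [set t | t <= 0]].
Proof.
split; first by exists (expR (eta * 0) * `|phi 0|); exists 0 => /=.
have := buc_funP phi; rewrite inE => -[_ _ [M HM] _].
exists M => _ [t t0 <-].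
by have := HM _ t0; rewrite normrZ ger0_norm ?expR_ge0.
Qed.

Fact buc_norm_ub (phi : B) theta : theta <= 0 ->
  expR (eta * theta) * `|phi theta| <= buc_norm phi.
Proof.
move=> t0; apply: ub_le_sup; first by have [] := buc_norm_has_sup phi.
by exists theta.
Qed.

Fact buc_norm_le (phi : B) M :
  (forall theta, theta <= 0 -> expR (eta * theta) * `|phi theta| <= M) ->
  buc_norm phi <= M.
Proof.
move=> H; apply: ge_sup; first by have [] := buc_norm_has_sup phi.
by move=> _ [t t0 <-]; exact: H.
Qed.

Fact buc_normD (phi psi : B) :
  buc_norm (phi + psi) <= buc_norm phi + buc_norm psi.
Proof.
apply: buc_norm_le => t t0 /=.
rewrite (@le_trans _ _ (expR (eta * t) * (`|phi t| + `|psi t|)))//.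
  by rewrite ler_wpM2l ?expR_ge0// ler_normD.
by rewrite mulrDr lerD// buc_norm_ub.
Qed.

Fact buc_norm_ge0 (phi : B) : 0 <= buc_norm phi.
Proof.
by apply: le_trans (buc_norm_ub phi (lexx 0)); rewrite mulr_ge0 ?expR_ge0.
Qed.

Fact buc_normZ (l : R) (phi : B) : buc_norm (l *: phi) = `|l| * buc_norm phi.
Proof.
have H k (psi : B) : buc_norm (k *: psi) <= `|k| * buc_norm psi.
  apply: buc_norm_le => t t0 /=.
  rewrite [X in `|X|](_ : _ = k *: psi t)// normrZ mulrCA.
  by rewrite ler_wpM2l// buc_norm_ub.
apply/eqP; rewrite eq_le H /=.
have [->|l0] := eqVneq l 0; first by rewrite normr0 mul0r buc_norm_ge0.
have := H l^-1 (l *: phi).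
by rewrite scalerA mulVf// scale1r normfV -ler_pdivrMl ?invr_gt0 ?normr_gt0// invrK.
Qed.

Fact buc_norm0_eq0 (phi : B) : buc_norm phi = 0 -> phi = 0.
Proof.
move=> h; apply/val_inj/funext => t /=.
have H s : s <= 0 -> phi s = 0.
  move=> /(buc_norm_ub phi); rewrite h => hs; apply/eqP.
  by rewrite -normr_le0 -(pmulr_rle0 _ (expR_gt0 (eta * s))).
have [/H//|/ltW t0] := leP t 0.
by have := buc_funP phi; rewrite inE => -[-> // _ _ _]; exact: H.
Qed.

HB.instance Definition _ := Lmodule_isNormed.Build R B
  buc_normD buc_normZ buc_norm0_eq0.

End BUCNormedModule.

(* The library's product norm is the maximum; it induces the same topology as
   this one, which is used wherever the norm of X appears explicitly. The norm
   on 'cV[R]_n is the library's, i.e. the maximum norm. *)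
Notation Xspace R n eta := ('cV[R]_n * BUC n (eta : R))%type.

Definition normX (R : realType) (n : nat) (eta : R) (x : Xspace R n eta) : R :=
  `|x.1| + `|x.2|.

Definition X0 (R : realType) (n : nat) (eta : R) : set (Xspace R n eta) :=
  [set x | x.1 = 0].

(* psi is the derivative of phi on (-oo, 0], one-sided at 0. *)
Definition is_deriv_nonpos (R : realType) (n : nat) (phi psi : R -> 'cV[R]_n) :=
  forall theta, theta <= 0 ->
    h^-1 *: (phi (theta + h) - phi theta)
      @[h --> within [set h | theta + h <= 0] 0^'] --> psi theta.

Definition BUC1 (R : realType) (n : nat) (eta : R) : set (BUC n eta) :=
  [set phi | exists psi : BUC n eta, is_deriv_nonpos phi psi].

Definition buc_deriv (R : realType) (n : nat) (eta : R) (phi : BUC n eta) :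
  BUC n eta := xget 0 [set psi : BUC n eta | is_deriv_nonpos phi psi].

Definition domA (R : realType) (n : nat) (eta : R) : set (Xspace R n eta) :=
  [set x | x.1 = 0 /\ BUC1 x.2].

(* Meaningful on domA only: buc_deriv is a default value outside BUC1. *)
Definition opA (R : realType) (n : nat) (eta : R) (x : Xspace R n eta) :
  Xspace R n eta := (- buc_deriv x.2 0, buc_deriv x.2).

(* Total for convenience; only ever used on X0. *)
Definition opF (R : realType) (n : nat) (eta : R) (f : BUC n eta -> 'cV[R]_n)
  (x : Xspace R n eta) : Xspace R n eta := (f x.2, 0).

(* v is the Riemann integral of g over [a, b], as a limit of tagged sums. *)
Definition is_Riemann_integral (R : realType) (V : normedModType R)
    (g : R -> V) (a b : R) (v : V) :=
  forall e, 0 < e -> exists2 d, 0 < d &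
    forall (N : nat) (s xi : nat -> R), s 0%N = a -> s N = b ->
      (forall i, (i < N)%N ->
        [/\ s i <= xi i, xi i <= s i.+1 & s i.+1 - s i < d]) ->
      `|\sum_(i < N) (s i.+1 - s i) *: g (xi i) - v| < e.

Definition is_mild_solution (R : realType) (n : nat) (eta : R)
    (f : BUC n eta -> 'cV[R]_n) (x : Xspace R n eta) (tau : \bar R)
    (u : R -> Xspace R n eta) :=
  [/\ (0 < tau)%E,
      forall t, 0 <= t -> (t%:E < tau)%E -> X0 (u t),
      {within [set t | 0 <= t /\ (t%:E < tau)%E], continuous u} &
      forall t, 0 <= t -> (t%:E < tau)%E -> exists I J,
        [/\ is_Riemann_integral u 0 t I,
            is_Riemann_integral (opF f \o u) 0 t J,
            domA I &
            u t = x + opA I + J]].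

(* The maximal solution extends every mild solution, so it is unique on
   [0, tau). *)
Definition is_maximal_mild_solution (R : realType) (n : nat) (eta : R)
    (f : BUC n eta -> 'cV[R]_n) (x : Xspace R n eta) (tau : \bar R)
    (u : R -> Xspace R n eta) :=
  is_mild_solution f x tau u /\
  forall tau' u', is_mild_solution f x tau' u' ->
    (tau' <= tau)%E /\
    (forall t, 0 <= t -> (t%:E < tau')%E -> u' t = u t).

Definition is_equilibrium (R : realType) (n : nat) (eta : R)
    (f : BUC n eta -> 'cV[R]_n) (x : Xspace R n eta) :=
  domA x /\ opA x + opF f x = 0.

Definition asymptotically_stable (R : realType) (n : nat) (eta : R)
    (f : BUC n eta -> 'cV[R]_n) (xbar : Xspace R n eta) :=
  (forall e, 0 < e -> exists2 d, 0 < d &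
    forall x, X0 x -> normX (x - xbar) <= d ->
      exists2 u, is_maximal_mild_solution f x +oo%E u &
        forall t, 0 <= t -> normX (u t - xbar) <= e) /\
  (exists2 d, 0 < d &
    forall x, X0 x -> normX (x - xbar) <= d ->
      exists2 u, is_maximal_mild_solution f x +oo%E u &
        normX (u t - xbar) @[t --> +oo] --> 0).

Definition lipschitz_on_bounded_sets (R : realType) (V W : normedModType R)
    (f : V -> W) :=
  forall xi, 0 < xi -> exists kappa : R, forall phi psi,
    `|phi| <= xi -> `|psi| <= xi -> `|f phi - f psi| <= kappa * `|phi - psi|.

(* The second clause is continuity of phi |-> 'd f phi in operator norm. *)
Definition continuously_differentiable_near (R : realType)
    (V W : normedModType R) (f : V -> W) (x : V) :=
  \forall phi \near x, differentiable f phi /\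
    forall e, 0 < e -> \forall psi \near phi,
      forall h, `|'d f psi h - 'd f phi h| <= e * `|h|.

(* The restriction to (-oo, 0] of g, which must belong to BUC. *)
Definition to_buc (R : realType) (n : nat) (eta : R) (g : R -> 'cV[R]_n) :
  BUC n eta := insubd 0 (fun theta => g (Num.min theta 0)).

(* The complex-linear extension: L (g1 + i g2) = L g1 + i L g2. *)
Definition complex_ext (R : realType) (n : nat) (eta : R)
    (L : BUC n eta -> 'cV[R]_n) (g : R -> 'cV[R[i]]_n) : 'cV[R[i]]_n :=
  \col_k Complex (L (to_buc eta (fun theta => map_mx (@complex.Re R) (g theta))) k 0)
                 (L (to_buc eta (fun theta => map_mx (@complex.Im R) (g theta))) k 0).

Definition cexp (R : realType) (z : R[i]) : R[i] :=
  Complex (expR (complex.Re z) * cos (complex.Im z))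
          (expR (complex.Re z) * sin (complex.Im z)).

Definition Delta (R : realType) (n : nat) (eta : R)
    (L : BUC n eta -> 'cV[R]_n) (lambda : R[i]) : 'M[R[i]]_n :=
  lambda%:M - \matrix_(k, j) complex_ext L (fun theta =>
    cexp (lambda * Complex theta 0) *: delta_mx j 0) k 0.

(* Main.v *)
Require Import Defs.
From mathcomp Require Import all_boot all_order all_algebra.
From mathcomp.real_closed Require Import complex.
From mathcomp Require Import all_classical all_reals all_analysis.
From mathcomp Require Import ring lra.
Set Implicit Arguments.
Unset Strict Implicit.
Unset Printing Implicit Defensive.
Import Order.TTheory GRing.Theory Num.Theory.
Import numFieldNormedType.Exports.
Local Open Scope classical_set_scope.
Local Open Scope ring_scope.

(** Write x_t for the history of x at time t, so that mild solutions are the curves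
(0, x_t) with x'(t) = f(x_t) for t > 0, and let L = Df(0).

Reduction to the linear equation. Suppose that there is a time N after which
every solution of x'(t) = L x_t has its history reduced to a quarter in norm.
On the bounded time interval [0, N] a nonlinear solution that starts with a
small history differs from the linear one by an arbitrarily small multiple of
the norm of that history: this is Gronwall's inequality together with
differentiability at 0. So the nonlinear flow halves small histories over a time
N, and iteration gives exponential decay (nonlinear_contraction,
nonlinear_decay). Existence is obtained by Picard iteration for f composed with
the retraction onto the unit ball, which is globally Lipschitz.

Decay of the linear equation. The state space is infinite-dimensional, so the
location of the characteristic roots has to be turned into decay. Instead of the
spectral theory of the semigroup, the argument uses periodic forcing.
For a in a bounded interval [0, B] the inverse of Delta(a + i xi) is at most
K / (1 + |xi|), uniformly: on bounded frequencies by compactness, and for large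
|xi| because the term i xi dominates (char_uniform_bound). Hence, if q is a
T-periodic trigonometric polynomial, then y'(t) = L y_t + exp(bt) q(t) has a
solution of the form exp(bt) times a T-periodic function, obtained by applying
the inverse of Delta to each Fourier coefficient. The factors 1 / (1 + |xi|) are
square-summable, so by Bessel's inequality the supremum of y(t) exp(-bt) is
controlled by the L^2 norm of q, with a constant that does not depend on b or T
(periodic_forcing). Continuous forcings are reached by Fejer sums, which are
replaced by discrete sums over sample points so that only finite Fourier
analysis is used.

Call b a decaying rate if x_m exp(-bm) becomes small relative to x_0 for suitable
m. For such a rate the periodic solution nearly forgets its past within a long
period, so that the same L^2 bound holds for the solution with zero history
(forced_estimate). Apply this to z(t) = (t/T)^2 x(t), where x solves the
linear equation: z has zero history, z(T) = x(T), and its forcing has size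
O(1/T) times the supremum M of the norm of x_t exp(-bt), hence L^2 norm
O(M / sqrt T) on [0, T]. So |x(T)| <= k M exp(bT) for any given k > 0 as soon as
T is large, uniformly in b (ramp_estimate). It follows that the rate b can be
lowered by a fixed amount as long as b >= 0 (decaying_step). Starting from the
rate given by Gronwall's inequality, finitely many steps reach b = 0
(linear_decay), which is the contraction needed above.

Mild solutions. If x solves the delay equation, then the integral of its
histories is the history of s |-> X(t + s) - X(s) with X a primitive of x, which
gives the mild equation (solves_mild_integrals). Conversely let w be the
difference of the second components of two mild solutions with the same initial
value, and W its integral. Then W has the derivative w with respect to time and
with respect to th, so it is constant along the lines s + th = const
(characteristic). Hence w(s) is the history at s of a single function z, for
which Gronwall's inequality gives z = 0 (difference_eq0,
mild_solution_unique); so the solutions above are the maximal ones. *)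

(** * Derivatives and the mean value inequality *)

Lemma minr_continuous {R : realType} (c : R) : continuous (fun t : R => Num.min t c).
Proof.
move=> t; apply: (@continuous_min R R id (cst c)); [exact: cvg_id|exact: cst_continuous].
Qed.

Lemma maxr_continuous {R : realType} (c : R) : continuous (fun t : R => Num.max t c).
Proof.
move=> t; apply: (@continuous_max R R id (cst c)); [exact: cvg_id|exact: cst_continuous].
Qed.

Lemma halfR_gt0 {R : realType} (e : R) : 0 < e -> 0 < e / 2.
Proof. by move=> e0; rewrite divr_gt0. Qed.

Section RealLine.
Context {R : realType}.
Implicit Types (V W : normedModType R).

Lemma continuousP_eps V W (x : V -> W) : continuous x <->
  forall t e, 0 < e -> exists2 d, 0 < d & forall s, `|s - t| < d -> `|x s - x t| < e.
Proof.
split=> [cx t e e0|H t].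
  have /cvgrPdist_lt/(_ e e0)/nbhs_ballP[d d0 Hd] := cx t.
  exists d => // s sd; rewrite distrC; apply: Hd.
  by rewrite -ball_normE /= distrC.
apply/cvgrPdist_lt => e e0; have [d d0 Hd] := H t e e0.
apply/nbhs_ballP; exists d => // s; rewrite -ball_normE /= distrC => /Hd.
by rewrite distrC.
Qed.

(** Only the point s is confined to the segment; the compactness argument
    produces one radius that is valid at all of its points. *)
Lemma segment_unif_continuous V (x : R -> V) (a b : R) : continuous x ->
  forall e, 0 < e -> exists2 d, 0 < d & forall s t, a <= s <= b ->
    `|s - t| < d -> `|x s - x t| < e.
Proof.
move=> /continuousP_eps cx e e0.
have := (@segment_compact R a b).
move=> /compact_near_coveringP /(_ _ (0 : R)^'+
  (fun d s => forall t, `|s - t| < d -> `|x s - x t| < e) _) H.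
have {}H : \forall d \near 0^'+, `[a, b] `<=` (fun s => forall t : R, `|s - t| < d -> `|x s - x t| < e).
  apply: H => s0 _.
  have [d d0 Hd] := cx s0 (e / 2) (halfR_gt0 e0).
  near=> s' d'.
  move=> t st.
  have h1 : `|s' - s0| < d / 2.
    near: s'. apply/nbhs_ballP; exists (d / 2) => /=; first by rewrite divr_gt0.
    by move=> s; rewrite -ball_normE/= distrC.
  have h2 : d' <= d / 2.
    by near: d'; apply: nbhs_right_le; rewrite divr_gt0.
  have h3 : `|t - s0| < d.
    rewrite -(subrK s' t) -addrA (le_lt_trans (ler_normD _ _))// distrC [ltRHS](splitr d).
    by rewrite ltrD// (lt_le_trans st).
  have h4 : `|s' - s0| < d by rewrite (lt_le_trans h1)// ler_pdivrMr// ler_peMr ?ler1n// ltW.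
  rewrite -(subrK (x s0) (x s')) -addrA (le_lt_trans (ler_normD _ _))// [ltRHS](splitr e).
  by rewrite ltrD ?Hd// distrC Hd.
have [d /= d0 Hd] := H.
exists (d / 2); first by rewrite divr_gt0.
move=> s t /andP[as' sb]; apply: (Hd (d / 2)) => /=.
- by rewrite sub0r normrN ger0_norm ?ltr_pdivrMr ?ltr_pMr ?ltr1n// ltW// divr_gt0.
- by rewrite divr_gt0.
- by rewrite /= in_itv/= as'.
Unshelve. all: by end_near. Qed.

Lemma segment_bounded V (x : R -> V) (a b : R) : continuous x ->
  exists2 M, 0 < M & forall s, a <= s <= b -> `|x s| <= M.
Proof.
move=> cx.
have := continuous_compact (continuous_subspaceT cx : {within `[a,b], continuous x}) (@segment_compact R a b).
move=> /compact_bounded /ex_strict_bound_gt0[M M0 HM]; exists M => // s sab.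
by apply/ltW/HM; exists s => //=; rewrite in_itv.
Qed.

(** Differentiability in the form of an error estimate, for values in any
    normed module and for all increments h, including h = 0. *)
Definition has_deriv V (x : R -> V) (t : R) (v : V) :=
  forall e, 0 < e -> exists2 d, 0 < d & forall h, `|h| < d ->
    `|x (t + h) - x t - h *: v| <= e * `|h|.

Lemma has_derivP (x : R -> R) t v : has_deriv x t v <-> is_derive t 1 x v.
Proof.
split=> [H|[dx <-]].
  have H' : h^-1 *: (x (h *: 1 + t) - x t) @[h --> 0^'] --> v.
    apply/cvgrPdist_le => e e0; have [d d0 Hd] := H e e0.
    near=> h.
    have h0 : h != 0 by near: h; exact: nbhs_dnbhs_neq.
    rewrite -(ler_pM2r (_ : 0 < `|h|)) ?normr_gt0// -normrM.
    rewrite [X in `|X|](_ : _ = - (x (t + h) - x t - h *: v)).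
      rewrite normrN; apply: Hd; near: h; exact: dnbhs0_lt.
    rewrite mulrBl /GRing.scale /= mulr1 mulrAC mulVf// mul1r [h + t]addrC.
    by rewrite [RHS]opprB [v * h]mulrC.
  apply: DeriveDef; first by apply/cvg_ex; exists v.
  exact/cvg_lim.
move=> e e0.
have /cvgrPdist_le/(_ e e0) [d /= d0 Hd] := dx.
exists d => // h hd.
have [->|h0] := eqVneq h 0; first by rewrite addr0 subrr scale0r subrr normr0 mulr0.
have := Hd h; rewrite /ball_ /= sub0r normrN => /(_ hd h0).
rewrite -(ler_pM2r (_ : 0 < `|h|)) ?normr_gt0// -normrM.
rewrite mulrBl /GRing.scale /= mulr1 [_^-1 * _]mulrC mulfVK// [h + t]addrC.
by rewrite distrC [_ * h]mulrC.
Unshelve. all: by end_near. Qed.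

Lemma has_derivD V (x y : R -> V) t v w : has_deriv x t v -> has_deriv y t w ->
  has_deriv (fun s => x s + y s) t (v + w).
Proof.
move=> hx hy e e0.
have [d1 d10 H1] := hx (e / 2) (halfR_gt0 e0).
have [d2 d20 H2] := hy (e / 2) (halfR_gt0 e0).
exists (Num.min d1 d2); first by rewrite lt_min d10.
move=> h; rewrite lt_min => /andP[h1 h2].
rewrite scalerDr !opprD (AC (2*2*2) ((1*3*5)*(2*4*6))).
by rewrite (le_trans (ler_normD _ _))// {1}(splitr e) mulrDl lerD// ?H1// H2.
Qed.

Lemma has_derivZ V (x : R -> V) t v k : has_deriv x t v ->
  has_deriv (fun s => k *: x s) t (k *: v).
Proof.
move=> hx e e0.
have k0 : 0 < `|k| + 1 by rewrite ltr_wpDl.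
have [d d0 H] := hx (e / (`|k| + 1)) (divr_gt0 e0 k0).
exists d => // h /H hh; rewrite scalerA [h * k]mulrC -scalerA -!scalerBr normrZ.
rewrite (le_trans (ler_wpM2l _ hh))// mulrA ler_wpM2r// mulrA.
by rewrite ler_pdivrMr// mulrC ler_pM2l// lerDl.
Qed.

Lemma has_derivN V (x : R -> V) t v : has_deriv x t v ->
  has_deriv (fun s => - x s) t (- v).
Proof.
move=> /(has_derivZ (-1)); rewrite scaleN1r.
by congr has_deriv; apply/funext => s; rewrite scaleN1r.
Qed.

Lemma has_derivB V (x y : R -> V) t v w : has_deriv x t v -> has_deriv y t w ->
  has_deriv (fun s => x s - y s) t (v - w).
Proof. by move=> hx hy; apply: has_derivD => //; exact: has_derivN. Qed.

Lemma has_deriv_cst V (c : V) t : has_deriv (fun=> c) t 0.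
Proof.
by move=> e e0; exists 1 => // h _; rewrite scaler0 !subrr normr0 mulr_ge0// ltW.
Qed.

Lemma has_deriv_shift V (x : R -> V) a t v : has_deriv x (a + t) v ->
  has_deriv (fun s => x (a + s)) t v.
Proof.
by move=> hx e e0; have [d d0 H] := hx e e0; exists d => // h; rewrite addrA; exact: H.
Qed.

Lemma has_deriv_near V (x y : R -> V) t v d : 0 < d ->
  (forall s, `|s - t| < d -> x s = y s) -> has_deriv x t v -> has_deriv y t v.
Proof.
move=> d0 xy hx e e0; have [d' d'0 H] := hx e e0.
exists (Num.min d d'); first by rewrite lt_min d0.
move=> h; rewrite lt_min => /andP[h1 h2]; rewrite -!xy ?subrr ?normr0//.
  exact: H.
by rewrite addrC addKr.
Qed.

Lemma has_deriv_sum V (I : Type) (r : seq I) (x : I -> R -> V) t (v : I -> V) :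
  (forall i, has_deriv (x i) t (v i)) ->
  has_deriv (fun s => \sum_(i <- r) x i s) t (\sum_(i <- r) v i).
Proof.
move=> H; elim: r => [|i r IH].
  rewrite big_nil (_ : (fun s => _) = fun=> 0); first exact: has_deriv_cst.
  by apply/funext => s; rewrite big_nil.
rewrite big_cons (_ : (fun s => _) = fun s => x i s + \sum_(i <- r) x i s).
  exact: has_derivD.
by apply/funext => s; rewrite big_cons.
Qed.

Lemma has_deriv_scaler V (f : R -> R) (c : V) t (df : R) : has_deriv f t df ->
  has_deriv (fun s => f s *: c) t (df *: c).
Proof.
move=> hf e e0.
have k0 : 0 < `|c| + 1 by rewrite ltr_wpDl.
have [d d0 H] := hf (e / (`|c| + 1)) (divr_gt0 e0 k0).
exists d => // h /H hh; rewrite scalerA -!scalerBl normrZ.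
rewrite (le_trans (ler_wpM2r _ hh))// mulrAC ler_wpM2r// mulrAC.
by rewrite ler_pdivrMr// ler_pM2l// lerDl.
Qed.

Lemma has_deriv_continuous V (x : R -> V) (t : R) v : has_deriv x t v ->
  {for t, continuous x}.
Proof.
move=> hx; apply/cvgrPdist_lt => e e0.
have [d d0 H] := hx 1 ltr01.
have K0 : 0 < 2 + `|v| by rewrite ltr_wpDr.
have m0 : 0 < Num.min d (e / (2 + `|v|)) by rewrite lt_min d0 divr_gt0.
apply/nbhs_ballP; exists (Num.min d (e / (2 + `|v|))) => // s; rewrite /ball_ /= lt_min [X in (X < d) && _]distrC => /andP[h1 h2].
have := H _ h1; rewrite subrKC mul1r => h3.
rewrite distrC -(subrK ((s - t) *: v) (x s - x t)) (le_lt_trans (ler_normD _ _))//.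
rewrite normrZ (le_lt_trans (lerD h3 (lexx _)))// -[X in X + _]mulr1 -mulrDr distrC.
rewrite (le_lt_trans (y := `|t - s| * (2 + `|v|)))//.
  by rewrite ler_wpM2l// lerD2r ler1n.
by rewrite -ltr_pdivlMr.
Qed.

Lemma deriv_continuous V (x dx : R -> V) :
  (forall t, has_deriv x t (dx t)) -> continuous x.
Proof. by move=> H t; exact: has_deriv_continuous (H t). Qed.

Lemma has_deriv_id (k t : R) : has_deriv (fun s : R => k * s) t k.
Proof.
move=> e e0; exists 1 => // h _; rewrite /GRing.scale/= mulrDr [k * t + _]addrC addrK.
by rewrite [h * k]mulrC subrr normr0 mulr_ge0// ltW.
Qed.

Lemma has_deriv_expR (k t : R) :
  has_deriv (fun s => expR (k * s)) t (k * expR (k * t)).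
Proof.
apply/has_derivP; have := @is_derive1_comp R expR (fun s => k * s) t (expR (k * t)) k.
rewrite [k * expR _]mulrC; apply.
by apply: (@is_derive_eq _ _ _ _ _ _ _ _ (is_deriveZ k (is_derive_id t (1:R)))); rewrite scaler1.
Qed.

(** The difference g - y has a nonnegative derivative, so it increases. *)
Lemma increment_le (y dy g dg : R -> R) a b : a <= b -> continuous y -> continuous g ->
  (forall t, a < t < b -> has_deriv y t (dy t)) ->
  (forall t, a < t < b -> has_deriv g t (dg t)) ->
  (forall t, a < t < b -> dy t <= dg t) -> y b - y a <= g b - g a.
Proof.
move=> ab cy cg hy hg yle; pose k t := g t - y t.
have hk t : a < t < b -> is_derive t 1 k (dg t - dy t).
  by move=> tab; apply/has_derivP; apply: has_derivB; [exact: hg|exact: hy].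
suff : k a <= k b by rewrite /k => ?; lra.
apply: (@ger0_derive1_le_cc R k a b).
- by move=> t; rewrite in_itv/= => /hk[].
- move=> t; rewrite in_itv/= => tab; rewrite derive1E; case: (hk t tab) => _ ->.
  by rewrite subr_ge0 yle.
- exact: (@continuous_subspaceT _ _ _ _ (fun t => continuousB (cg t) (cy t))).
- by rewrite in_itv/= lexx.
- by rewrite in_itv/= lexx ab.
- exact: ab.
Qed.

Lemma scalar_increment_le (f df : R -> R) (k a b : R) : a <= b ->
  continuous f -> (forall t, a < t < b -> has_deriv f t (df t)) ->
  (forall t, a < t < b -> `|df t| <= k) -> `|f b - f a| <= k * (b - a).
Proof.
move=> ab cf hf hle; have ck := deriv_continuous (has_deriv_id k).
rewrite ler_norml mulrBr; apply/andP; split.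
  have := increment_le ab (fun t => continuousN (cf t)) ck
    (fun t tab => has_derivN (hf t tab)) (fun t _ => has_deriv_id k t).
  rewrite opprK addrC lerNl opprB; apply => t /hle; apply: le_trans.
  by rewrite -normrN ler_norm.
apply: (increment_le ab cf ck hf (fun t _ => has_deriv_id k t)) => t /hle.
by apply: le_trans; exact: ler_norm.
Qed.

Lemma deriv_le1_lip (f df : R -> R) x y : (forall t, has_deriv f t (df t)) ->
  (forall t, t < Num.max x y -> `|df t| <= 1) -> `|f x - f y| <= `|x - y|.
Proof.
move=> hf; wlog xy : x y / y <= x.
  move=> H hle; case/orP: (le_total y x) => xy; first exact: H.
  by rewrite distrC [leRHS]distrC; apply: H => // t; rewrite maxC; exact: hle.
rewrite max_l// => hle; rewrite [leRHS]ger0_norm ?subr_ge0// -[leRHS]mul1r.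
apply: (scalar_increment_le xy (deriv_continuous hf) (fun t _ => hf t)) => t /andP[_].
exact: hle.
Qed.

End RealLine.

Section VectorLine.
Context {R : realType} {n : nat}.
Implicit Types x w : R -> 'cV[R]_n.

Lemma coord_le_norm (v : 'cV[R]_n) i : `|v i 0| <= `|v|.
Proof.
by rewrite [leRHS]/Num.Def.normr/= mx_normrE; apply: (le_bigmax _ _ (i, ord0)).
Qed.

Lemma norm_le_coord (v : 'cV[R]_n) M : 0 <= M -> (forall i, `|v i 0| <= M) -> `|v| <= M.
Proof.
move=> M0 H; rewrite /Num.Def.normr/= mx_normrE bigmax_le// => -[i j] _ /=.
by rewrite ord1.
Qed.

Lemma has_deriv_coord x t v : has_deriv x t v <->
  forall i, has_deriv (fun s => x s i 0) t (v i 0).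
Proof.
split=> [H i e e0|H e e0].
  have [d d0 Hd] := H e e0; exists d => // h /Hd.
  by apply: le_trans; apply: le_trans (coord_le_norm _ i); rewrite !mxE.
have /choice [d Hd] : forall i, exists d, 0 < d /\ forall h, `|h| < d ->
    `|x (t + h) i 0 - x t i 0 - h *: v i 0| <= e * `|h|.
  by move=> i; have [d d0 Hd] := H i e e0; exists d.
exists (\big[Num.min/1]_i d i).
  by elim/big_ind: _ => // [a b a0 b0|i _]; [rewrite lt_min a0|case: (Hd i)].
move=> h hd; apply: norm_le_coord; first by rewrite mulr_ge0// ltW.
move=> i; rewrite !mxE; apply: (Hd i).2; apply: (lt_le_trans hd).
by rewrite (bigD1 i)//= ge_min lexx.
Qed.

Lemma coord_continuous x i : continuous x -> continuous (fun s => x s i 0).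
Proof.
move=> /continuousP_eps cx; apply/continuousP_eps => t e e0.
have [d d0 Hd] := cx t e e0; exists d => // s /Hd; apply: le_lt_trans.
by apply: le_trans (coord_le_norm _ i); rewrite !mxE.
Qed.

(** The norm of a vector is the largest absolute value of its coordinates, so the
    mean value inequality reduces to a comparison of g with each coordinate and
    with its opposite. *)
Lemma norm_increment_le x (dx : R -> 'cV[R]_n) (g dg : R -> R) a b : a <= b ->
  continuous x -> continuous g ->
  (forall t, a < t < b -> has_deriv x t (dx t)) ->
  (forall t, a < t < b -> has_deriv g t (dg t)) ->
  (forall t, a < t < b -> `|dx t| <= dg t) ->
  `|x b - x a| <= g b - g a.
Proof.
move=> ab cx cg hx hg hle.
have sc (y dy : R -> R) cy hy := @increment_le R y dy g dg a b ab cy cg hy hg.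
have gi : 0 <= g b - g a.
  have := sc (fun=> 0) (fun=> 0) (@cst_continuous _ _ 0).
  rewrite subrr; apply => [t _|t tab]; first exact: has_deriv_cst.
  by rewrite (le_trans _ (hle t tab)).
apply: norm_le_coord => // i; rewrite !mxE ler_norml; apply/andP; split.
  rewrite lerNl opprB.
  have := sc (fun s => - x s i 0) (fun s => - dx s i 0).
  rewrite opprK addrC; apply => [t|t tab|t tab].
  - by apply: continuousN; exact: coord_continuous.
  - by apply: has_derivN; exact: ((has_deriv_coord _ _ _).1 (hx t tab)).
  - rewrite (le_trans _ (hle t tab))// (le_trans _ (coord_le_norm _ i))//.
    by rewrite -normrN ler_norm.
apply: (sc (fun s => x s i 0) (fun s => dx s i 0)) => [|t tab|t tab].
- exact: coord_continuous.
- exact: ((has_deriv_coord _ _ _).1 (hx t tab)).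
- by rewrite (le_trans _ (hle t tab))// (le_trans _ (coord_le_norm _ i))// ler_norm.
Qed.

Lemma has_deriv_scale (a : R -> R) x t da v : has_deriv a t da -> has_deriv x t v ->
  has_deriv (fun s => a s *: x s) t (da *: x t + a t *: v).
Proof.
move=> /has_derivP ha hx; apply/has_deriv_coord => i.
have /has_derivP hi := (has_deriv_coord _ _ _).1 hx i.
rewrite (_ : (fun s => _) = a \* (fun s => x s i 0)); last by apply/funext => s; rewrite mxE.
apply/has_derivP; apply: (is_derive_eq (is_deriveM ha hi)).
by rewrite !mxE /GRing.scale /= addrC [x t i 0 * _]mulrC.
Qed.

End VectorLine.

(** * Primitives on the line *)

Section Primitive.
Context {R : realType}.

Lemma primitive_right (g : R -> R) (a : R) : continuous g ->
  exists G : R -> R, forall t, a < t -> has_deriv G t (g t).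
Proof.
move=> cg; exists (fun x => (\int[lebesgue_measure]_(t in `[a, x]) g t)%R) => t at_.
apply/has_derivP.
have [] := @continuous_FTC1_closed R g a t (t + 1) _ _ at_ (cg t).
- by rewrite ltrDl.
- by apply: continuous_compact_integrable; [exact: segment_compact|exact: continuous_subspaceT].
- by move=> d <-; rewrite derive1E; exact: DeriveDef.
Qed.

Lemma has_deriv_reflect V (x : R -> V : normedModType R) t v : has_deriv x (- t) v ->
  has_deriv (fun s => x (- s)) t (- v).
Proof.
move=> H e e0; have [d d0 Hd] := H e e0; exists d => // h hd.
have := Hd (- h); rewrite normrN => /(_ hd).
by rewrite opprD scalerN scaleNr.
Qed.

Lemma deriv0_const (g : R -> R) a b : a <= b -> continuous g ->
  (forall t, a < t < b -> has_deriv g t 0) -> g b = g a.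
Proof.
move=> ab cg h; apply/eqP; rewrite -subr_eq0 -normr_le0 -(mul0r (b - a)).
by apply: (scalar_increment_le ab cg h) => t _; rewrite normr0.
Qed.

(** The fundamental theorem of calculus gives a primitive to the right of -1.
    Applied to the reflected function, it gives one to the left of 1. On the
    overlap (-1, 1) they differ by a constant, so they glue at 0. *)
Lemma continuous_primitive (g : R -> R) : continuous g ->
  exists2 G : R -> R, G 0 = 0 & forall t, has_deriv G t (g t).
Proof.
move=> cg.
have cgN : continuous (fun s => g (- s)).
  by move=> t; apply: continuous_comp; [exact: opp_continuous|exact: cg].
have [F hF] := primitive_right (-1) cg.
have [F' hF'] := primitive_right (-1) cgN.
pose P s := F s - F 0; pose Q s := F' 0 - F' (- s).
have hP t : -1 < t -> has_deriv P t (g t).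
  by move=> t1; rewrite -[g t]subr0; apply: has_derivB; [exact: hF|exact: has_deriv_cst].
have hQ t : t < 1 -> has_deriv Q t (g t).
  move=> t1; rewrite -[g t]opprK -[- - g t]add0r.
  apply: has_derivB; first exact: has_deriv_cst.
  apply: has_deriv_reflect; rewrite -[t in g t]opprK; apply: (hF' (- t)).
  by rewrite ltrN2.
have PQ s : -1 < s < 1 -> P s = Q s.
  have PQ0 : P 0 = Q 0 by rewrite /P /Q oppr0 !subrr.
  (* Clamping to [- |s|, |s|] makes the difference of the two primitives continuous on the whole line. *)
  pose cl (u : R) := Num.max (- `|s|) (Num.min `|s| u).
  have D u : -1 < u < 1 -> has_deriv (fun u => P u - Q u) u 0.
    by move=> /andP[u1 u2]; rewrite -(subrr (g u)); apply: has_derivB; [exact: hP|exact: hQ].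
  move=> s1; apply/eqP; rewrite -subr_eq0.
  have s1' : `|s| < 1 by rewrite ltr_norml.
  have ccl : continuous (fun u => P (cl u) - Q (cl u)).
    have ccl : continuous cl.
      move=> u; apply: (@continuous_max R R (cst (- `|s|)) (cst `|s| \min id)).
        exact: cst_continuous.
      by apply: continuous_min; [exact: cst_continuous|exact: cvg_id].
    move=> u; apply: (@continuous_comp _ _ _ cl (fun u => P u - Q u)); first exact: ccl.
    apply: has_deriv_continuous; apply: D.
    have h0 := normr_ge0 s.
    have h1 : - `|s| <= cl u by rewrite /cl le_max lexx.
    have h2 : cl u <= `|s| by rewrite /cl ge_max ge_min lexx andbT; lra.
    by apply/andP; split; lra.
  have key a b : a <= b -> `|a| <= `|s| -> `|b| <= `|s| -> P a - Q a = P b - Q b.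
    have clE u : `|u| <= `|s| -> cl u = u.
      by rewrite ler_norml => /andP[u1 u2]; rewrite /cl min_r// max_r.
    move=> ab as_ bs; have := deriv0_const ab ccl; rewrite !clE// => -> // t /andP[ta tb].
    have [ts1 ts2] : - `|s| < t /\ t < `|s|.
      by move: as_ bs; rewrite !ler_norml => /andP[? ?] /andP[? ?]; split; lra.
    apply: (@has_deriv_near _ _ (fun u => P u - Q u) _ t 0 (Num.min (t + `|s|) (`|s| - t))).
    - rewrite lt_min; apply/andP; split; lra.
    - move=> u; rewrite lt_min !ltr_norml => /andP[/andP[h1 h2] /andP[h3 h4]].
      rewrite clE//; rewrite ler_norml; apply/andP; split; lra.
    - by apply: D; apply/andP; split; lra.
  apply/eqP; case: (leP 0 s) => s0.
    by rewrite -(key 0 s)// ?normr0// PQ0 subrr.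
  by rewrite (key s 0)// ?normr0// ?PQ0 ?subrr// ltW.
exists (fun s => if 0 <= s then P s else Q s).
  by rewrite lexx /P subrr.
move=> t; case: (ltgtP t 0) => t0.
- apply: (@has_deriv_near _ _ Q _ t _ (- t)); [by rewrite oppr_gt0| |by apply: hQ; rewrite (lt_trans t0)].
  move=> s; rewrite ltr_norml => /andP[_ h]; rewrite leNgt ifF//; apply/negbTE/negPn; lra.
- apply: (@has_deriv_near _ _ P _ t _ t); [by []| |by apply: hP; rewrite (lt_trans _ t0)// ltrN10].
  move=> s; rewrite ltr_norml => /andP[h _]; rewrite ifT//; lra.
- apply: (@has_deriv_near _ _ P _ t _ 1); [by []| |by apply: hP; rewrite t0 ltrN10].
  move=> s; rewrite t0 subr0 ltr_norml => h; case: ifP => // _; exact: PQ.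
Qed.

Lemma vector_primitive n (g : R -> 'cV[R]_n) : continuous g ->
  exists2 G : R -> 'cV[R]_n, G 0 = 0 & forall t, has_deriv G t (g t).
Proof.
move=> cg.
have /choice[G HG] : forall i : 'I_n, exists G : R -> R, G 0 = 0 /\ forall t, has_deriv G t (g t i 0).
  by move=> i; have [G G0 hG] := continuous_primitive (coord_continuous (i := i) cg); exists G.
exists (fun t => \col_i G i t); first by apply/colP => i; rewrite !mxE (HG i).1.
move=> t; apply/has_deriv_coord => i.
rewrite (_ : (fun s => _) = G i); first exact: (HG i).2.
by apply/funext => s; rewrite mxE.
Qed.

End Primitive.

(** * Trajectories and their histories *)

Lemma lipschitz_continuous {R : realType} (V W : normedModType R) (f : V -> W) k :
  (forall s t, `|f s - f t| <= k * `|s - t|) -> continuous f.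
Proof.
move=> H; apply/continuousP_eps => t e e0.
have k0 : 0 < `|k| + 1 by rewrite ltr_wpDl.
exists (e / (`|k| + 1)); first by rewrite divr_gt0.
move=> s; rewrite ltr_pdivlMr// => h; apply: (le_lt_trans (H s t)).
apply: le_lt_trans h; rewrite mulrC ler_wpM2l//.
by rewrite (le_trans (ler_norm _))// lerDl.
Qed.

Lemma min0_lip {R : realType} (s t : R) : `|Num.min s 0 - Num.min t 0| <= `|s - t|.
Proof.
have h1 := ler_norm (s - t); have h2 := ler_norm (t - s); rewrite distrC in h2.
by rewrite ler_norml; case: (leP s 0) => a; case: (leP t 0) => b; apply/andP; split; lra.
Qed.

Lemma max0_lip {R : realType} (s t : R) : `|Num.max s 0 - Num.max t 0| <= `|s - t|.
Proof.
have h1 := ler_norm (s - t); have h2 := ler_norm (t - s); rewrite distrC in h2.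
by rewrite ler_norml; case: (leP s 0) => a; case: (leP t 0) => b; apply/andP; split; lra.
Qed.

Section Histories.
Context {R : realType} {n : nat} (eta : R).
Implicit Types x y : R -> 'cV[R]_n.

Definition weighted x (s : R) := expR (eta * s) *: x s.

(** The boundedness and uniform continuity that define BUC, required on every
    half-line (-oo, T]: the functions all of whose histories lie in BUC. *)
Definition traj x := forall T,
  (exists M, forall s, s <= T -> `|weighted x s| <= M) /\
  forall e, 0 < e -> exists2 d, 0 < d & forall s t, s <= T -> t <= T ->
    `|s - t| < d -> `|weighted x s - weighted x t| < e.

Definition hist x (t : R) : BUC n eta := to_buc eta (fun th => x (t + th)).

Lemma unweight x s : x s = expR (- (eta * s)) *: weighted x s.
Proof. by rewrite /weighted scalerA -expRD addNr expR0 scale1r. Qed.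

Lemma expR_lin_continuous (k : R) : continuous (fun s => expR (k * s)).
Proof.
move=> s; apply: (@continuous_comp _ _ _ (fun s => k * s) expR).
  by apply: continuousM; [exact: cst_continuous|exact: cvg_id].
exact: continuous_expR.
Qed.

Lemma traj_continuous x : traj x -> continuous x.
Proof.
move=> tx t.
have -> : x = fun s => expR (- eta * s) *: weighted x s.
  by apply/funext => s; rewrite {1}unweight mulNr.
apply: cvgZ; first exact: expR_lin_continuous.
apply/cvgrPdist_lt => e e0; have [_ /(_ e e0)[d d0 H]] := tx (t + 1).
have m0 : 0 < Num.min d 1 by rewrite lt_min d0 ltr01.
apply/nbhs_ballP; exists (Num.min d 1) => // s; rewrite /ball_ /= lt_min => /andP[h1 h2].
apply: H => //; first by rewrite lerDl.
by move: h2; rewrite distrC ltr_norml => /andP[_ ?]; lra.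
Qed.

Lemma weighted_continuous x : continuous x -> continuous (weighted x).
Proof.
move=> cx s; apply: cvgZ; [exact: expR_lin_continuous|exact: cx].
Qed.

(** A continuous function whose restriction to (-oo, 0] lies in BUC is a
    trajectory: beyond 0 only a compact interval is added. *)
Lemma trajP x : continuous x ->
  (exists M, forall s, s <= 0 -> `|weighted x s| <= M) ->
  (forall e, 0 < e -> exists2 d, 0 < d & forall s t, s <= 0 -> t <= 0 ->
    `|s - t| < d -> `|weighted x s - weighted x t| < e) -> traj x.
Proof.
move=> cx [M HM] Huc T; split.
  have [M' M'0 HM'] := segment_bounded 0 T (weighted_continuous cx).
  exists (Num.max M M') => s sT; rewrite le_max.
  case: (leP s 0) => s0; first by rewrite HM.
  by rewrite HM' ?orbT// sT ltW.
move=> e e0.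
have [d1 d10 H1] := Huc (e / 2) (halfR_gt0 e0).
have [d2 d20 H2] := segment_unif_continuous 0 (Num.max T 0) (weighted_continuous cx) (halfR_gt0 e0).
exists (Num.min d1 d2); first by rewrite lt_min d10.
have E s : weighted x s = weighted x (Num.min s 0) + (weighted x (Num.max s 0) - weighted x 0).
  by case: (leP s 0) => s0; rewrite ?subrr ?addr0// subrKC.
move=> s t sT tT; rewrite lt_min => /andP[h1 h2].
rewrite (E s) (E t) opprD addrACA opprB subrKA.
rewrite (le_lt_trans (ler_normD _ _))// [ltRHS](splitr e) ltrD//.
  by apply: H1; rewrite ?ge_min ?lexx ?orbT// (le_lt_trans (min0_lip s t)).
apply: H2; last by rewrite (le_lt_trans (max0_lip s t)).
by rewrite le_max lexx orbT /= ge_max !le_max sT lexx orbT.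
Qed.

Lemma buc_continuous (phi : BUC n eta) : continuous (phi : R -> 'cV[R]_n).
Proof.
have := buc_funP phi; rewrite inE => -[c _ _ uc].
have -> : (phi : R -> _) = fun s => expR (- eta * Num.min s 0) *: weighted phi (Num.min s 0).
  apply/funext => s; rewrite /weighted scalerA -expRD mulNr addNr expR0 scale1r.
  by case: (leP s 0) => // /ltW /c.
move=> t; apply: cvgZ.
  apply: (@continuous_comp _ _ _ (fun s : R => Num.min s 0) (fun s => expR (- eta * s))).
    exact: minr_continuous.
  exact: expR_lin_continuous.
apply/cvgrPdist_lt => e e0; have [d d0 H] := uc e e0.
apply/nbhs_ballP; exists d => // s; rewrite /ball_ /= => h.
by apply: H; rewrite ?ge_min ?lexx ?orbT// (le_lt_trans (min0_lip _ _)).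
Qed.

Lemma buc_traj (phi : BUC n eta) : traj phi.
Proof.
have := buc_funP phi; rewrite inE => -[_ _ bd uc].
exact: trajP (@buc_continuous phi) bd uc.
Qed.

Lemma traj_shift x a : traj x -> traj (fun s => x (a + s)).
Proof.
move=> tx T; have [[M HM] uc] := tx (a + T).
have E s : weighted (fun s => x (a + s)) s = expR (- (eta * a)) *: weighted x (a + s).
  by rewrite /weighted scalerA -expRD mulrDr addKr.
split.
  exists (expR (- (eta * a)) * M) => s sT.
  by rewrite E normrZ ger0_norm ?expR_ge0// ler_wpM2l ?expR_ge0// HM// lerD2l.
move=> e e0; have [|d d0 H] := uc (expR (eta * a) * e); first by rewrite mulr_gt0// expR_gt0.
exists d => // s t sT tT st; rewrite !E -scalerBr normrZ ger0_norm ?expR_ge0//.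
rewrite expRN mulrC ltr_pdivrMr ?expR_gt0// mulrC; apply: H; rewrite ?lerD2l//.
by rewrite opprD addrACA subrr add0r.
Qed.

Lemma traj_is_buc x : traj x -> is_buc eta (fun th => x (Num.min th 0)).
Proof.
move=> tx; have [bd uc] := tx 0.
split => [th th0||| e /uc[d d0 H]].
- by rewrite min_r// minxx.
- apply: continuous_subspaceT => s; apply: (@continuous_comp _ _ _ (fun s : R => Num.min s 0) x).
    exact: minr_continuous.
  exact: traj_continuous.
- by have [M HM] := bd; exists M => th th0; rewrite min_l//; exact: HM.
- by exists d => // s t s0 t0; rewrite !min_l//; exact: H.
Qed.

Lemma histE x t th : traj x -> hist x t th = x (t + Num.min th 0).
Proof.
move=> tx; rewrite /hist /to_buc.
have H : (fun th => x (t + Num.min th 0)) \in @buc_pred R n eta.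
  by rewrite inE; exact: (traj_is_buc (traj_shift t tx)).
exact: (congr1 (fun f : R -> 'cV[R]_n => f th) (insubdK 0 H)).
Qed.

Lemma hist_norm_le x t M : traj x ->
  (forall s, s <= t -> expR (eta * (s - t)) * `|x s| <= M) -> `|hist x t| <= M.
Proof.
move=> tx H; apply: buc_norm_le => th th0; rewrite histE// min_l//.
by have := H (t + th); rewrite addrAC subrr add0r; apply; rewrite gerDl.
Qed.

Lemma hist_norm_ub x t s : traj x -> s <= t ->
  expR (eta * (s - t)) * `|x s| <= `|hist x t|.
Proof.
move=> tx st; have s0 : s - t <= 0 by rewrite subr_le0.
by have := buc_norm_ub (hist x t) s0; rewrite histE// min_l// subrKC.
Qed.

Lemma norm_le_hist x t : traj x -> `|x t| <= `|hist x t|.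
Proof. by move=> tx; have := hist_norm_ub tx (lexx t); rewrite subrr mulr0 expR0 mul1r. Qed.

(** Elements of BUC are represented by functions that are constant on the right
    of 0, so their values on (-oo, 0] determine them. *)
Lemma eq_buc (phi psi : BUC n eta) : (forall th, th <= 0 -> phi th = psi th) -> phi = psi.
Proof.
move=> H; apply/val_inj/funext => t /=; case: (leP t 0) => [/H//|/ltW t0].
have := buc_funP phi; have := buc_funP psi; rewrite !inE => -[c _ _ _] [c' _ _ _].
by rewrite c// c'//; exact: H.
Qed.

Lemma trajD x y : traj x -> traj y -> traj (fun s => x s + y s).
Proof.
move=> tx ty T; have [[M HM] uc] := tx T; have [[M' HM'] uc'] := ty T.
have E s : weighted (fun s => x s + y s) s = weighted x s + weighted y s by rewrite /weighted scalerDr.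
split.
  exists (M + M') => s sT; rewrite E (le_trans (ler_normD _ _))// lerD ?HM ?HM'//.
move=> e e0; have [d d0 H] := uc _ (halfR_gt0 e0); have [d' d'0 H'] := uc' _ (halfR_gt0 e0).
exists (Num.min d d'); first by rewrite lt_min d0.
move=> s t sT tT; rewrite lt_min => /andP[h h'].
rewrite !E opprD addrACA (le_lt_trans (ler_normD _ _))// [ltRHS](splitr e).
by rewrite ltrD ?H ?H'.
Qed.

Lemma trajZ k x : traj x -> traj (fun s => k *: x s).
Proof.
move=> tx T; have [[M HM] uc] := tx T.
have E s : weighted (fun s => k *: x s) s = k *: weighted x s.
  by rewrite /weighted !scalerA mulrC.
have k0 : 0 < `|k| + 1 by rewrite ltr_wpDl.
split; first by exists (`|k| * M) => s sT; rewrite E normrZ ler_wpM2l// HM.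
move=> e e0; have [d d0 H] := uc (e / (`|k| + 1)) (divr_gt0 e0 k0).
exists d => // s t sT tT st; have := H s t sT tT st; rewrite !E -scalerBr normrZ ltr_pdivlMr//.
by apply: le_lt_trans; rewrite mulrC ler_wpM2l// lerDl.
Qed.

Lemma traj0 : traj (fun=> 0).
Proof.
by move=> T; split=> [|e e0]; [exists 0|exists 1] => // *; rewrite /weighted !scaler0 ?subrr normr0.
Qed.

Lemma trajN x : traj x -> traj (fun s => - x s).
Proof.
by move=> /(trajZ (-1)); congr traj; apply/funext => s; rewrite scaleN1r.
Qed.

Lemma trajB x y : traj x -> traj y -> traj (fun s => x s - y s).
Proof. by move=> tx ty; apply: trajD => //; exact: trajN. Qed.

Lemma traj_sum (I : Type) (r : seq I) (x : I -> R -> 'cV[R]_n) :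
  (forall i, traj (x i)) -> traj (fun s => \sum_(i <- r) x i s).
Proof.
move=> H; elim: r => [|i r IH].
  by rewrite (_ : (fun s => _) = fun=> 0); [exact: traj0|apply/funext => s; rewrite big_nil].
rewrite (_ : (fun s => _) = fun s => x i s + \sum_(i <- r) x i s); first exact: trajD.
by apply/funext => s; rewrite big_cons.
Qed.

Lemma bucDE (phi psi : BUC n eta) th : (phi + psi) th = phi th + psi th. Proof. by []. Qed.
Lemma bucZE k (phi : BUC n eta) th : (k *: phi) th = k *: phi th. Proof. by []. Qed.
Lemma bucBE (phi psi : BUC n eta) th : (phi - psi) th = phi th - psi th.
Proof. by rewrite -scaleN1r bucDE bucZE scaleN1r. Qed.

Lemma histD x y t : traj x -> traj y -> hist (fun s => x s + y s) t = hist x t + hist y t.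
Proof.
by move=> tx ty; apply: eq_buc => th _; rewrite bucDE !histE//; exact: trajD.
Qed.

Lemma histZ k x t : traj x -> hist (fun s => k *: x s) t = k *: hist x t.
Proof. by move=> tx; apply: eq_buc => th _; rewrite bucZE !histE//; exact: trajZ. Qed.

Lemma histB x y t : traj x -> traj y -> hist (fun s => x s - y s) t = hist x t - hist y t.
Proof.
by move=> tx ty; apply: eq_buc => th _; rewrite bucBE !histE//; exact: trajB.
Qed.

Lemma hist_sum (I : Type) (r : seq I) (x : I -> R -> 'cV[R]_n) t :
  (forall i, traj (x i)) ->
  hist (fun s => \sum_(i <- r) x i s) t = \sum_(i <- r) hist (x i) t.
Proof.
move=> H; elim: r => [|i r IH].
  rewrite big_nil; apply: eq_buc => th _; rewrite histE ?big_nil//.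
  exact: (traj_sum [::] H).
rewrite big_cons -IH -histD//; last exact: traj_sum.
by congr hist; apply/funext => s; rewrite big_cons.
Qed.

Lemma hist_shift x a t : hist (fun s => x (a + s)) t = hist x (a + t).
Proof. by rewrite /hist; congr to_buc; apply/funext => th; rewrite addrA. Qed.

Lemma hist_buc (phi : BUC n eta) : hist phi 0 = phi.
Proof. by apply: eq_buc => th th0; rewrite histE; [rewrite add0r min_l|exact: buc_traj]. Qed.

(** The norm of x_s - x_t involves u -> x(s + u) - x(t + u) weighted by
    exp(eta u). In terms of the function exp(eta r) x(r), this is a difference of
    nearby values, small by uniform continuity, plus a bounded value times the
    difference of the factors exp(- eta s) and exp(- eta t). *)
Lemma hist_continuous x : traj x -> continuous (hist x).
Proof.
move=> tx; apply/continuousP_eps => t e e0.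
have [[M0 HM0] uc] := tx (t + 1).
have [M M_0 HM] : exists2 M, 0 < M & forall s, s <= t + 1 -> `|weighted x s| <= M.
  by exists (`|M0| + 1) => [|s /HM0 h]; [rewrite ltr_wpDl|rewrite (le_trans h)// (le_trans (ler_norm _))// lerDl].
have [N N0 HN] := segment_bounded (t - 1) (t + 1) (expR_lin_continuous (k := - eta)).
have [d1 d10 H1] := uc _ (divr_gt0 (halfR_gt0 (halfR_gt0 e0)) N0).
have /continuousP_eps /(_ t _ (divr_gt0 (halfR_gt0 (halfR_gt0 e0)) M_0)) [d2 d20 H2] :=
  expR_lin_continuous (k := - eta).
exists (Num.min 1 (Num.min d1 d2)); first by rewrite !lt_min ltr01 d10.
move=> s; rewrite !lt_min => /and3P[h0 h1 h2].
have {h0} /andP[h0 h0'] : t - 1 <= s <= t + 1.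
  by move: h0; rewrite ltr_norml => /andP[? ?]; apply/andP; split; lra.
have tB : traj (fun u => x (s + u) - x (t + u)) by apply: trajB; exact: traj_shift.
rewrite (_ : _ - _ = hist (fun u => x (s + u) - x (t + u)) 0); last first.
  by rewrite histB; [rewrite !hist_shift !addr0|exact: traj_shift|exact: traj_shift].
apply: (@le_lt_trans _ _ (e / 2)); last by rewrite ltr_pdivrMr// ltr_pMr// ltr1n.
apply: hist_norm_le => // u u0; rewrite subr0.
have su : s + u <= t + 1 by lra.
have tu : t + u <= t + 1 by lra.
have -> : expR (eta * u) * `|x (s + u) - x (t + u)| =
   `|expR (- eta * s) *: (weighted x (s + u) - weighted x (t + u)) +
     (expR (- eta * s) - expR (- eta * t)) *: weighted x (t + u)|.
  rewrite -[in LHS](ger0_norm (expR_ge0 _)) -normrZ; congr (`| _ |).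
  rewrite [in RHS]scalerBl [in RHS]scalerBr [in RHS]addrA [in RHS]subrK /weighted !scalerA -!expRD !mulrDr !mulNr.
  by rewrite !addKr scalerBr.
rewrite (le_trans (ler_normD _ _))// [leRHS](splitr (e / 2)) lerD// normrZ.
  rewrite -[leRHS](divfK (lt0r_neq0 N0)) mulrC ler_pM ?normr_ge0//.
    by apply/ltW/H1; rewrite // opprD addrACA subrr addr0.
  by rewrite HN// h0.
rewrite -[leRHS](divfK (lt0r_neq0 M_0)) ler_pM ?normr_ge0//.
  exact/ltW/H2.
exact: HM.
Qed.

(** This is how the integral equation with initial history phi is solved: y is a
    primitive of the right-hand side. *)
Lemma glue_traj (phi : BUC n eta) y : continuous y ->
  traj (fun t => phi t + (y (Num.max t 0) - y 0)).
Proof.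
move=> cy; apply: trajD; first exact: buc_traj.
apply: trajP => [t||e e0].
- apply: continuousB; last exact: cst_continuous.
  apply: (@continuous_comp _ _ _ (fun s : R => Num.max s 0) y); last exact: cy.
  exact: maxr_continuous.
- by exists 0 => s s0; rewrite /weighted max_r// subrr scaler0 normr0.
- by exists 1 => // s t s0 t0 _; rewrite /weighted !max_r// subrr !scaler0 subrr normr0.
Qed.

Lemma hist_glue (phi : BUC n eta) x : traj x -> (forall t, t <= 0 -> x t = phi t) ->
  hist x 0 = phi.
Proof.
by move=> tx H; apply: eq_buc => th th0; rewrite histE// add0r min_l// H.
Qed.

End Histories.

(** * Gronwall's inequality and Picard iteration *)

(** The increments are dominated by a geometric series, whose tail bounds the
    distance to the limit. *)
Lemma geometric_limit {R : realType} n (u : nat -> 'cV[R]_n) (c : R) : 0 <= c ->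
  (forall k, `|u k.+1 - u k| <= c * 2^-1 ^+ k) ->
  exists l, forall k, `|l - u k| <= 2 * c * 2^-1 ^+ k.
Proof.
move=> c0 H.
have Hj k j : `|u (k + j)%N - u k| <= 2 * c * 2^-1 ^+ k * (1 - 2^-1 ^+ j).
  elim: j => [|j IH]; first by rewrite addn0 !subrr normr0 mulr0.
  rewrite addnS -(subrK (u (k + j)%N) (u _.+1)) -addrA (le_trans (ler_normD _ _))//.
  rewrite (le_trans (lerD (H _) IH))// exprD exprS.
  rewrite [leRHS](_ : _ = c * (2^-1 ^+ k * 2^-1 ^+ j) + 2 * c * 2^-1 ^+ k * (1 - 2^-1 ^+ j))//.
  by field.
have Hk k j : (k <= j)%N -> `|u j - u k| <= 2 * c * 2^-1 ^+ k.
  move=> /subnKC <-; apply: (le_trans (Hj _ _)); apply: ler_piMr.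
    by rewrite !mulr_ge0// exprn_ge0// invr_ge0.
  by rewrite lerBlDr lerDl exprn_ge0// invr_ge0.
have small : (2 * c * 2^-1 ^+ k @[k --> \oo]) --> (0 : R).
  rewrite -[0](mulr0 (2 * c)); apply: cvgM; first exact: cvg_cst.
  by apply: cvg_expr; rewrite ger0_norm// invf_lt1// ltr1n.
have cu : cvg (u @ \oo).
  apply: cauchy_cvg; apply: cauchy_exP => e e0.
  have /cvgrPdist_lt /(_ e e0) [N _ HN] := small.
  exists (u N); exists N => // j /= Nj; rewrite -ball_normE /= distrC.
  apply: (le_lt_trans (Hk _ _ Nj)); have := HN N (leqnn _).
  by rewrite sub0r normrN; apply: le_lt_trans; exact: ler_norm.
exists (lim (u @ \oo)) => k.
have h : `|u j - u k| @[j --> \oo] --> `|lim (u @ \oo) - u k|.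
  by apply: cvg_norm; apply: cvgB => //; exact: cvg_cst.
by apply: (cvgr_to_le h); exists k => // j /= /Hk.
Qed.

Section Equations.
Context {R : realType} {n : nat} (eta : R) (eta0 : 0 < eta).
Implicit Types x y w : R -> 'cV[R]_n.
Notation traj := (traj eta).
Notation hist := (hist eta).

(** The derivative of exp(eta s) x(s) is bounded, which gives uniform
    continuity. *)
Lemma traj_of_bounded_deriv (x dx : R -> 'cV[R]_n) M M' :
  (forall s, has_deriv x s (dx s)) -> (forall s, s <= 0 -> `|weighted eta x s| <= M) ->
  (forall s, s <= 0 -> `|weighted eta dx s| <= M') -> traj x.
Proof.
move=> hx hM hM'.
have cx := deriv_continuous hx.
apply: trajP => //; first by exists M.
have hw s : has_deriv (weighted eta x) s (eta *: weighted eta x s + weighted eta dx s).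
  by have := has_deriv_scale (has_deriv_expR eta s) (hx s); rewrite -scalerA.
pose K := eta * M + M'.
have K0 : 0 <= K.
  apply: addr_ge0; last by apply: le_trans (hM' 0 (lexx 0)); exact: normr_ge0.
  by apply: mulr_ge0; [exact: ltW|apply: le_trans (hM 0 (lexx 0)); exact: normr_ge0].
have lip s t : s <= t -> t <= 0 -> `|weighted eta x t - weighted eta x s| <= K * (t - s).
  move=> st t0; rewrite mulrBr.
  apply: (norm_increment_le st (weighted_continuous cx) (deriv_continuous (has_deriv_id K))
    (fun t _ => hw t) (fun t _ => has_deriv_id K t)).
  move=> r /andP[_ rt]; have r0 : r <= 0 by rewrite (le_trans (ltW rt)).
  rewrite (le_trans (ler_normD _ _))// lerD ?hM'// normrZ gtr0_norm// ler_pM2l//.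
  exact: hM.
move=> e e0; have K1 : 0 < K + 1 by rewrite ltr_wpDl.
exists (e / (K + 1)); first exact: divr_gt0.
have sym s t : s <= t -> t <= 0 -> `|s - t| < e / (K + 1) -> `|weighted eta x t - weighted eta x s| < e.
  move=> st t0; rewrite ltr_pdivlMr// => h; apply: (le_lt_trans (lip s t st t0)).
  apply: le_lt_trans h; rewrite distrC ger0_norm ?subr_ge0// mulrC ler_wpM2l ?subr_ge0//.
  by rewrite lerDl.
move=> s t s0 t0 h; case: (leP s t) => [st|/ltW ts]; first by rewrite distrC; exact: sym.
by apply: sym => //; rewrite distrC.
Qed.

Lemma hist_norm_split x t M : traj x -> 0 <= t -> `|hist x 0| <= M ->
  (forall s, 0 <= s <= t -> `|x s| <= M) -> `|hist x t| <= M.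
Proof.
move=> tx t0 h0 h; apply: hist_norm_le => // s st; case: (leP s 0) => s0.
  apply: (le_trans _ h0); apply: (le_trans _ (hist_norm_ub tx s0)).
  by rewrite subr0 ler_wpM2r// ler_expR ler_pM2l// gerBl.
rewrite -[leRHS]mul1r ler_pM ?expR_ge0 ?normr_ge0//; last by rewrite h// ltW.
by rewrite -expR0 ler_expR -(mulr0 eta) ler_pM2l// subr_le0.
Qed.

(** Gronwall's inequality with memory. Let m be the maximum over [0, T] of
    exp(-2lt) |x_t|. The integral of l m exp(2ls) is at most m exp(2lt) / 2, so
    the memory term contributes at most m / 2 to m and can be absorbed. *)
Lemma gronwall x (dx : R -> 'cV[R]_n) (l r T : R) : 0 < l -> 0 <= r -> 0 <= T ->
  traj x ->
  (forall t, 0 < t < T -> has_deriv x t (dx t)) ->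
  (forall t, 0 < t < T -> `|dx t| <= l * `|hist x t| + r) ->
  forall t, 0 <= t <= T -> `|hist x t| <= 2 * expR (2 * l * t) * (`|hist x 0| + r * T).
Proof.
move=> l0 r0 T0 tx hx hle.
have ch : continuous (fun t => expR (- (2 * l) * t) * `|hist x t|).
  move=> t; apply: cvgM; first exact: expR_lin_continuous.
  by apply: cvg_norm; exact: hist_continuous.
have [t0 t0T ht0] := @EVT_max R _ 0 T T0 (continuous_subspaceT ch).
set m := expR (- (2 * l) * t0) * `|hist x t0| in ht0.
have m0 : 0 <= m by rewrite mulr_ge0 ?expR_ge0.
have Hm t : 0 <= t <= T -> `|hist x t| <= m * expR (2 * l * t).
  move=> tT; have := ht0 t; rewrite in_itv/= => /(_ tT).
  by rewrite mulNr expRN mulrC ler_pdivrMr ?expR_gt0.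
have Hx t : 0 <= t <= T -> `|x t| <= `|hist x 0| + m / 2 * expR (2 * l * t) + r * T.
  move=> /andP[t_0 tT].
  have := @norm_increment_le R n x dx (fun s => m / 2 * expR (2 * l * s) + r * s)
    (fun s => m / 2 * (2 * l * expR (2 * l * s)) + r) 0 t t_0 (traj_continuous tx).
  have lt s : 0 < s < t -> 0 < s < T.
    by move=> /andP[-> /= h]; exact: lt_le_trans h tT.
  have hg s : has_deriv (fun s => m / 2 * expR (2 * l * s) + r * s) s (m / 2 * (2 * l * expR (2 * l * s)) + r).
    by apply: has_derivD; [apply: (has_derivZ (m / 2)); exact: has_deriv_expR|exact: has_deriv_id].
  move=> /(_ (deriv_continuous hg) (fun s h => hx s (lt s h)) (fun s _ => hg s)) H.
  have {}H : `|x t - x 0| <= m / 2 * expR (2 * l * t) + r * t - (m / 2 * expR (2 * l * 0) + r * 0).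
    apply: H => s /lt sT; apply: (le_trans (hle s sT)); rewrite lerD2r.
    have := Hm s; move: (sT) => /andP[/ltW -> /ltW ->] /(_ isT) h.
    apply: (le_trans (ler_wpM2l (ltW l0) h)).
    rewrite (_ : m / 2 * _ = l * (m * expR (2 * l * s)))//; by field.
  rewrite mulr0 expR0 mulr1 mulr0 addr0 in H.
  rewrite -(subrK (x 0) (x t)) (le_trans (ler_normD _ _))//.
  rewrite addrC -addrA lerD ?norm_le_hist// (le_trans H)//.
  rewrite (le_trans (y := m / 2 * expR (2 * l * t) + r * t)) ?gerBl ?divr_ge0//.
  by rewrite lerD2l ler_wpM2l.
have Hh t : 0 <= t <= T -> `|hist x t| <= `|hist x 0| + m / 2 * expR (2 * l * t) + r * T.
  move=> /andP[t_0 tT]; apply: hist_norm_split => // [|s /andP[s0 st]].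
    by rewrite -addrA lerDl addr_ge0 ?mulr_ge0 ?expR_ge0 ?invr_ge0.
  apply: (le_trans (Hx s _)); first by rewrite s0 (le_trans st).
  rewrite lerD2r lerD2l ler_wpM2l ?divr_ge0// ler_expR ler_wpM2l//.
  by rewrite mulr_ge0// ltW.
have mle : m <= 2 * (`|hist x 0| + r * T).
  have h1 := Hh t0; rewrite in_itv/= in t0T; move: (h1 t0T).
  have e1 : expR (- (2 * l) * t0) <= 1.
    by rewrite -expR0 ler_expR mulNr oppr_le0 !mulr_ge0 ?(ltW l0)//; case/andP: t0T.
  move=> /(ler_wpM2l (expR_ge0 (- (2 * l) * t0))); rewrite -/m.
  rewrite (_ : expR _ * _ = expR (- (2 * l) * t0) * (`|hist x 0| + r * T) + m / 2 * (expR (- (2 * l) * t0) * expR (2 * l * t0))); last by ring.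
  rewrite -expRD mulNr addNr expR0 mulr1 => h.
  have : expR (- (2 * l) * t0) * (`|hist x 0| + r * T) <= `|hist x 0| + r * T.
    by rewrite ler_piMl// addr_ge0// mulr_ge0.
  rewrite mulNr => h2; have h3 := le_trans h (lerD h2 (lexx _)).
  clearbody m; clear -h3; lra.
move=> t tT; rewrite mulrAC; apply: (le_trans (Hm t tT)).
by rewrite ler_wpM2r ?expR_ge0.
Qed.

Section Picard.
Variables (F : BUC n eta -> 'cV[R]_n) (K : R).
Hypothesis K0 : 0 < K.
Hypothesis FK : forall phi psi, `|F phi - F psi| <= K * `|phi - psi|.
Variable phi : BUC n eta.

Lemma field_continuous x : traj x -> continuous (fun t => F (hist x t)).
Proof.
move=> tx t; apply: (@continuous_comp _ _ _ (hist x) F); first exact: hist_continuous.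
exact: (lipschitz_continuous FK).
Qed.

Let extends_phi x := [/\ traj x & forall t, t <= 0 -> x t = phi t].

Lemma picard_step x : traj x -> exists y,
  extends_phi y /\ forall t, 0 < t -> has_deriv y t (F (hist x t)).
Proof.
move=> tx; have [G G0 hG] := vector_primitive (field_continuous tx).
exists (fun t => phi t + (G (Num.max t 0) - G 0)); split.
  split; first exact: glue_traj (deriv_continuous hG).
  by move=> t t0; rewrite max_r// subrr addr0.
move=> t t0.
apply: (@has_deriv_near _ _ (fun s => phi 0 + (G s - G 0)) _ t _ t t0).
  move=> s; rewrite ltr_norml => /andP[h _]; have s0 : 0 <= s by lra.
  rewrite max_l//; congr (_ + _).
  by have := buc_funP phi; rewrite inE => -[c _ _ _]; rewrite c.
rewrite -[F _]add0r; apply: has_derivD; first exact: has_deriv_cst.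
by rewrite -[F _]subr0; apply: has_derivB => //; exact: has_deriv_cst.
Qed.

Let E t := expR (2 * K * t).

(** In the norm weighted by exp(-2Kt) the Picard map is a contraction with factor
    1/2. *)
Lemma picard_contract x y x' y' c : 0 <= c -> extends_phi x -> extends_phi y ->
  extends_phi x' -> extends_phi y' ->
  (forall t, 0 < t -> has_deriv x' t (F (hist x t))) ->
  (forall t, 0 < t -> has_deriv y' t (F (hist y t))) ->
  (forall t, 0 <= t -> `|x t - y t| <= c * E t) ->
  forall t, 0 <= t -> `|x' t - y' t| <= c / 2 * E t.
Proof.
move=> c0 [tx xphi] [ty yphi] [tx' x'phi] [ty' y'phi] hx' hy' H t t0.
have Hh s : 0 <= s -> `|hist x s - hist y s| <= c * E s.
  move=> s0; rewrite -histB//; apply: hist_norm_split => //; first exact: trajB.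
    rewrite histB// (hist_glue tx xphi) (hist_glue ty yphi) subrr normr0.
    by rewrite mulr_ge0 ?expR_ge0.
  move=> u /andP[u0 us]; apply: (le_trans (H u u0)).
  by rewrite ler_wpM2l// ler_expR ler_wpM2l// mulr_ge0// ltW.
have hg s : has_deriv (fun s => c / 2 * E s) s (c / 2 * (2 * K * E s)).
  by apply: (has_derivZ (c / 2)); exact: has_deriv_expR.
have := @norm_increment_le R n (fun s => x' s - y' s) (fun s => F (hist x s) - F (hist y s))
  (fun s => c / 2 * E s) (fun s => c / 2 * (2 * K * E s)) 0 t t0
  (traj_continuous (trajB tx' ty')) (deriv_continuous hg) _ (fun s _ => hg s).
rewrite (x'phi 0 (lexx 0)) (y'phi 0 (lexx 0)) subrr subr0 => h.
apply: le_trans (h _ _) _.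
- by move=> s /andP[s0 _]; apply: has_derivB; [exact: hx'|exact: hy'].
- move=> s /andP[s0 _]; apply: (le_trans (FK _ _)).
  rewrite (_ : c / 2 * _ = K * (c * E s)); last by field.
  by rewrite ler_wpM2l ?(ltW K0)// Hh// ltW.
by rewrite gerBl mulr_ge0 ?expR_ge0// divr_ge0.
Qed.

(** Consecutive Picard iterates differ by at most C 2^(-k) exp(2Kt), so they
    converge uniformly on bounded intervals; the limit x is a fixed point, because
    the Picard map sends it to a function y at distance 0. *)
Lemma picard_solution : exists x, [/\ traj x, (forall t, t <= 0 -> x t = phi t) &
  forall t, 0 < t -> has_deriv x t (F (hist x t))].
Proof.
have base : extends_phi phi by split => //; exact: buc_traj.
have /choice[N HN] : forall x, exists y, traj x ->
    extends_phi y /\ forall t, 0 < t -> has_deriv y t (F (hist x t)).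
  move=> x; have [tx|ntx] := pselect (traj x); last by exists x.
  by have [y Hy] := picard_step tx; exists y.
pose u k := iter k N (phi : R -> 'cV[R]_n).
have ue k : extends_phi (u k) by elim: k => //= k [tu _]; have [] := HN _ tu.
have ud k t : 0 < t -> has_deriv (u k.+1) t (F (hist (u k) t)).
  by move=> t0; have [tu _] := ue k; have [_] := HN _ tu; apply.
pose c := `|F 0| + K * `|phi|.
have c0 : 0 <= c by rewrite addr_ge0// mulr_ge0// ltW.
pose C := c / (2 * K).
have C0 : 0 <= C by rewrite divr_ge0// mulr_ge0// ltW.
have step k t : 0 <= t -> `|u k.+1 t - u k t| <= C * 2^-1 ^+ k * E t.
  elim: k t => [|k IH] t t0; last first.
    rewrite exprS [2^-1 * _]mulrC mulrA; apply: (@picard_contract (u k.+1) (u k)) => //; [|exact: ud|exact: ud].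
    by rewrite mulr_ge0// exprn_ge0.
  rewrite expr0 mulr1.
  have hg s : has_deriv (fun s => C * E s) s (C * (2 * K * E s)).
    by apply: (has_derivZ C); exact: has_deriv_expR.
  have := @norm_increment_le R n (fun s => u 1%N s - u 0%N s) (fun s => F (hist phi s))
    (fun s => C * E s) (fun s => C * (2 * K * E s)) 0 t t0
    (traj_continuous (trajB (ue 1%N).1 (ue 0%N).1)) (deriv_continuous hg) _ (fun s _ => hg s).
  rewrite ((ue 1%N).2 0 (lexx 0)) ((ue 0%N).2 0 (lexx 0)) subrr subr0 => h.
  apply: le_trans (h _ _) _.
  - move=> s /andP[s0 _]; rewrite -[F _]subr0; apply: has_derivB; first exact: (ud 0%N).
    apply: (@has_deriv_near _ _ (fun=> phi 0) _ s _ s s0); last exact: has_deriv_cst.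
    move=> v; rewrite ltr_norml => /andP[hv _]; have v0 : 0 <= v by lra.
    by have := buc_funP phi; rewrite inE => -[cc _ _ _]; rewrite /= cc.
  - move=> s /andP[s0 _].
    have -> : C * (2 * K * E s) = c * E s by rewrite /C mulrA divfK// gt_eqF// mulr_gt0.
    rewrite (le_trans (y := c))//; last first.
      by rewrite ler_peMr// -expR0 ler_expR !mulr_ge0// ltW.
    rewrite -(subrK (F 0) (F _)) addrC (le_trans (ler_normD _ _))// lerD2l.
    apply: (le_trans (FK _ _)); rewrite subr0 ler_wpM2l ?(ltW K0)//.
    apply: hist_norm_split => //; [exact: buc_traj|exact: ltW|by rewrite hist_buc|].
    move=> v /andP[v0 _]; have := buc_funP phi; rewrite inE => -[cc _ _ _].
    by rewrite cc// (le_trans (norm_le_hist 0 (buc_traj phi)))// hist_buc.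
  by rewrite gerBl mulr_ge0 ?expR_ge0.
clearbody C.
have lim_ex t : exists l, (t <= 0 -> l = phi t) /\ (0 <= t -> forall k, `|l - u k t| <= 2 * C * E t * 2^-1 ^+ k).
  case: (leP t 0) => t0.
    exists (phi t); split => // _ k; rewrite (ue k).2// subrr normr0.
    by rewrite mulr_ge0 ?exprn_ge0 ?invr_ge0// mulr_ge0 ?expR_ge0// mulr_ge0.
  have [l Hl] := @geometric_limit R n (fun k => u k t) (C * E t) (mulr_ge0 C0 (expR_ge0 _))
    (fun k => eq_ind _ (fun z => `|u k.+1 t - u k t| <= z) (step k t (ltW t0)) _ (mulrAC _ _ _)).
  by exists l; split => // _ k; rewrite -[2 * C * _]mulrA.
have /choice[x Hx] := lim_ex.
have xphi t : t <= 0 -> x t = phi t by have [] := Hx t.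
have xu t k : 0 <= t -> `|x t - u k t| <= 2 * C * 2^-1 ^+ k * E t.
  by move=> t0; rewrite mulrAC; have [_] := Hx t; apply.
have small e : 0 < e -> exists k, 2 * C * 2^-1 ^+ k < e.
  move=> e0; have h : (2 * C * 2^-1 ^+ k @[k --> \oo]) --> (0 : R).
    rewrite -[0](mulr0 (2 * C)); apply: cvgM; first exact: cvg_cst.
    by apply: cvg_expr; rewrite ger0_norm// invf_lt1// ltr1n.
  have /cvgrPdist_lt /(_ e e0) [k _ Hk] := h.
  exists k; have := Hk k (leqnn _); rewrite sub0r normrN; apply: le_lt_trans; exact: ler_norm.
have tx : traj x.
  apply: trajP.
  - apply/continuousP_eps => t e e0.
    have e3 : 0 < e / 3 by rewrite divr_gt0.
    have [k Hk] := small (e / 3 / E (t + 1)) (divr_gt0 e3 (expR_gt0 _)).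
    have /continuousP_eps /(_ t _ e3)[d d0 Hd] := traj_continuous (ue k).1.
    exists (Num.min d 1); first by rewrite lt_min d0 ltr01.
    move=> s; rewrite lt_min => /andP[/Hd h1 h2].
    have near v : v <= t + 1 -> `|x v - u k v| < e / 3.
      move=> vt; case: (leP v 0) => v0.
        by rewrite xphi// (ue k).2// subrr normr0.
      apply: (le_lt_trans (xu v k (ltW v0))); move: Hk; rewrite ltr_pdivlMr ?expR_gt0//.
      apply: le_lt_trans; rewrite ler_wpM2l//; first by rewrite !mulr_ge0 ?exprn_ge0.
      by rewrite ler_expR ler_wpM2l// mulr_ge0// ltW.
    have h3 : `|x s - u k s| < e / 3.
      by apply: near; move: h2; rewrite ltr_norml => /andP[_ ?]; lra.
    have h4 : `|u k t - x t| < e / 3 by rewrite distrC near// lerDl.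
    have -> : x s - x t = (x s - u k s) + ((u k s - u k t) + (u k t - x t)).
      by rewrite !addrA !subrK.
    apply: (le_lt_trans (ler_normD _ _)); have := ler_normD (u k s - u k t) (u k t - x t); lra.
  - have [[M HM] _] := buc_traj phi 0; exists M => s s0; rewrite /weighted xphi//; exact: HM.
  - move=> e e0; have [_ /(_ e e0)[d d0 Hd]] := buc_traj phi 0; exists d => // s t s0 t0.
    by rewrite /weighted !xphi//; exact: Hd.
have [y [[ty yphi] hy]] := picard_step tx.
suff xy : x = y by exists x; split => //; rewrite {1}xy.
apply/funext => t; case: (leP t 0) => t0; first by rewrite xphi// yphi.
apply/eqP; rewrite -subr_eq0 -normr_le0; apply/ler_addgt0Pl => e e0; rewrite addr0.
have [k Hk] := small (e / 2 / E t) (divr_gt0 (halfR_gt0 e0) (expR_gt0 _)).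
have h1 := xu t k.+1 (ltW t0).
have h2 : `|y t - u k.+1 t| <= 2 * C * 2^-1 ^+ k / 2 * E t.
  apply: (@picard_contract x (u k) y (u k.+1) _ _ _ (ue k) _ (ue k.+1) hy (ud k)).
  - by rewrite !mulr_ge0 ?exprn_ge0.
  - by split.
  - by split.
  - by move=> s s0; exact: xu.
  - exact: ltW.
rewrite -(subrK (u k.+1 t) (x t)) -addrA (le_trans (ler_normD _ _))//.
rewrite [in X in _ + X]distrC (le_trans (lerD h1 h2))//.
move: Hk; rewrite ltr_pdivlMr ?expR_gt0// exprS => Hk.
set z := 2^-1 ^+ k in Hk *; set w := E t in Hk *.
have -> : 2 * C * (2^-1 * z) * w + 2 * C * z / 2 * w = 2 * C * z * w by field.
by apply/ltW/(lt_le_trans Hk); rewrite ler_pdivrMr// ler_peMr ?ler1n// ltW.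
Qed.

End Picard.
End Equations.

(** * Oscillating exponentials and the characteristic matrix *)

Section TrigLipschitz.
Context {R : realType}.

Lemma has_deriv_cos (k t : R) : has_deriv (fun s => cos (k * s)) t (- k * sin (k * t)).
Proof.
apply/has_derivP; have H := @is_derive1_comp R (@cos R) (fun s => k * s) t (- sin (k * t)) k.
rewrite (_ : - k * _ = - sin (k * t) * k); last by ring.
apply: H; exact/has_derivP/has_deriv_id.
Qed.

Lemma has_deriv_sin (k t : R) : has_deriv (fun s => sin (k * s)) t (k * cos (k * t)).
Proof.
apply/has_derivP; have := @is_derive1_comp R (@sin R) (fun s => k * s) t (cos (k * t)) k.
rewrite [k * cos _]mulrC; apply.
exact/has_derivP/has_deriv_id.
Qed.

Lemma norm_cos_le1 (x : R) : `|cos x| <= 1.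
Proof. by rewrite ler_norml cos_geN1 cos_le1. Qed.

Lemma norm_sin_le1 (x : R) : `|sin x| <= 1.
Proof. by rewrite ler_norml sin_geN1 sin_le1. Qed.

Lemma cos_lip (x y : R) : `|cos x - cos y| <= `|x - y|.
Proof.
apply: (deriv_le1_lip (fun t => (has_derivP _ _ _).2 (is_derive_cos t))) => t _.
by rewrite normrN norm_sin_le1.
Qed.

Lemma sin_lip (x y : R) : `|sin x - sin y| <= `|x - y|.
Proof.
apply: (deriv_le1_lip (fun t => (has_derivP _ _ _).2 (is_derive_sin t))) => t _.
exact: norm_cos_le1.
Qed.

Lemma expR_lip (x y : R) : x <= 0 -> y <= 0 -> `|expR x - expR y| <= `|x - y|.
Proof.
move=> x0 y0; apply: (deriv_le1_lip (fun t => (has_derivP _ _ _).2 (is_derive_expR t))) => t tm.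
rewrite ger0_norm ?expR_ge0// -expR0 ler_expR (le_trans (ltW tm))//.
by rewrite ge_max x0.
Qed.

(** From 1 + u <= exp(u) with u = -ct. *)
Lemma expR_mul_le (c t : R) : 0 < c -> t <= 0 -> expR (c * t) * `|t| <= c^-1.
Proof.
move=> c0 t0; rewrite ler0_norm// -(ler_pM2l c0) divff ?gt_eqF//.
have := expR_ge1Dx (- (c * t)); rewrite expRN => h.
have e0 := expR_gt0 (c * t).
rewrite mulrCA mulrN -[leRHS](divff (lt0r_neq0 e0)) ler_pM2l// (le_trans _ h)// lerDr//.
Qed.

End TrigLipschitz.

Section Oscillations.
Context {R : realType} {n : nat} (eta : R) (eta0 : 0 < eta).
Implicit Types p q u v : 'cV[R]_n.
Notation traj := (@traj R n eta).
Notation hist := (hist eta).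

(** The real part of exp((a + i xi) t) (p + i q). Complex vectors are represented
    by pairs (p, q), so that the real operator L can be applied to real-valued
    functions only. *)
Definition osc (a xi : R) p q (t : R) : 'cV[R]_n :=
  expR (a * t) *: (cos (xi * t) *: p - sin (xi * t) *: q).

Lemma oscD a xi p q p' q' t :
  osc a xi (p + p') (q + q') t = osc a xi p q t + osc a xi p' q' t.
Proof.
by rewrite /osc -scalerDr; congr (_ *: _); rewrite !scalerDr opprD addrACA.
Qed.

Lemma oscZ a xi k p q t : osc a xi (k *: p) (k *: q) t = k *: osc a xi p q t.
Proof.
rewrite /osc [RHS]scalerA [k * _]mulrC -scalerA; congr (_ *: _).
by rewrite scalerBr !scalerA mulrC [_ * k]mulrC.
Qed.

Lemma osc_deriv a xi p q t :
  has_deriv (osc a xi p q) t (osc a xi (a *: p - xi *: q) (a *: q + xi *: p) t).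
Proof.
have h := has_deriv_scale (has_deriv_expR a t)
  (has_derivB (has_deriv_scaler p (has_deriv_cos xi t)) (has_deriv_scaler q (has_deriv_sin xi t))).
move: h; congr has_deriv; apply/colP => i; rewrite !mxE; ring.
Qed.

Lemma rot_norm_le (c s : R) p q : `|c| <= 1 -> `|s| <= 1 -> `|c *: p - s *: q| <= `|p| + `|q|.
Proof.
move=> c1 s1; rewrite (le_trans (ler_normB _ _))// !normrZ.
by rewrite lerD// ler_piMl.
Qed.

Lemma osc_norm_le a xi p q t : `|osc a xi p q t| <= expR (a * t) * (`|p| + `|q|).
Proof.
rewrite /osc normrZ ger0_norm ?expR_ge0// ler_wpM2l ?expR_ge0//.
by rewrite rot_norm_le ?norm_cos_le1 ?norm_sin_le1.
Qed.

Lemma weighted_osc a xi p q s : weighted eta (osc a xi p q) s = osc (eta + a) xi p q s.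
Proof. by rewrite /weighted /osc scalerA -expRD mulrDl. Qed.

Lemma osc_traj a xi p q : 0 <= a -> traj (osc a xi p q).
Proof.
move=> a0; have bd u v s : s <= 0 -> `|weighted eta (osc a xi u v) s| <= `|u| + `|v|.
  move=> s0; rewrite weighted_osc (le_trans (osc_norm_le _ _ _ _ _))// ler_piMl ?addr_ge0//.
  by rewrite -expR0 ler_expR mulr_ge0_le0// addr_ge0// ltW.
exact: (traj_of_bounded_deriv eta0 (osc_deriv a xi p q) (bd _ _) (bd _ _)).
Qed.

(** A translation in time multiplies the amplitude p + i q by
    exp((a + i xi) t). *)
Lemma osc_shift a xi p q t th : osc a xi p q (t + th) =
  expR (a * t) *: osc a xi (cos (xi * t) *: p - sin (xi * t) *: q)
                           (sin (xi * t) *: p + cos (xi * t) *: q) th.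
Proof.
rewrite /osc [RHS]scalerA -expRD mulrDr; congr (_ *: _).
apply/colP => i; rewrite !mxE mulrDr cosD sinD; ring.
Qed.

Section Characteristic.
Variable L : {linear BUC n eta -> 'cV[R]_n}.

Definition oscL a xi p q := L (hist (osc a xi p q) 0).

Lemma oscLD a xi p q p' q' : 0 <= a ->
  oscL a xi (p + p') (q + q') = oscL a xi p q + oscL a xi p' q'.
Proof.
move=> a0; rewrite /oscL -linearD -histD; [|exact: osc_traj..].
by congr (L (hist _ 0)); apply/funext => s; rewrite oscD.
Qed.

Lemma oscLZ a xi k p q : 0 <= a -> oscL a xi (k *: p) (k *: q) = k *: oscL a xi p q.
Proof.
move=> a0; rewrite /oscL -linearZ -histZ; last exact: osc_traj.
by congr (L (hist _ 0)); apply/funext => s; rewrite oscZ.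
Qed.

Lemma oscLN a xi p q : 0 <= a -> oscL a xi (- p) (- q) = - oscL a xi p q.
Proof. by move=> a0; rewrite -scaleN1r -[- q]scaleN1r oscLZ// scaleN1r. Qed.

(** L commutes with translations, so it maps an oscillation to an oscillation
    with the same exponent; its amplitude is the value of the complex extension
    of L, whose imaginary part is the real part for -i (p + i q) = q - i p. *)
Lemma L_osc a xi p q t : 0 <= a ->
  L (hist (osc a xi p q) t) = osc a xi (oscL a xi p q) (oscL a xi q (- p)) t.
Proof.
move=> a0.
have -> : hist (osc a xi p q) t = expR (a * t) *:
  hist (osc a xi (cos (xi * t) *: p - sin (xi * t) *: q)
                 (sin (xi * t) *: p + cos (xi * t) *: q)) 0.
  rewrite -[t in LHS]addr0 -hist_shift -histZ; last exact: osc_traj.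
  by congr (hist _ 0); apply/funext => s; rewrite osc_shift.
rewrite linearZ /=; congr (_ *: _).
have := @oscLD a xi (cos (xi * t) *: p) (cos (xi * t) *: q) (sin (xi * t) *: - q) (sin (xi * t) *: p) a0.
rewrite !oscLZ// -[p in oscL _ _ (- q) p]opprK oscLN// !scalerN => <-.
by rewrite /oscL [cos _ *: q + _]addrC.
Qed.

(** The real part of Delta(a + i xi) (p + i q); charIm is the imaginary part. *)
Definition charRe a xi p q := a *: p - xi *: q - oscL a xi p q.
Definition charIm a xi p q := a *: q + xi *: p - oscL a xi q (- p).

(** Solving the equation with an oscillating forcing therefore amounts to
    inverting the characteristic matrix. *)
Lemma osc_solves a xi p q t : 0 <= a ->
  has_deriv (osc a xi p q) t
    (L (hist (osc a xi p q) t) + osc a xi (charRe a xi p q) (charIm a xi p q) t).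
Proof.
move=> a0.
have zE (u w : 'cV[R]_n) : u + (w - u) = w by rewrite addrC subrK.
have := osc_deriv a xi p q t.
rewrite -(zE (oscL a xi p q) (a *: p - xi *: q)) -(zE (oscL a xi q (- p)) (a *: q + xi *: p)).
by rewrite oscD L_osc.
Qed.

Definition cplx p q : 'cV[R[i]]_n := \col_i Complex (p i 0) (q i 0).

(** By real linearity in (p, q), which is what the matrix product with Delta
    expresses. *)
Lemma oscL_basis a xi (c s : 'I_n -> R) : 0 <= a ->
  oscL a xi (\col_i c i) (\col_i s i) =
  \sum_j (c j *: oscL a xi (delta_mx j 0) 0 + s j *: oscL a xi 0 (delta_mx j 0)).
Proof.
move=> a0.
have E (f : 'I_n -> R) : \col_i f i = \sum_j f j *: (delta_mx j 0 : 'cV[R]_n).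
  by apply/colP => i; rewrite [LHS]mxE summxE (bigD1 i)//= !mxE !eqxx mulr1 big1 ?addr0// => j ji;
     rewrite !mxE eq_sym (negbTE ji) mulr0.
have S (r : seq 'I_n) : oscL a xi (\sum_(j <- r) c j *: delta_mx j 0) (\sum_(j <- r) s j *: delta_mx j 0) =
  \sum_(j <- r) (c j *: oscL a xi (delta_mx j 0) 0 + s j *: oscL a xi 0 (delta_mx j 0)).
  elim: r => [|j r IH]; rewrite ?big_nil ?big_cons.
    by have := @oscLZ a xi 0 0 0 a0; rewrite !scale0r.
  rewrite oscLD// IH; congr (_ + _).
  have := oscLD xi (c j *: delta_mx j 0) 0 0 (s j *: delta_mx j 0) a0.
  rewrite addr0 add0r => ->; congr (_ + _).
    by have := oscLZ xi (c j) (delta_mx j 0) 0 a0; rewrite scaler0.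
  by have := oscLZ xi (s j) 0 (delta_mx j 0) a0; rewrite scaler0.
by rewrite !E S.
Qed.

Lemma complex_ext_exp a xi (j k : 'I_n) : 0 <= a ->
  complex_ext L (fun theta => cexp (Complex a xi * Complex theta 0) *: delta_mx j 0) k 0 =
  Complex (oscL a xi (delta_mx j 0) 0 k 0) (- oscL a xi 0 (delta_mx j 0) k 0).
Proof.
move=> a0; rewrite /complex_ext mxE.
have -> : - oscL a xi 0 (delta_mx j 0) k 0 = oscL a xi 0 (- delta_mx j 0) k 0.
  by have := oscLN xi 0 (delta_mx j 0) a0; rewrite oppr0 => ->; rewrite mxE.
congr (Complex (L _ k 0) (L _ k 0)); rewrite /hist; congr to_buc; apply/funext => th;
  have E : Complex a xi * Complex th 0 = Complex (a * th) (xi * th)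
    by rewrite /GRing.mul /= mulr0 subr0 mulr0 add0r.
  apply/colP => i; rewrite E add0r /osc !mxE /=; case: (i == j); rewrite /=; ring.
apply/colP => i; rewrite E add0r /osc !mxE /=; case: (i == j); rewrite /=; ring.
Qed.

Lemma Delta_cplx a xi p q : 0 <= a ->
  Delta L (Complex a xi) *m cplx p q = cplx (charRe a xi p q) (charIm a xi p q).
Proof.
move=> a0; apply/colP => k.
have cE (r w : 'cV[R]_n) : oscL a xi r w =
    \sum_j (r j 0 *: oscL a xi (delta_mx j 0) 0 + w j 0 *: oscL a xi 0 (delta_mx j 0)).
  rewrite -(oscL_basis xi (fun j => r j 0) (fun j => w j 0) a0).
  by congr (oscL a xi _ _); apply/colP => i; rewrite mxE.
have vE (x y : R) (A B : 'cV[R]_n) : (x *: A + y *: B) k 0 = x * A k 0 + y * B k 0.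
  by rewrite !mxE.
have CS (F G : 'I_n -> R) : \sum_j Complex (F j) (G j) = Complex (\sum_j F j) (\sum_j G j).
  by elim/big_rec3: _ => // j x y z _ ->.
have mE (x y z w : R) : Complex x y * Complex z w = Complex (x * z - y * w) (x * w + y * z) by [].
have aux (x y z w : R) : Complex x (- y) * Complex z w =
    Complex (z * x + w * y) (w * x + - z * y).
  by rewrite mE; congr Complex; ring.
have c2 : ((\matrix_(k, j) complex_ext L (fun theta =>
    cexp (Complex a xi * Complex theta 0) *: delta_mx j 0) k 0) *m cplx p q) k 0 =
    Complex (oscL a xi p q k 0) (oscL a xi q (- p) k 0).
  rewrite mxE (cE p q) (cE q (- p)) !summxE -CS; apply: eq_bigr => j _.
  rewrite [X in X * _]mxE [X in _ * X]mxE complex_ext_exp// !vE.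
  have -> : (- p) j 0 = - p j 0 by rewrite [LHS]mxE.
  exact: aux.
have c1 : (Complex a xi *: cplx p q) k 0 = Complex a xi * Complex (p k 0) (q k 0).
  by rewrite !mxE.
have c3 : cplx (charRe a xi p q) (charIm a xi p q) k 0 =
    Complex (charRe a xi p q k 0) (charIm a xi p q k 0) by rewrite mxE.
have sE (A B : 'cV[R[i]]_n) : (A - B) k 0 = A k 0 - B k 0 by rewrite !mxE.
rewrite /Delta mulmxBl mul_scalar_mx; apply: (etrans (sE _ _)).
apply: (etrans (congr2 (fun x y => x - y) c1 c2)); apply: (etrans _ (esym c3)).
have e (x y : R) (A B C : 'cV[R]_n) : (x *: A - y *: B - C) k 0 = x * A k 0 - y * B k 0 - C k 0.
  by rewrite !mxE.
have e' (x y : R) (A B C : 'cV[R]_n) : (x *: A + y *: B - C) k 0 = x * A k 0 + y * B k 0 - C k 0.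
  by rewrite !mxE.
rewrite mE; congr Complex; first exact: (esym (e _ _ _ _ _)).
exact: (esym (e' _ _ _ _ _)).
Qed.

End Characteristic.
End Oscillations.

(** * Uniform invertibility in the closed right half-plane *)

Lemma cplx_mul_bound {R : realType} (x y a b U V : R) : `|a| <= U -> `|b| <= V ->
  `|x * a - y * b| <= (`|x| + `|y|) * (U + V) /\ `|x * b + y * a| <= (`|x| + `|y|) * (U + V).
Proof.
move=> hU hV; have U0 : 0 <= U by exact: le_trans hU.
have V0 : 0 <= V by exact: le_trans hV.
split; [apply: (le_trans (ler_normB _ _))|apply: (le_trans (ler_normD _ _))].
  rewrite !normrM mulrDl lerD// ler_wpM2l//; first by rewrite (le_trans hU)// lerDl.
  by rewrite (le_trans hV)// lerDr.
rewrite !normrM mulrDl lerD// ler_wpM2l//; first by rewrite (le_trans hV)// lerDr.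
by rewrite (le_trans hU)// lerDl.
Qed.

Lemma twice_bound {R : realType} (m x p q : R) : 0 <= x ->
  p <= m * x -> q <= m * x -> p + q <= (2 * m + 1) * x.
Proof. by move=> *; rewrite mulrDl -mulrA; lra. Qed.

(** The choice of d makes the perturbation of a and b together contribute at most
    s / 2, which is absorbed on the left. *)
Lemma absorb_perturbation {R : realType} (s C m d a b a' b' : R) : 0 < C -> 0 < m ->
  d = (8 * m * C)^-1 -> s <= C * (a + b) -> a <= a' + m * (2 * d) * s ->
  b <= b' + m * (2 * d) * s -> s <= 2 * C * (a' + b').
Proof.
move=> C0 m0 -> h ha hb.
have h2 : s <= C * (a' + b') + s / 2.
  apply: (le_trans h); rewrite (le_trans (ler_wpM2l (ltW C0) (lerD ha hb)))//.
  rewrite addrACA mulrDr lerD2l (_ : C * _ = s / 2)//; field.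
  by rewrite !gt_eqF.
rewrite -mulrA; lra.
Qed.

Lemma norm_le_dist {R : realType} (V : normedModType R) (x y : V) e :
  `|x - y| <= e -> `|x| <= `|y| + e.
Proof.
by move=> h; rewrite -{1}(subrK y x) addrC (le_trans (ler_normD _ _))// lerD2l.
Qed.

(** Solve the real part of the characteristic equation for xi q. *)
Lemma frequency_dominates {R : realType} (V : normedModType R) (p q A : V) (a xi B m : R) :
  0 <= a <= B -> `|A| <= m -> `|xi| * `|q| <= B * `|p| + m + `|a *: p - xi *: q - A|.
Proof.
move=> /andP[a0 aB] Am; rewrite -normrZ.
have e : xi *: q = a *: p - A - (a *: p - xi *: q - A) by rewrite opprB subrKA subKr.
rewrite [in leLHS]e (le_trans (ler_normB _ _))// lerD2r (le_trans (ler_normB _ _))// lerD//.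
by rewrite normrZ ger0_norm// ler_wpM2r.
Qed.

Lemma high_frequency_bound {R : realType} (B l x p q u v : R) : 0 <= B -> 0 < l ->
  0 <= p -> 0 <= q -> 2 * (B + 2 * l) + 1 < x ->
  x * q <= B * p + l * (p + q) + u -> x * p <= B * q + l * (p + q) + v ->
  (1 + x) * (p + q) <= 4 * (u + v).
Proof.
move=> B0 l0 p0 q0 hx h1 h2.
have s0 : 0 <= p + q by rewrite addr_ge0.
have x1 : 1 <= x by lra.
have big : (B + 2 * l) * (p + q) <= x / 2 * (p + q) by rewrite ler_wpM2r//; lra.
have h3 : p + q <= x * (p + q) by rewrite ler_peMl.
lra.
Qed.

Section UniformInverse.
Context {R : realType} {n : nat} (eta : R) (eta0 : 0 < eta).
Variable L : {linear BUC n eta -> 'cV[R]_n}.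
Variable l : R.
Hypothesis l0 : 0 < l.
Hypothesis Ll : forall phi, `|L phi| <= l * `|phi|.
Hypothesis detN0 : forall a xi : R, 0 <= a -> \det (Delta L (Complex a xi)) != 0.
Implicit Types p q u v : 'cV[R]_n.
Notation hist := (hist eta).

Lemma charImE a xi p q : charIm L a xi p q = charRe L a xi q (- p).
Proof. by rewrite /charIm /charRe scalerN opprK. Qed.

Lemma cplx_ReIm (c : 'cV[R[i]]_n) :
  cplx (map_mx (@complex.Re R) c) (map_mx (@complex.Im R) c) = c.
Proof. by apply/colP => i; rewrite !mxE; case: (c i 0). Qed.

Lemma cplx_inj p q u v : cplx p q = cplx u v -> p = u /\ q = v.
Proof.
by move=> /colP H; split; apply/colP => i; have := H i; rewrite !mxE => -[].
Qed.

Lemma char_surj a xi u v : 0 <= a -> exists p q, charRe L a xi p q = u /\ charIm L a xi p q = v.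
Proof.
move=> a0; pose c := invmx (Delta L (Complex a xi)) *m cplx u v.
exists (map_mx (@complex.Re R) c), (map_mx (@complex.Im R) c); apply: cplx_inj.
rewrite -(Delta_cplx eta0 L)// cplx_ReIm /c mulKVmx// unitmxE unitfE; exact: detN0.
Qed.

(** A crude bound: the sum of the absolute values of all entries of the inverse
    matrix. *)
Lemma char_inverse_bound a xi : 0 <= a -> exists2 C, 0 < C & forall p q,
  `|p| + `|q| <= C * (`|charRe L a xi p q| + `|charIm L a xi p q|).
Proof.
move=> a0; set D := Delta L (Complex a xi).
pose N := invmx D.
pose m := \sum_i \sum_j (`|complex.Re (N i j)| + `|complex.Im (N i j)|).
have m0 : 0 <= m by apply: sumr_ge0 => i _; apply: sumr_ge0 => j _; rewrite addr_ge0.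
exists (2 * m + 1); first by rewrite ltr_wpDl// mulr_ge0.
move=> p q; set u := charRe L a xi p q; set v := charIm L a xi p q.
have s0 : 0 <= `|u| + `|v| by rewrite addr_ge0.
have e : cplx p q = N *m cplx u v.
  by rewrite -(Delta_cplx eta0 L)// mulKmx// unitmxE unitfE; exact: detN0.
have row_le i : \sum_j (`|complex.Re (N i j)| + `|complex.Im (N i j)|) * (`|u| + `|v|) <= m * (`|u| + `|v|).
  rewrite -mulr_suml ler_wpM2r// /m [leRHS](bigD1 i)//= lerDl.
  by apply: sumr_ge0 => i' _; apply: sumr_ge0 => j _; rewrite addr_ge0.
have ent i : `|p i 0| <= m * (`|u| + `|v|) /\ `|q i 0| <= m * (`|u| + `|v|).
  have := congr1 (fun M : 'cV[R[i]]_n => M i 0) e; rewrite [in LHS]mxE [in RHS]mxE.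
  have CS (F : 'I_n -> R[i]) : \sum_j F j = Complex (\sum_j complex.Re (F j)) (\sum_j complex.Im (F j)).
    by elim/big_rec3: _ => // j x y z _ ->; case: (F j).
  rewrite CS => -[-> ->].
  have b j : `|complex.Re (N i j * cplx u v j 0)| <= (`|complex.Re (N i j)| + `|complex.Im (N i j)|) * (`|u| + `|v|) /\
    `|complex.Im (N i j * cplx u v j 0)| <= (`|complex.Re (N i j)| + `|complex.Im (N i j)|) * (`|u| + `|v|).
    rewrite mxE; case: (N i j) => x y /=.
    exact: cplx_mul_bound (coord_le_norm u j) (coord_le_norm v j).
  by split; apply: (le_trans (ler_norm_sum _ _ _)); apply: le_trans (row_le i); apply: ler_sum => j _; have [] := b j.
have hp : `|p| <= m * (`|u| + `|v|) by apply: norm_le_coord => [|i]; [rewrite mulr_ge0|case: (ent i)].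
have hq : `|q| <= m * (`|u| + `|v|) by apply: norm_le_coord => [|i]; [rewrite mulr_ge0|case: (ent i)].
exact: twice_bound s0 hp hq.
Qed.

Lemma oscL_le a xi p q : 0 <= a -> `|oscL L a xi p q| <= l * (`|p| + `|q|).
Proof.
move=> a0; apply: (le_trans (Ll _)); rewrite ler_wpM2l ?(ltW l0)//.
apply: hist_norm_le => [|s s0]; first exact: osc_traj.
rewrite subr0 (le_trans (ler_wpM2l (expR_ge0 _) (osc_norm_le _ _ _ _ _)))//.
rewrite mulrA -expRD -mulrDl ler_piMl ?addr_ge0// -expR0 ler_expR.
by rewrite mulr_ge0_le0// addr_ge0// ltW.
Qed.

Lemma osc_param_lip a a' xi xi' p q s : 0 <= a -> 0 <= a' -> s <= 0 ->
  `|osc a xi p q s - osc a' xi' p q s| <= `|s| * (`|a - a'| + `|xi - xi'|) * (`|p| + `|q|).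
Proof.
move=> a0 a'0 s0.
have half (r r' : R) (g : R -> R) : (forall x, `|g x| <= 1) -> (forall x y, `|g x - g y| <= `|x - y|) ->
  `|expR (a * s) * g (xi * s) - expR (a' * s) * g (xi' * s)| <= `|s| * (`|a - a'| + `|xi - xi'|).
  move=> g1 gl.
  have -> : expR (a * s) * g (xi * s) - expR (a' * s) * g (xi' * s) =
     (expR (a * s) - expR (a' * s)) * g (xi * s) + expR (a' * s) * (g (xi * s) - g (xi' * s)) by ring.
  rewrite (le_trans (ler_normD _ _))// !normrM mulrDr lerD//.
    rewrite -[leRHS]mulr1 ler_pM// (le_trans (expR_lip _ _)) ?mulr_ge0_le0//.
    by rewrite -mulrBl normrM mulrC.
  rewrite -[leRHS]mul1r ler_pM//.
    by rewrite ger0_norm ?expR_ge0// -expR0 ler_expR mulr_ge0_le0.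
  by rewrite (le_trans (gl _ _))// -mulrBl normrM mulrC.
have hc := half 0 0 (@cos R) (@norm_cos_le1 R) (@cos_lip R).
have hs := half 0 0 (@sin R) (@norm_sin_le1 R) (@sin_lip R).
have -> : osc a xi p q s - osc a' xi' p q s =
  (expR (a * s) * cos (xi * s) - expR (a' * s) * cos (xi' * s)) *: p -
  (expR (a * s) * sin (xi * s) - expR (a' * s) * sin (xi' * s)) *: q.
  by apply/colP => i; rewrite !mxE; ring.
by rewrite (le_trans (ler_normB _ _))// !normrZ mulrDr lerD// ler_wpM2r.
Qed.

(** The weight exp(eta s) compensates for the factor |s| that differentiation in
    the exponent produces: exp(eta s) |s| <= 1 / eta. *)
Lemma oscL_param_lip a a' xi xi' p q : 0 <= a -> 0 <= a' ->
  `|oscL L a xi p q - oscL L a' xi' p q| <= l / eta * (`|a - a'| + `|xi - xi'|) * (`|p| + `|q|).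
Proof.
move=> a0 a'0; have t1 : traj eta (osc a xi p q) by exact: osc_traj.
have t2 : traj eta (osc a' xi' p q) by exact: osc_traj.
rewrite /oscL -linearB -histB// (le_trans (Ll _))// -!mulrA ler_wpM2l ?(ltW l0)//.
apply: hist_norm_le => [|s s0]; first exact: trajB.
rewrite subr0 (le_trans (ler_wpM2l (expR_ge0 _) (osc_param_lip _ _ _ _ a0 a'0 s0)))//.
rewrite [leLHS]mulrA [expR _ * _]mulrA -[leLHS]mulrA ler_wpM2r ?mulr_ge0 ?addr_ge0//.
exact: expR_mul_le.
Qed.

Lemma charRe_param_lip a a' xi xi' p q : 0 <= a -> 0 <= a' ->
  `|charRe L a xi p q - charRe L a' xi' p q| <= (1 + l / eta) * (`|a - a'| + `|xi - xi'|) * (`|p| + `|q|).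
Proof.
move=> a0 a'0.
have -> : charRe L a xi p q - charRe L a' xi' p q =
  ((a - a') *: p - (xi - xi') *: q) - (oscL L a xi p q - oscL L a' xi' p q).
  rewrite /charRe; move: (oscL L _ _ _ _) (oscL L _ _ _ _) => A B.
  by apply/colP => i; rewrite !mxE; ring.
rewrite (le_trans (ler_normB _ _))// 2!mulrDl mul1r lerD//; last exact: oscL_param_lip.
rewrite (le_trans (ler_normB _ _))// !normrZ mulrDr lerD// ler_wpM2r//.
  by rewrite lerDl.
by rewrite lerDr.
Qed.

Lemma charIm_param_lip a a' xi xi' p q : 0 <= a -> 0 <= a' ->
  `|charIm L a xi p q - charIm L a' xi' p q| <= (1 + l / eta) * (`|a - a'| + `|xi - xi'|) * (`|p| + `|q|).
Proof.
move=> a0 a'0; have := charRe_param_lip xi xi' q (- p) a0 a'0.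
by rewrite (charImE a) (charImE a') normrN [`|q| + _]addrC.
Qed.

(** For |xi| <= X the parameters range over a compact set, near each point of
    which the inverse bound persists with twice the constant because the
    characteristic matrix is Lipschitz in (a, xi). For |xi| > X the term i xi
    dominates both a and L. *)
Lemma char_uniform_bound B : 0 <= B -> exists2 K, 0 < K & forall a xi p q, 0 <= a <= B ->
  (1 + `|xi|) * (`|p| + `|q|) <= K * (`|charRe L a xi p q| + `|charIm L a xi p q|).
Proof.
move=> B0; pose X := 2 * (B + 2 * l) + 1.
have X1 : 1 <= X by rewrite lerDr mulr_ge0// addr_ge0// mulr_ge0// ltW.
pose good (K : R) (z : R * R) := 0 <= z.1 -> forall p q,
  `|p| + `|q| <= K * (`|charRe L z.1 z.2 p q| + `|charIm L z.1 z.2 p q|).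
have cK : compact (`[0, B] `*` `[- X, X]) by apply: compact_setX; exact: segment_compact.
have [K [K0 HK]] : exists K, 0 < K /\ `[0, B] `*` `[- X, X] `<=` good K.
  move: cK => /compact_near_coveringP /(_ _ (+oo : set_system R) good _) H.
  suff /filter_ex [K HK] : \forall K \near +oo, 0 < K /\ `[0, B] `*` `[- X, X] `<=` good K by exists K.
  apply: filterI; first by exists 0; split => // K.
  apply: H => -[a xi] [/= a0 _]; rewrite in_itv/= in a0; case/andP: a0 => a0 _.
  have [C C0 HC] := char_inverse_bound xi a0.
  pose m := 1 + l / eta.
  have m0 : 0 < m by rewrite addr_gt0// divr_gt0.
  pose d := (8 * m * C)^-1.
  have dE : d = (8 * m * C)^-1 by [].
  have d0 : 0 < d by rewrite invr_gt0 !mulr_gt0.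
  clearbody d.
  exists (ball (a, xi) d, [set K | 2 * C < K]).
    split; first exact: nbhsx_ballx.
    by apply: nbhs_pinfty_gt; exact: num_real.
  move=> [[a' xi'] K] [/= [/= ha hxi] CK] a'0 p q.
  have {}ha : `|a - a'| < d by move: ha; rewrite /ball/=.
  have {}hxi : `|xi - xi'| < d by move: hxi; rewrite /ball/=.
  set s := `|p| + `|q|; have s0 : 0 <= s by rewrite addr_ge0.
  have h1 := HC p q; rewrite -/s in h1.
  have e1 := charRe_param_lip xi xi' p q a0 a'0.
  have e2 := charIm_param_lip xi xi' p q a0 a'0.
  rewrite -/s -/m in e1 e2.
  clearbody s; clearbody m.
  have dd : m * (`|a - a'| + `|xi - xi'|) * s <= m * (2 * d) * s.
    by rewrite ler_wpM2r// ler_wpM2l ?(ltW m0)// mulr_natl mulr2n lerD// ltW.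
  have f1 := norm_le_dist (le_trans e1 dd).
  have f2 := norm_le_dist (le_trans e2 dd).
  have h2 := absorb_perturbation C0 m0 dE h1 f1 f2.
  apply: (le_trans h2); rewrite ler_wpM2r ?addr_ge0//; exact: ltW.
exists ((1 + X) * K + 4); first by rewrite ltr_wpDl// mulr_ge0 ?ltW// addr_gt0// (lt_le_trans ltr01).
move=> a xi p q /andP[a0 aB].
set s := `|p| + `|q|; have s0 : 0 <= s by rewrite addr_ge0.
set U := `|charRe L a xi p q| + `|charIm L a xi p q|.
have U0 : 0 <= U by rewrite addr_ge0.
rewrite [leRHS]mulrDl; case: (leP `|xi| X) => xiX.
  rewrite (le_trans (y := (1 + X) * K * U))//; last by rewrite lerDl mulr_ge0.
  rewrite -mulrA ler_pM ?addr_ge0// ?lerD2l//.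
  by apply: (HK (a, xi)) => //; split; rewrite /= in_itv/= ?a0// -ler_norml.
rewrite (le_trans (y := 4 * U))//; last first.
  by rewrite lerDr !mulr_ge0 ?(ltW K0)// addr_ge0// (le_trans ler01).
have aB' : 0 <= a <= B by rewrite a0.
have g1 := @frequency_dominates R _ p q (oscL L a xi p q) a xi B _ aB' (oscL_le xi p q a0).
have g2 := @frequency_dominates R _ q (- p) (oscL L a xi q (- p)) a xi B _ aB' (oscL_le xi q (- p) a0).
rewrite normrN [`|q| + `|p|]addrC scalerN opprK in g2.
exact: high_frequency_bound B0 l0 (normr_ge0 _) (normr_ge0 _) xiX g1 g2.
Qed.

End UniformInverse.

(** * Discrete Fourier sums and the Fejer kernel *)

Section TrigSums.
Context {R : realType}.

Lemma sin_cos_period (y : R) (d : nat) :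
  sin (y + 2 * pi * d%:R) = sin y /\ cos (y + 2 * pi * d%:R) = cos y.
Proof.
have -> : 2 * pi * d%:R = (pi *+ 2) *+ d :> R by rewrite -[RHS]mulr_natr -[pi *+ 2]mulr_natl.
by rewrite !(periodicn (@sinD2pi R)) !(periodicn (@cosD2pi R)).
Qed.

(** Each term 2 sin h cos(x + 2 l h) is a difference of sines. *)
Lemma cos_sum_telescope (x h : R) m :
  2 * sin h * \sum_(l < m) cos (x + 2 * l%:R * h) = sin (x + (2 * m%:R - 1) * h) - sin (x - h).
Proof.
elim: m => [|m IH]; first by rewrite big_ord0 mulr0 mulr0 sub0r mulN1r subrr.
rewrite big_ord_recr/= mulrDr IH.
have -> : x + (2 * m.+1%:R - 1) * h = (x + 2 * m%:R * h) + h by rewrite -natr1; ring.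
have -> : x + (2 * m%:R - 1) * h = (x + 2 * m%:R * h) - h by ring.
by rewrite [in RHS]sinD sinB; ring.
Qed.

Lemma sin_sum_telescope (x h : R) m :
  2 * sin h * \sum_(l < m) sin (x + 2 * l%:R * h) = cos (x - h) - cos (x + (2 * m%:R - 1) * h).
Proof.
elim: m => [|m IH]; first by rewrite big_ord0 mulr0 mulr0 sub0r mulN1r subrr.
rewrite big_ord_recr/= mulrDr IH.
have -> : x + (2 * m.+1%:R - 1) * h = (x + 2 * m%:R * h) + h by rewrite -natr1; ring.
have -> : x + (2 * m%:R - 1) * h = (x + 2 * m%:R * h) - h by ring.
set z := x + 2 * m%:R * h.
have -> : cos (z + h) = cos (z - h) - 2 * sin h * sin z by rewrite cosD cosB; ring.
ring.
Qed.

Lemma sin_ratio_neq0 (m j j' : nat) : (j < m)%N -> (j' < m)%N -> j != j' ->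
  sin (pi * (j%:R - j'%:R) / m%:R) != 0 :> R.
Proof.
wlog lt : j j' / (j' < j)%N.
  move=> H jm j'm jj'; case: (ltngtP j' j) => [lt|lt|e]; first exact: (H j j').
    have := H j' j lt j'm jm; rewrite eq_sym => /(_ jj').
    by rewrite -(opprB j%:R) mulrN mulNr sinN oppr_eq0.
  by rewrite e eqxx in jj'.
move=> jm j'm _; have m0 : 0 < m%:R :> R by rewrite ltr0n (leq_ltn_trans _ jm).
rewrite gt_eqF// sin_gt0_pi// ; apply/andP; split.
  by rewrite divr_gt0// mulr_gt0 ?pi_gt0// subr_gt0 ltr_nat.
rewrite ltr_pdivrMr// ltr_pM2l ?pi_gt0// (le_lt_trans (y := j%:R)) ?ltr_nat//.
by rewrite gerBl.
Qed.

(** Orthogonality of the characters of Z/m: the telescoped sum runs over full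
    periods, and sin h does not vanish. *)
Lemma cos_sum_eq0 (x : R) (m j j' : nat) : (j < m)%N -> (j' < m)%N -> j != j' ->
  \sum_(l < m) cos (x + 2 * l%:R * (pi * (j%:R - j'%:R) / m%:R)) = 0.
Proof.
move=> jm j'm jj'.
have m0 : 0 < m%:R :> R by rewrite ltr0n (leq_ltn_trans _ jm).
have mN : m%:R != 0 :> R by rewrite gt_eqF.
set h := _ / m%:R.
have hm : h * m%:R = pi * (j%:R - j'%:R) by rewrite /h divfK.
have sh : sin h != 0 by exact: sin_ratio_neq0.
have := cos_sum_telescope x h m.
have -> : x + (2 * m%:R - 1) * h = (x - h) + 2 * pi * j%:R - 2 * pi * j'%:R.
  have -> : x + (2 * m%:R - 1) * h = (x - h) + 2 * (h * m%:R) by ring.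
  rewrite hm; ring.
have -> : sin (x - h + 2 * pi * j%:R - 2 * pi * j'%:R) = sin (x - h).
  have := (sin_cos_period (x - h + 2 * pi * j%:R - 2 * pi * j'%:R) j').1.
  by rewrite subrK (sin_cos_period _ _).1 => <-.
rewrite subrr => /eqP; rewrite mulf_eq0 mulf_eq0 (negbTE sh) pnatr_eq0 /=.
by move/eqP.
Qed.

(** Expand the squares; by orthogonality only the diagonal terms survive. The
    offset l0 permutes the frequencies modulo m, and only shifts the phase of
    the off-diagonal terms. *)
Lemma discrete_parseval (p : nat -> R) (m l0 : nat) : (0 < m)%N ->
  \sum_(l < m) ((\sum_(j < m) p j * cos (2 * pi * (l0%:R - l%:R) * j%:R / m%:R)) ^+ 2 +
                (\sum_(j < m) p j * sin (2 * pi * (l0%:R - l%:R) * j%:R / m%:R)) ^+ 2) =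
  m%:R * \sum_(j < m) p j ^+ 2.
Proof.
move=> m0; have mN : m%:R != 0 :> R by rewrite pnatr_eq0 -lt0n.
have E (l : 'I_m) : (\sum_(j < m) p j * cos (2 * pi * (l0%:R - l%:R) * j%:R / m%:R)) ^+ 2 +
                (\sum_(j < m) p j * sin (2 * pi * (l0%:R - l%:R) * j%:R / m%:R)) ^+ 2 =
   \sum_(j < m) \sum_(j' < m) p j * p j' *
     cos (2 * pi * l0%:R * (j'%:R - j%:R) / m%:R + 2 * l%:R * (pi * (j%:R - j'%:R) / m%:R)).
  rewrite !expr2 !mulr_suml -big_split/=; apply: eq_bigr => j _.
  rewrite !mulr_sumr -big_split/=; apply: eq_bigr => j' _.
  have -> : 2 * pi * l0%:R * (j'%:R - j%:R) / m%:R + 2 * l%:R * (pi * (j%:R - j'%:R) / m%:R) =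
    2 * pi * (l0%:R - l%:R) * j'%:R / m%:R - 2 * pi * (l0%:R - l%:R) * j%:R / m%:R :> R.
    by field.
  by rewrite cosB; ring.
rewrite (eq_bigr _ (fun l _ => E l)) exchange_big/= mulr_sumr; apply: eq_bigr => j _.
rewrite exchange_big/= (bigD1 j)//= [X in _ + X]big1 ?addr0; last first.
  move=> j' jj'; rewrite -mulr_sumr cos_sum_eq0 ?mulr0//.
  by rewrite eq_sym.
rewrite -mulr_sumr (eq_bigr (fun=> 1)); last first.
  by move=> l _; rewrite !subrr !mulr0 !mul0r mulr0 addr0 cos0.
by rewrite sumr_const card_ord -expr2 mulrC.
Qed.

(** The Fejer kernel of order m and period T, written as a double sum of cosines
    because each pair (l, l') contributes one oscillation to the periodic
    solution. *)
Definition fejer (m : nat) (T t : R) : R :=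
  m%:R^-1 * \sum_(l < m) \sum_(l' < m) cos (2 * pi * (l%:R - l'%:R) / T * t).

(** The modulus squared of a geometric sum, hence nonnegative. *)
Lemma fejer_square m T t : fejer m T t = m%:R^-1 *
  ((\sum_(l < m) cos (2 * pi * l%:R / T * t)) ^+ 2 + (\sum_(l < m) sin (2 * pi * l%:R / T * t)) ^+ 2).
Proof.
congr (_ * _); rewrite !expr2 !mulr_suml -big_split/=; apply: eq_bigr => l _.
rewrite !mulr_sumr -big_split/=; apply: eq_bigr => l' _.
rewrite -cosB; congr cos; ring.
Qed.

Lemma fejer_ge0 m T t : 0 <= fejer m T t.
Proof. by rewrite fejer_square mulr_ge0 ?invr_ge0// addr_ge0// sqr_ge0. Qed.

(** Away from the multiples of T the two sums in fejer_square telescope after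
    multiplication by 2 sin(pi t / T), so the kernel is O(1/m) there. *)
Lemma fejer_far m T t : fejer m T t * sin (pi / T * t) ^+ 2 <= 2 / m%:R.
Proof.
rewrite fejer_square -[leLHS]mulrA [leRHS]mulrC ler_wpM2l ?invr_ge0//.
set h := pi / T * t.
have hE (l : 'I_m) : 2 * pi * l%:R / T * t = 0 + 2 * l%:R * h by rewrite /h; ring.
have cE : \sum_(l < m) cos (2 * pi * l%:R / T * t) = \sum_(l < m) cos (0 + 2 * l%:R * h).
  by apply: eq_bigr => l _; rewrite hE.
have sE : \sum_(l < m) sin (2 * pi * l%:R / T * t) = \sum_(l < m) sin (0 + 2 * l%:R * h).
  by apply: eq_bigr => l _; rewrite hE.
rewrite cE sE mulrDl.
have sq (a b c : R) : 2 * b * a = c -> `|c| <= 2 -> a ^+ 2 * b ^+ 2 <= 1.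
  move=> e; rewrite -e => c2.
  have : (2 * b * a) ^+ 2 <= 2 ^+ 2 by rewrite -[leLHS]real_normK ?num_real// lerXn2r ?nnegrE.
  rewrite !exprMn; lra.
have two : 2 = 1 + 1 :> R by [].
rewrite [leRHS]two lerD//.
  apply: (sq _ _ _ (cos_sum_telescope 0 h m)).
  by rewrite (le_trans (ler_normB _ _))// two lerD// norm_sin_le1.
apply: (sq _ _ _ (sin_sum_telescope 0 h m)).
by rewrite (le_trans (ler_normB _ _))// two lerD// norm_cos_le1.
Qed.

(** Only the constant terms l = l' survive summation over the m sample points. *)
Lemma fejer_mean m T t : (0 < m)%N -> 0 < T ->
  \sum_(j < m) fejer m T (t - j%:R * T / m%:R) = m%:R.
Proof.
move=> m0 T0; have mN : m%:R != 0 :> R by rewrite pnatr_eq0 -lt0n.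
have TN : T != 0 by rewrite gt_eqF.
rewrite /fejer -mulr_sumr exchange_big/=.
rewrite (eq_bigr (fun=> m%:R)); first by rewrite sumr_const card_ord -(mulr_natr m%:R) mulKf.
move=> l _; rewrite exchange_big/= (bigD1 l)//= [X in _ + X]big1 ?addr0; last first.
  move=> l' ll'.
  rewrite -[RHS](@cos_sum_eq0 (2 * pi * (l%:R - l'%:R) / T * t) m l' l)//.
  apply: eq_bigr => j _; congr cos; field.
  by rewrite mN.
rewrite (eq_bigr (fun=> 1)); first by rewrite sumr_const card_ord.
by move=> j _; rewrite subrr mulr0 !mul0r cos0.
Qed.

(** Comparison with a telescoping sum: h(x) = x / (1 + a|x|) is bounded by 1/a and
    increases by at least (1 + a)^(-1) times the summand at each step. *)
Lemma inverse_square_sum (a : R) (m l0 : nat) : 0 < a ->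
  \sum_(l < m) (1 + a * `|l0%:R - l%:R|) ^- 2 <= 2 * (1 + a^-1).
Proof.
move=> a0; pose h (x : R) := x / (1 + a * `|x|).
have pos x : 0 < 1 + a * `|x| by rewrite ltr_pwDl// mulr_ge0// ltW.
have hb x : `|h x| <= a^-1.
  rewrite normrM normfV [`|1 + _|]gtr0_norm// ler_pdivrMr// mulrDr mulr1 mulKf ?gt_eqF//.
  by rewrite lerDr invr_ge0 ltW.
have step (l : nat) : (1 + a * `|l0%:R - l%:R|) ^- 2 <= (1 + a) * (h (l.+1%:R - l0%:R) - h (l%:R - l0%:R)).
  have [le|lt] := leqP l0 l.
    have -> : l.+1%:R - l0%:R = (l%:R - l0%:R) + 1 :> R by rewrite -natr1; ring.
    rewrite distrC; have : 0 <= l%:R - l0%:R :> R by rewrite subr_ge0 ler_nat.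
    move: (l%:R - l0%:R) => x x0; rewrite /h !ger0_norm ?addr_ge0//.
    have p1 : 0 < 1 + a * x by rewrite ltr_pwDl// mulr_ge0// ltW.
    have p2 : 0 < 1 + a * (x + 1) by rewrite ltr_pwDl// mulr_ge0 ?addr_ge0// ltW.
    have -> : (1 + a) * ((x + 1) / (1 + a * (x + 1)) - x / (1 + a * x)) = (1 + a) / ((1 + a * (x + 1)) * (1 + a * x)).
      by field; rewrite !gt_eqF.
    rewrite ler_pdivlMr ?mulr_gt0// mulrC ler_pdivrMr ?exprn_gt0//.
    rewrite expr2 mulrA ler_pM2r//.
    have : 0 <= a * (a * x) by rewrite !mulr_ge0// ltW.
    by lra.
  have -> : l.+1%:R - l0%:R = - (l0%:R - l%:R - 1) :> R by rewrite -natr1; ring.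
  have -> : l%:R - l0%:R = - (l0%:R - l%:R) :> R by ring.
  have : 1 <= l0%:R - l%:R :> R.
    by have : l%:R + 1 <= l0%:R :> R; [rewrite natr1 ler_nat|lra].
  move: (l0%:R - l%:R) => x x1; rewrite /h !normrN !ger0_norm ?subr_ge0//; last by rewrite (le_trans ler01).
  have x0 : 0 <= x - 1 by rewrite subr_ge0.
  have p1 : 0 < 1 + a * x by rewrite ltr_pwDl// mulr_ge0// ?ltW// (lt_le_trans ltr01).
  have p2 : 0 < 1 + a * (x - 1) by rewrite ltr_pwDl// mulr_ge0// ltW.
  have -> : (1 + a) * (- (x - 1) / (1 + a * (x - 1)) - - x / (1 + a * x)) = (1 + a) / ((1 + a * (x - 1)) * (1 + a * x)).
    by field; rewrite !gt_eqF.
  rewrite ler_pdivlMr ?mulr_gt0// mulrC ler_pdivrMr ?exprn_gt0//.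
  rewrite expr2 mulrA ler_pM2r//.
  have : 0 <= a * (a * x) by rewrite !mulr_ge0 ?(ltW a0)// (le_trans ler01).
  by lra.
rewrite (le_trans (ler_sum _ (fun (l : 'I_m) _ => step l)))// -mulr_sumr.
have -> : \sum_(l < m) (h (l.+1%:R - l0%:R) - h (l%:R - l0%:R)) = h (m%:R - l0%:R) - h (0%:R - l0%:R).
  elim: m => [|m IH]; first by rewrite big_ord0 subrr.
  by rewrite big_ord_recr/= IH addrC addrA subrK.
rewrite (le_trans (ler_wpM2l _ (le_trans (ler_norm _) (le_trans (ler_normB _ _) (lerD (hb _) (hb _))))))//.
  by rewrite addr_ge0// ltW.
rewrite (_ : (1 + a) * _ = 2 * (1 + a^-1))//; field.
by rewrite gt_eqF.
Qed.

Lemma sample_count (g w : R) m : 0 < g -> 0 <= w ->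
  \sum_(j < m) (if j%:R * g < w then 1 else 0) <= w / g + 1.
Proof.
move=> g0 w0; rewrite -(ler_pM2r g0) mulrDl divfK ?gt_eqF// mul1r mulr_suml.
suff : \sum_(j < m) (if j%:R * g < w then 1 else 0) * g <= Num.min (w + g) (m%:R * g).
  by move=> /le_trans; apply; rewrite ge_min lexx.
elim: m => [|m IH]; first by rewrite big_ord0 mul0r le_min lexx addr_ge0// ltW.
rewrite big_ord_recr/= (le_trans (lerD IH (lexx _)))// -natr1 mulrDl mul1r.
case: ifP => [lt|_]; last first.
  by rewrite mul0r addr0 le_min ge_min lexx ge_min lerDl (ltW g0) orbT.
rewrite mul1r min_r ?(le_trans (ltW lt)) ?lerDl ?(ltW g0)//.
by rewrite le_min lexx andbT lerD2r ltW.
Qed.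

End TrigSums.

(** * Fejer approximation and Bessel's inequality *)

Section FejerApproximation.
Context {R : realType} {n : nat}.
Variables (p : R -> 'cV[R]_n) (T H : R).
Hypothesis T0 : 0 < T.
Hypothesis cp : continuous p.
Hypothesis p0 : p 0 = 0.
Hypothesis pT : p T = 0.
Hypothesis pH : forall t, 0 <= t <= T -> `|p t| <= H.

(** The function |sin(pi (t - s) / T)| measures the distance of t and s modulo T.
    It is small also when t and s are near opposite ends of [0, T], where
    p(0) = p(T) = 0 is used. *)
Lemma periodic_modulus e : 0 < e -> exists2 c, 0 < c & forall t s,
  0 <= t <= T -> 0 <= s <= T -> `|sin (pi / T * (t - s))| < c -> `|p t - p s| <= e.
Proof.
move=> e0; have [d0 d00 Hd] := segment_unif_continuous 0 T cp (halfR_gt0 e0).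
pose d := Num.min d0 (T / 2).
have dp : 0 < d by rewrite lt_min d00 halfR_gt0.
have dd0 : d <= d0 by rewrite ge_min lexx.
have dT : d <= T / 2 by rewrite ge_min lexx orbT.
have dT' : d <= T - d by rewrite lerBrDr [leRHS](splitr T) lerD.
clearbody d.
have cs : continuous (fun r => sin (pi / T * r) : R).
  exact: (deriv_continuous (has_deriv_sin (pi / T))).
have [c0 c0I Hc] := EVT_min dT' (continuous_subspaceT cs).
rewrite in_itv/= in c0I; case/andP: c0I => dc cd.
(* The smallest value of sin(pi r / T) for d <= r <= T - d. *)
exists (sin (pi / T * c0)).
  apply: sin_gt0_pi; apply/andP; split.
    by rewrite mulr_gt0// ?divr_gt0 ?pi_gt0//; lra.
  by rewrite mulrAC ltr_pdivrMr// ltr_pM2l ?pi_gt0//; lra.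
have sym t s : 0 <= t <= T -> 0 <= s <= T -> s <= t -> `|sin (pi / T * (t - s))| < sin (pi / T * c0) -> `|p t - p s| <= e.
  move=> /andP[t0 tT] /andP[s0 sT] st hs.
  case: (ltP (t - s) d) => [lt|le].
    rewrite ltW// (lt_trans (Hd t s _ _)) ?t0//.
      by rewrite ger0_norm ?subr_ge0// (lt_le_trans lt).
    by rewrite ltr_pdivrMr// ltr_pMr// ltr1n.
  case: (leP (t - s) (T - d)) => [le'|lt].
    have : sin (pi / T * c0) <= sin (pi / T * (t - s)) by apply: Hc; rewrite in_itv/= le.
    by move/(le_trans)/(_ (ler_norm _)); rewrite leNgt hs.
  have h1 : `|p t| < e / 2.
    rewrite -[p t]subr0 -pT; apply: Hd; first by rewrite t0.
    by rewrite ler0_norm ?subr_le0//; lra.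
  have h2 : `|p s| < e / 2.
    rewrite -[p s]subr0 -p0; apply: Hd; first by rewrite s0.
    by rewrite subr0 ger0_norm//; lra.
  by rewrite (le_trans (ler_normB _ _))// [leRHS](splitr e) lerD// ltW.
move=> t s tT sT; case: (leP s t) => [st|/ltW ts]; first exact: sym.
rewrite -(opprB s t) mulrN sinN normrN => h.
by rewrite distrC; exact: sym.
Qed.

(** The kernel is nonnegative with mean 1 over the sample points, and its mass is
    concentrated near the multiples of T. *)
Lemma fejer_approx e : 0 < e -> exists m0 : nat, forall m : nat, (m0 <= m)%N -> (0 < m)%N ->
  forall t, 0 <= t <= T ->
  `|m%:R^-1 *: (\sum_(j < m) fejer m T (t - j%:R * T / m%:R) *: p (j%:R * T / m%:R)) - p t| <= e.
Proof.
move=> e0; have [c c0 Hc] := periodic_modulus (halfR_gt0 e0).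
have H0 : 0 <= H by apply: le_trans (pH (t := 0) _); rewrite ?normr_ge0// lexx ltW.
have [m0 Hm0] : exists m0 : nat, 8 * H / (c ^+ 2 * e) <= m0%:R.
  by exists (Num.truncn (8 * H / (c ^+ 2 * e))).+1; apply/ltW/truncnS_gt.
exists m0 => m m0m m_gt0 t tT.
have mp : 0 < m%:R :> R by rewrite ltr0n.
have mN := lt0r_neq0 mp.
have mH : 4 * H / (c ^+ 2 * m%:R) <= e / 2.
  have : 8 * H / (c ^+ 2 * e) <= m%:R by rewrite (le_trans Hm0)// ler_nat.
  rewrite ler_pdivrMr ?mulr_gt0 ?exprn_gt0// => h.
  by rewrite ler_pdivrMr ?mulr_gt0 ?exprn_gt0//; lra.
have -> : p t = m%:R^-1 *: (\sum_(j < m) fejer m T (t - j%:R * T / m%:R) *: p t).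
  by rewrite -scaler_suml scalerA fejer_mean// mulVf// scale1r.
rewrite -scalerBr -sumrB normrZ normfV gtr0_norm// mulrC ler_pdivrMr//.
have sj (j : 'I_m) : 0 <= j%:R * T / m%:R <= T.
  rewrite divr_ge0 ?mulr_ge0 ?(ltW T0)//= ler_pdivrMr// mulrC ler_pM2l// ler_nat ltnW//.
have bd (j : 'I_m) : `|fejer m T (t - j%:R * T / m%:R) *: p (j%:R * T / m%:R) - fejer m T (t - j%:R * T / m%:R) *: p t|
   <= fejer m T (t - j%:R * T / m%:R) * (e / 2) + e / 2.
  rewrite -scalerBr normrZ ger0_norm ?fejer_ge0//.
  have := sj j; set s := j%:R * T / m%:R => sT.
  case: (ltP `|sin (pi / T * (t - s))| c) => [lt|le].
    rewrite (le_trans (ler_wpM2l (fejer_ge0 _ _ _) (_ : _ <= e / 2)))//.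
      by rewrite distrC; exact: Hc.
    by rewrite lerDl ltW// halfR_gt0.
  have f1 : fejer m T (t - s) <= 2 / m%:R / c ^+ 2.
    rewrite ler_pdivlMr ?exprn_gt0//; apply: le_trans (fejer_far m T (t - s)).
    rewrite ler_wpM2l ?fejer_ge0// -[leRHS]real_normK ?num_real//.
    by rewrite lerXn2r ?nnegrE// ltW.
  have f2 : `|p s - p t| <= 2 * H.
    by rewrite (le_trans (ler_normB _ _))// mulr_natl mulr2n lerD// pH.
  rewrite (le_trans (ler_pM (fejer_ge0 _ _ _) (normr_ge0 _) f1 f2))//.
  apply: (@le_trans _ _ (e / 2)); last by rewrite lerDr mulr_ge0 ?fejer_ge0// ltW// halfR_gt0.
  rewrite (_ : 2 / m%:R / c ^+ 2 * (2 * H) = 4 * H / (c ^+ 2 * m%:R))//; field.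
  by rewrite mN gt_eqF.
rewrite (le_trans (ler_norm_sum _ _ _))// (le_trans (ler_sum _ (fun j _ => bd j)))//.
rewrite big_split/= -mulr_suml fejer_mean// sumr_const card_ord -(mulr_natl (e / 2)) -mulrDr.
by rewrite mulrC ler_pM2r// -splitr.
Qed.

End FejerApproximation.

Section Bessel.
Context {R : realType} {n : nat}.

Lemma norm_sqr_le_sum (v : 'cV[R]_n) : `|v| ^+ 2 <= \sum_i v i 0 ^+ 2.
Proof.
have s0 : 0 <= \sum_i v i 0 ^+ 2 by apply: sumr_ge0 => i _; exact: sqr_ge0.
rewrite -[leRHS]sqr_sqrtr// lerXn2r ?nnegrE ?sqrtr_ge0//.
apply: norm_le_coord; first exact: sqrtr_ge0.
move=> i; rewrite -sqrtr_sqr ler_wsqrtr// (bigD1 i)//= lerDl.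
by apply: sumr_ge0 => j _; exact: sqr_ge0.
Qed.

(** Parseval's identity in each coordinate. The maximum norm is at most the
    Euclidean norm, and conversely the Euclidean norm costs the factor n. *)
Lemma discrete_bessel (s : nat -> 'cV[R]_n) (m l0 : nat) : (0 < m)%N ->
  \sum_(l < m) (`|m%:R^-1 *: \sum_(j < m) cos (2 * pi * (l0%:R - l%:R) * j%:R / m%:R) *: s j| +
                `|m%:R^-1 *: \sum_(j < m) sin (2 * pi * (l0%:R - l%:R) * j%:R / m%:R) *: s j|) ^+ 2
   <= 2 * n%:R / m%:R * \sum_(j < m) `|s j| ^+ 2.
Proof.
move=> m0; have mp : 0 < m%:R :> R by rewrite ltr0n.
pose A l := \sum_(j < m) cos (2 * pi * (l0%:R - l%:R) * j%:R / m%:R) *: s j.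
pose B l := \sum_(j < m) sin (2 * pi * (l0%:R - l%:R) * j%:R / m%:R) *: s j.
have AE l i : A l i 0 = \sum_(j < m) s j i 0 * cos (2 * pi * (l0%:R - l%:R) * j%:R / m%:R).
  by rewrite summxE; apply: eq_bigr => j _; rewrite mxE mulrC.
have BE l i : B l i 0 = \sum_(j < m) s j i 0 * sin (2 * pi * (l0%:R - l%:R) * j%:R / m%:R).
  by rewrite summxE; apply: eq_bigr => j _; rewrite mxE mulrC.
have step (l : 'I_m) : (`|m%:R^-1 *: A l| + `|m%:R^-1 *: B l|) ^+ 2 <=
   2 * m%:R^-1 ^+ 2 * \sum_i (A l i 0 ^+ 2 + B l i 0 ^+ 2).
  rewrite !normrZ normfV gtr0_norm// -mulrDr exprMn [2 * _]mulrC -[leRHS]mulrA ler_wpM2l ?exprn_ge0 ?invr_ge0//.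
  rewrite big_split/= (le_trans _ (ler_wpM2l _ (lerD (norm_sqr_le_sum _) (norm_sqr_le_sum _))))//.
  move: `|A l| `|B l| => a b; have := sqr_ge0 (a - b); rewrite !expr2; lra.
apply: (le_trans (ler_sum _ (fun l _ => step l))).
rewrite -mulr_sumr exchange_big/=.
have -> : \sum_i \sum_(l < m) (A l i 0 ^+ 2 + B l i 0 ^+ 2) = \sum_i m%:R * \sum_(j < m) s j i 0 ^+ 2.
  apply: eq_bigr => i _; rewrite -(discrete_parseval (fun j => s j i 0) l0 m0).
  by apply: eq_bigr => l _; rewrite AE BE.
rewrite -mulr_sumr exchange_big/= mulrA.
have -> : 2 * m%:R^-1 ^+ 2 * m%:R = 2 / m%:R :> R.
  by rewrite expr2 -!mulrA mulVf ?gt_eqF// mulr1.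
rewrite [2 * n%:R / _]mulrAC -[leRHS]mulrA ler_wpM2l ?divr_ge0//.
rewrite mulr_sumr ler_sum// => j _.
rewrite -[n in n%:R]card_ord mulr_natl -sumr_const ler_sum// => i _.
rewrite -[leLHS]real_normK ?num_real// lerXn2r ?nnegrE//.
exact: coord_le_norm.
Qed.

End Bessel.

(** * Periodically forced linear equations *)

(** The inequality between the geometric and the arithmetic mean splits the product
    of the decaying factor 1 / (1 + w) and the Fourier coefficient a into two
    square-summable sequences; r is the weight between them. *)
Lemma resolvent_am_gm {R : realType} (K w x a r : R) : 0 < K -> 0 <= w -> 0 <= a -> 0 < r ->
  (1 + w) * x <= K * a -> x <= K * (r * (1 + w) ^- 2 + r^-1 * a ^+ 2).
Proof.
move=> K0 w0 a0 r0 h.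
have w1 : 0 < 1 + w by rewrite ltr_pwDl.
pose d := (1 + w)^-1.
have d0 : 0 < d by rewrite invr_gt0.
have dw : d * (1 + w) = 1 by rewrite mulVf// gt_eqF.
have hx : x <= K * (d * a).
  by have := ler_wpM2l (ltW d0) h; rewrite mulrA dw mul1r mulrCA.
apply: (le_trans hx); rewrite ler_pM2l// -exprVn -/d.
rewrite -(ler_pM2l r0).
have -> : r * (r * d ^+ 2 + r^-1 * a ^+ 2) = (r * d) ^+ 2 + a ^+ 2 by field; rewrite gt_eqF.
have := sqr_ge0 (r * d - a); have : 0 <= (r * d) * a by rewrite !mulr_ge0// ltW.
rewrite !expr2; lra.
Qed.

Section PeriodicForcing.
Context {R : realType} {n : nat} (eta : R) (eta0 : 0 < eta).
Variable L : {linear BUC n eta -> 'cV[R]_n}.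
Variables (B K : R).
Hypothesis K0 : 0 < K.
Hypothesis HK : forall a xi (p q : 'cV[R]_n), 0 <= a <= B ->
  (1 + `|xi|) * (`|p| + `|q|) <= K * (`|charRe L a xi p q| + `|charIm L a xi p q|).
Hypothesis Hsurj : forall a xi (u v : 'cV[R]_n), 0 <= a ->
  exists p q, charRe L a xi p q = u /\ charIm L a xi p q = v.
Notation hist := (hist eta).
Notation traj := (@traj R n eta).

(** The double sum of oscillations with the discrete Fourier coefficients of s as
    amplitudes is the Fejer sum of s, times exp(bt): expand
    cos(w (t - jT/m)). *)
Lemma osc_fourier_kernel (b T : R) (m : nat) (s : nat -> 'cV[R]_n) t : (0 < m)%N -> 0 < T ->
  m%:R^-1 *: (\sum_(l < m) \sum_(l' < m) osc b (2 * pi * (l%:R - l'%:R) / T)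
    (m%:R^-1 *: \sum_(j < m) cos (2 * pi * (l%:R - l'%:R) * j%:R / m%:R) *: s j)
    (- (m%:R^-1 *: \sum_(j < m) sin (2 * pi * (l%:R - l'%:R) * j%:R / m%:R) *: s j)) t) =
  expR (b * t) *: (m%:R^-1 *: (\sum_(j < m) fejer m T (t - j%:R * T / m%:R) *: s j)).
Proof.
move=> m0 T0; have mN : m%:R != 0 :> R by rewrite pnatr_eq0 -lt0n.
have TN : T != 0 by rewrite gt_eqF.
rewrite [RHS]scalerA [expR _ * _]mulrC -[RHS]scalerA; congr (_ *: _).
have E (l l' : 'I_m) : osc b (2 * pi * (l%:R - l'%:R) / T)
    (m%:R^-1 *: \sum_(j < m) cos (2 * pi * (l%:R - l'%:R) * j%:R / m%:R) *: s j)
    (- (m%:R^-1 *: \sum_(j < m) sin (2 * pi * (l%:R - l'%:R) * j%:R / m%:R) *: s j)) t =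
  expR (b * t) *: (\sum_(j < m) (m%:R^-1 * cos (2 * pi * (l%:R - l'%:R) / T * (t - j%:R * T / m%:R))) *: s j).
  rewrite /osc; congr (_ *: _); rewrite scalerN opprK !scaler_sumr -big_split/=.
  apply: eq_bigr => j _; rewrite !scalerA -scalerDl; congr (_ *: _).
  have -> : 2 * pi * (l%:R - l'%:R) / T * (t - j%:R * T / m%:R) =
    2 * pi * (l%:R - l'%:R) / T * t - 2 * pi * (l%:R - l'%:R) * j%:R / m%:R :> R.
    by field; rewrite mN.
  by rewrite cosB; ring.
rewrite (eq_bigr _ (fun l _ => eq_bigr _ (fun l' _ => E l l'))).
under eq_bigr do rewrite -scaler_sumr exchange_big/=.
rewrite -scaler_sumr exchange_big/=; congr (_ *: _); apply: eq_bigr => j _.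
rewrite /fejer mulr_sumr scaler_suml; apply: eq_bigr => l _.
by rewrite mulr_sumr scaler_suml.
Qed.

Lemma osc_periodic (b T : R) (l l' : nat) (p q : 'cV[R]_n) t : 0 < T ->
  osc b (2 * pi * (l%:R - l'%:R) / T) p q (t + T) =
  expR (b * T) *: osc b (2 * pi * (l%:R - l'%:R) / T) p q t.
Proof.
move=> T0; rewrite /osc scalerA -expRD [b * (t + T)]mulrDr addrC; congr (_ *: _).
have e : 2 * pi * (l%:R - l'%:R) / T * (t + T) + 2 * pi * l'%:R =
   2 * pi * (l%:R - l'%:R) / T * t + 2 * pi * l%:R :> R.
  by field; rewrite gt_eqF.
have [s1 c1] := sin_cos_period (2 * pi * (l%:R - l'%:R) / T * (t + T)) l'.
have [s2 c2] := sin_cos_period (2 * pi * (l%:R - l'%:R) / T * t) l.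
by rewrite -s1 -c1 e s2 c2.
Qed.

(** The weight r / T balances the two parts. The resolvent part sums to O(T), since
    the frequencies have spacing 2 pi / T. The coefficient part is at most
    O(H^2 W / T) by Bessel's inequality, because a proportion W / T of the sample
    points carries s. *)
Lemma coefficient_sum_le (T W H r : R) (m : nat) (s : nat -> 'cV[R]_n) l :
  1 <= W -> W <= T -> T <= m%:R -> 0 <= H -> 0 < r ->
  (forall j, (j < m)%N -> `|s j| <= H) -> (forall j, W <= j%:R * T / m%:R -> s j = 0) ->
  \sum_(l' < m) (r / T * (1 + `|2 * pi * (l%:R - l'%:R) / T|) ^- 2 + (r / T)^-1 *
    (`|m%:R^-1 *: \sum_(j < m) cos (2 * pi * (l%:R - l'%:R) * j%:R / m%:R) *: s j| +
     `|m%:R^-1 *: \sum_(j < m) sin (2 * pi * (l%:R - l'%:R) * j%:R / m%:R) *: s j|) ^+ 2)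
  <= 4 * (n%:R + 1) * (r + H ^+ 2 * W / r).
Proof.
move=> W1 WT Tm H0 r0 sH sW.
have T0 : 0 < T by rewrite (lt_le_trans ltr01)// (le_trans W1).
have mp : 0 < m%:R :> R by rewrite (lt_le_trans T0).
have m0 : (0 < m)%N by rewrite -(ltr0n R).
have W0 : 0 < W by rewrite (lt_le_trans ltr01).
rewrite big_split/= -!mulr_sumr.
have h1 : \sum_(l' < m) (1 + `|2 * pi * (l%:R - l'%:R) / T|) ^- 2 <= 4 * T.
  have a0 : 0 < 2 * pi / T :> R by rewrite divr_gt0// mulr_gt0// pi_gt0.
  have e (l' : 'I_m) : `|2 * pi * (l%:R - l'%:R) / T| = 2 * pi / T * `|l%:R - l'%:R|.
    by rewrite mulrAC normrM gtr0_norm.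
  under eq_bigr do rewrite e.
  apply: (le_trans (inverse_square_sum m l a0)); rewrite invf_div.
  have : T / (2 * pi) <= T.
    by rewrite ler_pdivrMr ?mulr_gt0 ?pi_gt0// ler_peMr ?(ltW T0)//; have := pi_ge2 R; lra.
  by move: (T / _) => z zT; lra.
have h2 := discrete_bessel s l m0.
have h3 : \sum_(j < m) `|s j| ^+ 2 <= H ^+ 2 * (W / (T / m%:R) + 1).
  have g0 : 0 < T / m%:R by rewrite divr_gt0.
  apply: le_trans (ler_wpM2l (exprn_ge0 _ H0) (sample_count m g0 (ltW W0))).
  rewrite mulr_sumr; apply: ler_sum => j _; case: ifPn => [_|].
    by rewrite mulr1 lerXn2r ?nnegrE// sH.
  by rewrite -leNgt mulrA => /sW ->; rewrite normr0 expr2 !mulr0.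
have h4 : (r / T)^-1 * (2 * n%:R / m%:R * (H ^+ 2 * (W / (T / m%:R) + 1))) <= 4 * n%:R * (H ^+ 2 * W / r).
  have -> : (r / T)^-1 * (2 * n%:R / m%:R * (H ^+ 2 * (W / (T / m%:R) + 1))) =
    2 * n%:R * H ^+ 2 / r * (W + T / m%:R) by field; rewrite !gt_eqF.
  have -> : 4 * n%:R * (H ^+ 2 * W / r) = 2 * n%:R * H ^+ 2 / r * (W + W) by field; rewrite gt_eqF.
  rewrite ler_wpM2l ?divr_ge0 ?mulr_ge0 ?exprn_ge0 ?(ltW r0)// lerD2l.
  by rewrite (le_trans _ W1)// ler_pdivrMr// mul1r.
have rT0 : 0 <= r / T by rewrite divr_ge0 ?(ltW r0)// ltW.
apply: (le_trans (lerD (ler_wpM2l rT0 h1) (ler_wpM2l _ (le_trans h2 (ler_wpM2l _ h3))))).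
- by rewrite invr_ge0.
- by rewrite divr_ge0// mulr_ge0.
apply: (le_trans (lerD (lexx _) h4)).
have -> : r / T * (4 * T) = 4 * r by field; rewrite gt_eqF.
have X0 : 0 <= H ^+ 2 * W / r by rewrite divr_ge0 ?mulr_ge0 ?exprn_ge0// ltW.
have : 0 <= n%:R * r by rewrite mulr_ge0// ltW.
move: X0; move: (H ^+ 2 * W / r) => X X0 nr0.
have : 0 <= n%:R * X by rewrite mulr_ge0.
lra.
Qed.

(** The amplitudes P of the solution are obtained by applying the inverse
    characteristic matrices to the discrete Fourier coefficients A - i D of the
    forcing. The bound for y is independent of the period T: only the length W of
    the interval that carries the forcing enters, as for an L^2 norm. *)
Lemma periodic_forcing (b T W H r e : R) (p : R -> 'cV[R]_n) : 0 <= b <= B ->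
  1 <= W -> W <= T -> 0 <= H -> 0 < r -> 0 < e -> continuous p -> p 0 = 0 ->
  (forall t, W <= t -> p t = 0) -> (forall t, 0 <= t <= T -> `|p t| <= H) ->
  exists y q, [/\ traj y,
    forall t, has_deriv y t (L (hist y t) + expR (b * t) *: q t),
    forall t, 0 <= t <= T -> `|q t - p t| <= e,
    forall t, y (t + T) = expR (b * T) *: y t &
    forall t, `|y t| <= expR (b * t) * (K * 4 * (n%:R + 1) * (r + H ^+ 2 * W / r))].
Proof.
move=> bB W1 WT H0 r0 e0 cp p0 pW pH; have /andP[b0 _] := bB.
have T0 : 0 < T by rewrite (lt_le_trans ltr01)// (le_trans W1).
have [m0 Hm0] := fejer_approx T0 cp p0 (pW T WT) pH e0.
(* m >= T makes the spacing T / m of the sample points at most 1. *)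
pose m := (maxn m0 (Num.truncn T)).+1.
have m_gt0 : (0 < m)%N by [].
have m0m : (m0 <= m)%N by rewrite /m leqW// leq_maxl.
have Tm : T <= m%:R.
  by apply/ltW/(lt_le_trans (truncnS_gt T)); rewrite ler_nat ltnS leq_maxr.
clearbody m.
pose s (j : nat) := p (j%:R * T / m%:R).
pose w (z : nat * nat) : R := 2 * pi * (z.1%:R - z.2%:R) / T.
pose A (z : nat * nat) := m%:R^-1 *: \sum_(j < m) cos (2 * pi * (z.1%:R - z.2%:R) * j%:R / m%:R) *: s j.
pose D (z : nat * nat) := m%:R^-1 *: \sum_(j < m) sin (2 * pi * (z.1%:R - z.2%:R) * j%:R / m%:R) *: s j.
have /choice[P HP] : forall z, exists pq : 'cV[R]_n * 'cV[R]_n,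
    charRe L b (w z) pq.1 pq.2 = A z /\ charIm L b (w z) pq.1 pq.2 = - D z.
  by move=> z; have [u [v h]] := Hsurj (w z) (A z) (- D z) b0; exists (u, v).
pose o (l l' : nat) := osc b (w (l, l')) (P (l, l')).1 (P (l, l')).2.
pose y t := m%:R^-1 *: \sum_(l < m) \sum_(l' < m) o l l' t.
have ot l l' : traj (o l l') by exact: osc_traj.
have ot' (l : 'I_m) : traj (fun t => \sum_(l' < m) o l l' t) by apply: traj_sum => l'; exact: ot.
exists y, (fun t => m%:R^-1 *: (\sum_(j < m) fejer m T (t - j%:R * T / m%:R) *: p (j%:R * T / m%:R))).
split.
- by apply: trajZ; apply: traj_sum.
- move=> t.
  have -> : L (hist y t) = m%:R^-1 *: \sum_(l < m) \sum_(l' < m) L (hist (o l l') t).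
    rewrite /y histZ ?hist_sum//; last exact: traj_sum.
    rewrite linearZ/= linear_sum; congr (_ *: _); apply: eq_bigr => l _.
    by rewrite hist_sum// linear_sum.
  rewrite -(osc_fourier_kernel b (fun j => p (j%:R * T / m%:R)))// -scalerDr -big_split/=.
  apply: has_derivZ; apply: has_deriv_sum => l; rewrite -big_split/=.
  apply: has_deriv_sum => l'.
  have [h1 h2] := HP ((l : nat), (l' : nat)).
  have := osc_solves eta0 L (w ((l : nat), (l' : nat))) (P ((l : nat), (l' : nat))).1 (P ((l : nat), (l' : nat))).2 t b0.
  by rewrite h1 h2.
- by move=> t tT; exact: Hm0.
- move=> t; rewrite /y scalerA mulrC -scalerA; congr (_ *: _); rewrite scaler_sumr.
  apply: eq_bigr => l _; rewrite scaler_sumr; apply: eq_bigr => l' _.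
  exact: osc_periodic.
move=> t; rewrite /y normrZ normfV gtr0_norm ?ltr0n// mulrC ler_pdivrMr ?ltr0n//.
have term (l l' : nat) : `|o l l' t| <= expR (b * t) * (K * (r / T * (1 + `|w (l, l')|) ^- 2 +
   (r / T)^-1 * (`|A (l, l')| + `|D (l, l')|) ^+ 2)).
  apply: (le_trans (osc_norm_le _ _ _ _ _)); rewrite ler_wpM2l ?expR_ge0//.
  apply: resolvent_am_gm; [exact: K0|exact: normr_ge0|by apply: addr_ge0|exact: divr_gt0|].
  have [h1 h2] := HP (l, l').
  have := HK (w (l, l')) (P (l, l')).1 (P (l, l')).2 bB.
  by rewrite h1 h2 normrN.
have inner (l : 'I_m) : `|\sum_(l' < m) o l l' t| <= expR (b * t) * (K * 4 * (n%:R + 1) * (r + H ^+ 2 * W / r)).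
  apply: (le_trans (ler_norm_sum _ _ _)); apply: (le_trans (ler_sum _ (fun (l' : 'I_m) _ => term l l'))).
  rewrite -!mulr_sumr ler_wpM2l ?expR_ge0//.
  have -> : K * 4 * (n%:R + 1) * (r + H ^+ 2 * W / r) = K * (4 * (n%:R + 1) * (r + H ^+ 2 * W / r)).
    by rewrite -!mulrA.
  rewrite ler_pM2l//; apply: (@coefficient_sum_le T W H r m s l W1 WT Tm H0 r0).
    move=> j jm; apply: pH; rewrite divr_ge0 ?mulr_ge0 ?(ltW T0)//=.
    by rewrite ler_pdivrMr ?ltr0n// mulrC ler_pM2l// ler_nat ltnW.
  by move=> j hj; exact: pW.
apply: (le_trans (ler_norm_sum _ _ _)); apply: (le_trans (ler_sum _ (fun l _ => inner l))).
by rewrite sumr_const card_ord -[leLHS]mulr_natr.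
Qed.

End PeriodicForcing.

(** * Forced linear equations with zero history *)

(** The continuation of h beyond T decreases linearly to 0 on [T, T + 1]; clamping
    the argument of h keeps it in [0, T]. *)
Lemma taper {R : realType} n (T H : R) (h : R -> 'cV[R]_n) : 0 <= T -> continuous h ->
  (forall t, 0 <= t <= T -> `|h t| <= H) -> exists p : R -> 'cV[R]_n,
  [/\ continuous p, forall t, t <= T -> p t = h t, forall t, T + 1 <= t -> p t = 0 &
      forall t, 0 <= t -> `|p t| <= H].
Proof.
move=> T0 ch hH.
exists (fun t => Num.max (Num.min (T + 1 - t) 1) 0 *: h (Num.min t T)); split.
- move=> t; apply: cvgZ.
    apply: (@continuous_comp _ _ _ (fun t => Num.min (T + 1 - t) 1) (fun t => Num.max t 0)).
      apply: (@continuous_comp _ _ _ (fun t => T + 1 - t) (fun t => Num.min t 1)).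
        by apply: continuousB; [exact: cst_continuous|exact: cvg_id].
      exact: minr_continuous.
    exact: maxr_continuous.
  apply: (@continuous_comp _ _ _ (fun t => Num.min t T) h); first exact: minr_continuous.
  exact: ch.
- move=> t tT; rewrite (min_r (_ : 1 <= T + 1 - t)); last by lra.
  by rewrite max_l// scale1r min_l.
- move=> t tT; rewrite max_r ?scale0r// ge_min; apply/orP; left; lra.
- move=> t t0; rewrite normrZ -[leRHS]mul1r ler_pM//.
    rewrite ger0_norm ?le_max ?lexx ?orbT// ge_max ler01 andbT ge_min lexx orbT//.
  by apply: hH; rewrite le_min t0 T0 ge_min lexx orbT.
Qed.

Lemma collect_errors {R : realType} (Y E f G e r T : R) : 0 < E -> 0 <= f -> 0 <= Y -> 0 <= e ->
  1 <= G -> (4 * E * f + 2 * E * T) * e <= r ->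
  G * Y + (2 * Y + 4 * E * f * e + G * (2 * E * T * e)) <= G * (3 * Y + r).
Proof.
move=> E0 f0 Y0 e0 G1 h.
have G0 : 0 <= G by rewrite (le_trans ler01).
apply: (@le_trans _ _ (G * (3 * Y + (4 * E * f + 2 * E * T) * e))); last first.
  by rewrite ler_wpM2l// lerD2l.
have h1 : 0 <= (G - 1) * (2 * Y + 4 * E * f * e).
  by rewrite mulr_ge0 ?subr_ge0// addr_ge0// !mulr_ge0// ltW.
rewrite -subr_ge0; apply: (le_trans h1); rewrite le_eqVlt; apply/orP; left; apply/eqP; ring.
Qed.

Section LinearEquation.
Context {R : realType} {n : nat} (eta : R) (eta0 : 0 < eta).
Variable L : {linear BUC n eta -> 'cV[R]_n}.
Variable l : R.
Hypothesis l0 : 0 < l.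
Hypothesis Ll : forall phi, `|L phi| <= l * `|phi|.
Notation hist := (hist eta).
Notation traj := (@traj R n eta).

Definition solves_linear x := traj x /\ forall t, 0 < t -> has_deriv x t (L (hist x t)).

Lemma solves_linear_shift x a : 0 <= a -> solves_linear x -> solves_linear (fun s => x (a + s)).
Proof.
move=> a0 [tx hx]; split; first exact: traj_shift.
by move=> t t0; apply: has_deriv_shift; rewrite hist_shift; apply: hx; rewrite ltr_wpDl.
Qed.

Lemma linear_growth x : solves_linear x -> forall t, 0 <= t ->
  `|hist x t| <= 2 * expR (2 * l * t) * `|hist x 0|.
Proof.
move=> [tx hx] t t0.
have := @gronwall R n eta eta0 x (fun t => L (hist x t)) l 0 t l0 (lexx 0) t0 tx
  (fun s h => hx s (proj1 (andP h))) _ t.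
rewrite mul0r addr0; apply; last by rewrite t0 lexx.
by move=> s _; rewrite addr0.
Qed.

Lemma linear_exists (phi : BUC n eta) : exists2 x, solves_linear x & hist x 0 = phi.
Proof.
have Lip (u v : BUC n eta) : `|L u - L v| <= l * `|u - v| by rewrite -linearB.
have [x [tx xphi hx]] := picard_solution eta0 l0 Lip phi.
by exists x => //; exact: hist_glue.
Qed.

(** The difference satisfies a linear inequality with zero history, so Gronwall's
    inequality applies. *)
Lemma forced_vs_linear x (dx : R -> 'cV[R]_n) r T : 0 <= T -> 0 <= r -> traj x ->
  (forall t, 0 < t < T -> has_deriv x t (dx t)) ->
  (forall t, 0 < t < T -> `|dx t - L (hist x t)| <= r) ->
  exists z, [/\ solves_linear z, hist z 0 = hist x 0 &
    `|hist x T| <= `|hist z T| + 2 * expR (2 * l * T) * (r * T)].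
Proof.
move=> T0 r0 tx hx hr; have [z [tz hz] z0] := linear_exists (hist x 0).
exists z; split => //; apply: norm_le_dist.
have txz : traj (fun s => x s - z s) by exact: trajB.
have := @gronwall R n eta eta0 (fun s => x s - z s) (fun t => dx t - L (hist z t)) l r T l0 r0 T0 txz _ _ T.
rewrite !histB// z0 subrr normr0 add0r; apply; last by rewrite T0 lexx.
  by move=> t tT; apply: has_derivB; [exact: hx|apply: hz; case/andP: tT].
move=> t tT; rewrite histB//.
have -> : dx t - L (hist z t) = L (hist x t - hist z t) + (dx t - L (hist x t)).
  by rewrite linearB [RHS]addrC subrKA.
by rewrite (le_trans (ler_normD _ _))// lerD ?hr.
Qed.

Definition decays b k m := forall x, solves_linear x ->
  `|hist x m| <= k * expR (b * m) * `|hist x 0|.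

(** Every k > 0 is allowed, so decaying 0 says that the linear flow contracts by
    any given factor after a suitable time. *)
Definition decaying b := forall k, 0 < k -> exists2 m, 1 <= m & decays b k m.

Section ForcedEstimate.
Variables (B C : R).
Hypothesis C0 : 0 < C.
Hypothesis periodic : forall (b T W H r e : R) (p : R -> 'cV[R]_n), 0 <= b <= B ->
  1 <= W -> W <= T -> 0 <= H -> 0 < r -> 0 < e -> continuous p -> p 0 = 0 ->
  (forall t, W <= t -> p t = 0) -> (forall t, 0 <= t <= T -> `|p t| <= H) ->
  exists y q, [/\ traj y,
    forall t, has_deriv y t (L (hist y t) + expR (b * t) *: q t),
    forall t, 0 <= t <= T -> `|q t - p t| <= e,
    forall t, y (t + T) = expR (b * T) *: y t &
    forall t, `|y t| <= expR (b * t) * (C * (r + H ^+ 2 * W / r))].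

(** The forcing is repeated with the long period W + m. Since b is a decaying rate,
    the periodic solution y has almost forgotten its past at the start of each
    period. So it is nearly the solution with zero history on [0, T], and the
    bound for y carries over. *)
Lemma forced_estimate b T H r z (h : R -> 'cV[R]_n) : 0 <= b <= B -> decaying b ->
  0 <= T -> 0 <= H -> 0 < r -> traj z -> (forall t, t <= 0 -> z t = 0) ->
  continuous h -> h 0 = 0 ->
  (forall t, 0 < t < T -> has_deriv z t (L (hist z t) + h t)) ->
  (forall t, 0 <= t <= T -> `|h t| <= H * expR (b * t)) ->
  `|z T| <= expR (b * T) * (3 * (C * (r + H ^+ 2 * (T + 1) / r)) + r).
Proof.
move=> bB db T0 H0 r0 tz z0 ch h0 hz hH; have /andP[b0 _] := bB.
have k0 : 0 < (expR (2 * l * T))^-1 by rewrite invr_gt0 expR_gt0.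
have [m m1 Hm] := db _ k0.
have m0 : 0 <= m by rewrite (le_trans ler01).
pose g t := expR (- b * t) *: h t.
have hg t : h t = expR (b * t) *: g t.
  by rewrite /g scalerA -expRD mulNr subrr expR0 scale1r.
have cg : continuous g by move=> t; apply: cvgZ; [exact: expR_lin_continuous|exact: ch].
have gH t : 0 <= t <= T -> `|g t| <= H.
  move=> tT; rewrite /g normrZ gtr0_norm ?expR_gt0// mulNr expRN mulrC.
  by rewrite ler_pdivrMr ?expR_gt0// hH.
have [p [cp pg p0W pH]] := taper T0 cg gH.
pose W := T + 1.
have W1 : 1 <= W by rewrite lerDr.
have W0 : 0 <= W by rewrite (le_trans ler01).
pose Y := C * (r + H ^+ 2 * W / r).
have Y0 : 0 <= Y.
  by rewrite mulr_ge0 ?(ltW C0)// addr_ge0 ?(ltW r0)// divr_ge0 ?(ltW r0)// mulr_ge0 ?exprn_ge0.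
pose D := 4 * expR (2 * l * T) * (expR (2 * l * m) * m) + 2 * expR (2 * l * T) * T.
have D0 : 0 <= D by rewrite addr_ge0// !mulr_ge0 ?expR_ge0.
have DE : D = 4 * expR (2 * l * T) * (expR (2 * l * m) * m) + 2 * expR (2 * l * T) * T by [].
clearbody D.
pose e := r / (D + 1).
have e0 : 0 < e by rewrite divr_gt0// ltr_wpDl.
have De : D * e <= r.
  by rewrite /e mulrCA ler_piMr ?(ltW r0)// ler_pdivrMr ?mul1r ?lerDl ?ltr_wpDl.
have p0 : p 0 = 0 by rewrite pg// /g h0 scaler0.
have WT : W <= W + m by rewrite lerDl.
have [y [q [ty hy qp yper ybd]]] := periodic bB W1 WT H0 r0 e0 cp p0 p0W
  (fun t h => pH t (proj1 (andP h))).
rewrite -/Y in ybd.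
have eb s t : s <= t -> expR (b * s) <= expR (b * t) by move=> st; rewrite ler_expR ler_wpM2l.
have yh t : `|hist y t| <= expR (b * t) * Y.
  apply: hist_norm_le => // s st; apply: (@le_trans _ _ (`|y s|)).
    rewrite ler_piMl// -expR0 ler_expR mulr_ge0_le0 ?(ltW eta0)// subr_le0//.
  by rewrite (le_trans (ybd s))// ler_wpM2r// eb.
(* The history one period later is exp(b(W + m)) times the present one. During
   the last stretch, of length m, the forcing is within e of zero and the linear
   flow contracts relative to exp(bm), so y_0 is bounded by a small multiple of
   the norm of y. *)
have y0 : `|hist y 0| <= (expR (2 * l * T))^-1 * Y + 2 * (expR (2 * l * m) * m) * e.
  have tyW := traj_shift W ty.
  have bd t : 0 < t < m -> `|L (hist y (W + t)) + expR (b * (W + t)) *: q (W + t) -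
      L (hist (fun s => y (W + s)) t)| <= expR (b * (W + m)) * e.
    move=> /andP[t0 tm]; rewrite hist_shift addrC addKr normrZ ger0_norm ?expR_ge0// ler_pM ?expR_ge0//.
      by rewrite eb// lerD2l ltW.
    rewrite -[q _]subr0 -(p0W (W + t)) ?lerDl ?(ltW t0)//.
    by apply: qp; rewrite addr_ge0 ?(ltW t0)//= lerD2l ltW.
  have [x [lx x0 hx]] := @forced_vs_linear (fun s => y (W + s))
    (fun t => L (hist y (W + t)) + expR (b * (W + t)) *: q (W + t)) (expR (b * (W + m)) * e) m m0
    (mulr_ge0 (expR_ge0 _) (ltW e0)) tyW
    (fun t _ => has_deriv_shift (hy (W + t))) bd.
  have := Hm x lx; rewrite x0 !hist_shift addr0 => h1.
  have {}h1 : `|hist y (W + m)| <= (expR (2 * l * T))^-1 * expR (b * m) * (expR (b * W) * Y) +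
      2 * expR (2 * l * m) * (expR (b * (W + m)) * e * m).
    rewrite hist_shift in hx; apply: (le_trans hx); rewrite lerD2r (le_trans h1)//.
    by rewrite ler_wpM2l// mulr_ge0 ?invr_ge0 ?expR_ge0.
  have yT : hist y (W + m) = expR (b * (W + m)) *: hist y 0.
    apply: eq_buc => th th0; rewrite bucZE !histE// add0r addrC yper//.
  rewrite yT normrZ ger0_norm ?expR_ge0// in h1.
  rewrite -(ler_pM2l (expR_gt0 (b * (W + m)))) (le_trans h1)//.
  by rewrite [b * (W + m)]mulrDr expRD le_eqVlt; apply/orP; left; apply/eqP; ring.
have tyz : traj (fun s => y s - z s) by exact: trajB.
have hz0 : hist z 0 = 0.
  by apply: eq_buc => th th0; rewrite histE// add0r min_l// z0.
have bd t : 0 < t < T -> `|(L (hist y t) + expR (b * t) *: q t) - (L (hist z t) + h t) -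
    L (hist (fun s => y s - z s) t)| <= expR (b * T) * e.
  move=> /andP[t0 tT]; rewrite histB// linearB opprD addrACA [_ - _ + _]addrC addrK.
  rewrite hg -scalerBr normrZ ger0_norm ?expR_ge0// ler_pM ?expR_ge0//; first by rewrite eb// ltW.
  rewrite -pg ?(ltW tT)//; apply: qp; rewrite (ltW t0) /= (le_trans (ltW tT))//.
  by rewrite (le_trans _ WT)// lerDl.
have [x [lx x0 hx]] := @forced_vs_linear (fun s => y s - z s)
  (fun t => (L (hist y t) + expR (b * t) *: q t) - (L (hist z t) + h t)) (expR (b * T) * e) T T0
  (mulr_ge0 (expR_ge0 _) (ltW e0)) tyz
  (fun t tT => has_derivB (hy t) (hz t tT)) bd.
rewrite histB// histB// hz0 subr0 in x0 hx.
have h1 := linear_growth lx T0; rewrite x0 in h1.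
have zy : `|z T| <= `|y T| + `|hist y T - hist z T|.
  rewrite -{1}(subKr (y T) (z T)) (le_trans (ler_normB _ _))// lerD2l.
  by rewrite -histB//; exact: (norm_le_hist T tyz).
apply: (le_trans zy); apply: (le_trans (lerD (ybd T) hx)).
apply: (le_trans (lerD (lexx _) (lerD h1 (lexx _)))).
apply: (le_trans (lerD (lexx _) (lerD (ler_wpM2l _ y0) (lexx _)))); first by rewrite mulr_ge0 ?expR_ge0.
rewrite -/W -/Y.
clearbody e.
set E := expR (2 * l * T) in DE *; set F := expR (2 * l * m) in DE *; set G := expR (b * T).
have E0 : 0 < E by exact: expR_gt0.
have G1 : 1 <= G by rewrite -expR0 ler_expR mulr_ge0.
have -> : 2 * E * (E^-1 * Y + 2 * (F * m) * e) + 2 * E * (G * e * T) =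
  2 * Y + (4 * E * (F * m)) * e + G * (2 * E * T * e) by field; rewrite gt_eqF.
have Fm0 : 0 <= F * m by rewrite mulr_ge0 ?expR_ge0.
by apply: collect_errors => //; [exact: ltW|rewrite -DE].
Qed.

End ForcedEstimate.
End LinearEquation.

(** * Decay of the linear flow *)

Lemma expRN_le_inv {R : realType} (c t : R) : 0 < c -> 0 < t -> expR (- (c * t)) <= (c * t)^-1.
Proof.
move=> c0 t0; have ct : 0 < c * t by exact: mulr_gt0.
rewrite expRN lef_pV2 ?posrE ?expR_gt0//.
by apply: le_trans (expR_ge1Dx _); rewrite lerDr.
Qed.

Lemma half_absorb {R : realType} (x : R) : x <= 1 / 2 * x -> x <= 0.
Proof. by move=> ?; lra. Qed.

Section Decay.
Context {R : realType} {n : nat} (eta : R) (eta0 : 0 < eta).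
Variable L : {linear BUC n eta -> 'cV[R]_n}.
Variable l : R.
Hypothesis l0 : 0 < l.
Hypothesis Ll : forall phi, `|L phi| <= l * `|phi|.
Notation hist := (hist eta).
Notation traj := (@traj R n eta).
Notation decaying := (decaying L).
Notation decays := (decays L).
Variables (B C : R).
Hypothesis C0 : 0 < C.
Hypothesis forced : forall b T H r z (h : R -> 'cV[R]_n), 0 <= b <= B -> decaying b ->
  0 <= T -> 0 <= H -> 0 < r -> traj z -> (forall t, t <= 0 -> z t = 0) ->
  continuous h -> h 0 = 0 ->
  (forall t, 0 < t < T -> has_deriv z t (L (hist z t) + h t)) ->
  (forall t, 0 <= t <= T -> `|h t| <= H * expR (b * t)) ->
  `|z T| <= expR (b * T) * (C * (r + H ^+ 2 * (T + 1) / r)).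

(** A quadratic ramp: its derivative also vanishes at 0, so that the forcing of the
    ramped solution is continuous. *)
Definition ramp (T t : R) := (Num.max t 0 / T) ^+ 2.

Lemma ramp_continuous T : continuous (ramp T).
Proof.
move=> t; rewrite /ramp; under eq_fun do rewrite expr2.
by apply: cvgM; (apply: cvgM; [exact: maxr_continuous|exact: cst_continuous]).
Qed.

Lemma ramp_deriv T t : 0 < t -> has_deriv (ramp T) t (2 * t / T ^+ 2).
Proof.
move=> t0; apply: (@has_deriv_near _ _ (fun s => (s / T) ^+ 2) _ t _ t t0).
  by move=> s; rewrite ltr_norml => /andP[h _]; rewrite /ramp max_l//; lra.
have [->|TN] := eqVneq T 0.
  rewrite expr0n invr0 mulr0; under eq_fun do rewrite mulr0 expr0n.
  exact: has_deriv_cst.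
move=> e e0; have T2 : 0 < T ^+ 2 by rewrite exprn_even_gt0.
exists (e * T ^+ 2) => [|h hd]; first exact: mulr_gt0.
have -> : ((t + h) / T) ^+ 2 - (t / T) ^+ 2 - h *: (2 * t / T ^+ 2) = h / T ^+ 2 * h.
  by rewrite /GRing.scale /=; field.
rewrite normrM ler_wpM2r// normrM normfV (gtr0_norm T2).
by rewrite ler_pdivrMr// ltW.
Qed.

Lemma ramp_lip T s t : 0 < T -> s <= t -> 0 <= t <= T ->
  `|ramp T t - ramp T s| <= 2 / T * (t - s).
Proof.
move=> T0 st /andP[t0 tT]; rewrite /ramp [Num.max t 0]max_l//.
set m := Num.max s 0.
have m0 : 0 <= m by rewrite le_max lexx orbT.
have mt : m <= t by rewrite ge_max st.
have ms : s <= m by rewrite le_max lexx.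
have -> : (t / T) ^+ 2 - (m / T) ^+ 2 = (t + m) / T * ((t - m) / T) by field; rewrite gt_eqF.
have h1 : 0 <= (t - m) / T by rewrite divr_ge0 ?(ltW T0)// subr_ge0.
have h2 : 0 <= (t + m) / T by rewrite divr_ge0 ?(ltW T0)// addr_ge0.
have -> : 2 / T * (t - s) = 2 * ((t - s) / T) by rewrite mulrAC mulrA.
rewrite ger0_norm; last exact: mulr_ge0.
rewrite ler_pM//; first by rewrite ler_pdivrMr// mulr_natl mulr2n lerD// (le_trans mt).
by rewrite ler_pM2r ?invr_gt0// lerD2l lerN2.
Qed.

(** Multiplying a solution x by the ramp costs the forcing
    ramp' x + L(ramp(t) x_t - (ramp x)_t). It has relative size O(1/T), since the
    ramp varies by at most 2|s - t|/T and the weight exp(eta(s - t)) absorbs the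
    factor |s - t|. With the weight r0 M, the estimate of forced_estimate then gives
    k M / 2 from the first term and O(M / T) from the second. *)
Lemma ramp_estimate k : 0 < k -> exists2 T1, 1 <= T1 & forall b x M T,
  0 <= b <= B -> decaying b -> solves_linear L x -> 0 <= M -> T1 <= T ->
  (forall t, 0 <= t <= T -> `|hist x t| <= M * expR (b * t)) ->
  `|x T| <= k * M * expR (b * T).
Proof.
move=> k0; pose c := 1 + l / eta.
have c0 : 0 < c by rewrite addr_gt0// divr_gt0.
pose r0 := k / (2 * C).
have r00 : 0 < r0 by rewrite divr_gt0// mulr_gt0.
have r0E : r0 = k / (2 * C) by [].
have cE : c = 1 + l / eta by [].
clearbody r0 c.
have Q0 : 0 <= 16 * C * c ^+ 2 / (r0 * k).
  by apply/divr_ge0; apply/ltW; rewrite !mulr_gt0 ?exprn_gt0.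
pose T1 := 16 * C * c ^+ 2 / (r0 * k) + 1.
exists T1; first by rewrite lerDr.
move=> b x M T bB db [tx hx] M0 T1T hM; have /andP[b0 _] := bB.
have T1p : 1 <= T.
  by rewrite (le_trans _ T1T)// lerDr.
have T0 : 0 < T by rewrite (lt_le_trans ltr01).
have [MN|MN] := eqVneq M 0.
  rewrite MN in hM *; have := hM T; rewrite (ltW T0) lexx => /(_ isT); rewrite !mulr0 !mul0r.
  by apply: le_trans; exact: norm_le_hist.
have Mp : 0 < M by rewrite lt_def MN.
pose z t := ramp T t *: x t.
pose h t := (2 * Num.max t 0 / T ^+ 2) *: x t + L (ramp T t *: hist x t - hist z t).
have cz : continuous z.
  by move=> t; apply: cvgZ; [exact: ramp_continuous|exact: traj_continuous tx t].
have z0 t : t <= 0 -> z t = 0.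
  by move=> t0; rewrite /z /ramp max_r// mul0r expr0n scale0r.
have tz : traj z.
  apply: trajP => // [|e e0].
    by exists 0 => s s0; rewrite /weighted z0// scaler0 normr0.
  by exists 1 => // s t s0 t0 _; rewrite /weighted (z0 s s0) (z0 t t0) !scaler0 subrr normr0.
have ch : continuous h.
  move=> t; apply: cvgD.
    apply: cvgZ; last exact: traj_continuous tx t.
    by apply: cvgM; [apply: cvgM; [exact: cst_continuous|exact: maxr_continuous]|exact: cst_continuous].
  have Lip (u v : BUC n eta) : `|L u - L v| <= l * `|u - v| by rewrite -linearB.
  apply: (@continuous_comp _ _ _ (fun t => ramp T t *: hist x t - hist z t) L).
    apply: cvgB; last exact: hist_continuous.
    by apply: cvgZ; [exact: ramp_continuous|exact: hist_continuous].
  exact: (lipschitz_continuous Lip).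
have h0 : h 0 = 0.
  rewrite /h maxxx mulr0 mul0r scale0r add0r (_ : _ - _ = 0) ?linear0//.
  apply: eq_buc => th th0; rewrite bucBE bucZE !histE// add0r min_l// z0// /ramp maxxx mul0r.
  by rewrite expr0n /= scale0r subrr.
have hz t : 0 < t < T -> has_deriv z t (L (hist z t) + h t).
  move=> /andP[t0 tT].
  rewrite /h linearB linearZ/= max_l ?(ltW t0)// addrCA subrKC.
  exact: has_deriv_scale (ramp_deriv T t0) (hx t t0).
pose H := 2 / T * c * M.
have H0 : 0 <= H by rewrite !mulr_ge0 ?invr_ge0 ?(ltW T0)// ltW.
have hH t : 0 <= t <= T -> `|h t| <= H * expR (b * t).
  move=> /andP[t0 tT].
  have xt : `|hist x t| <= M * expR (b * t) by rewrite hM// t0.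
  rewrite (_ : H * _ = 2 / T * (M * expR (b * t)) + l * (2 / T / eta * (M * expR (b * t)))); last first.
    by rewrite /H cE; field; rewrite !gt_eqF.
  rewrite (le_trans (ler_normD _ _))// lerD//.
    rewrite normrZ ler_pM//; last by rewrite (le_trans (norm_le_hist t tx)).
    rewrite max_l// ger0_norm ?divr_ge0 ?mulr_ge0 ?exprn_ge0 ?(ltW T0)//.
    rewrite ler_pdivrMr ?exprn_gt0// (_ : 2 / T * T ^+ 2 = 2 * T); last by field; rewrite gt_eqF.
    by rewrite ler_pM2l.
  rewrite (le_trans (Ll _))// ler_wpM2l ?(ltW l0)//.
  have trx : traj (fun s => ramp T t *: x s) by exact: trajZ.
  rewrite -histZ// -histB//; apply: hist_norm_le; first exact: trajB.
  move=> s st; rewrite /z -scalerBl normrZ.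
  have ts : 0 <= t - s by rewrite subr_ge0.
  have lip := ramp_lip T0 st (introT andP (conj t0 tT)).
  have Me0 : 0 <= M * expR (b * t) by rewrite mulr_ge0 ?expR_ge0.
  have [s0|s0] := leP 0 s.
    have xs : `|x s| <= M * expR (b * t).
      apply: (le_trans (norm_le_hist s tx)); apply: (le_trans (hM s _)).
        by rewrite s0 (le_trans st).
      apply: ler_wpM2l; first exact: M0.
      by rewrite ler_expR; apply: ler_wpM2l.
    rewrite mulrA; apply: ler_pM; [|exact: normr_ge0| |exact: xs].
      by apply: mulr_ge0; [exact: expR_ge0|exact: normr_ge0].
    apply: (le_trans (ler_wpM2l (expR_ge0 _) lip)); rewrite mulrCA.
    apply: ler_wpM2l; first by apply: divr_ge0; [exact: ler0n|exact: ltW].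
    have := expR_mul_le eta0 (_ : s - t <= 0); rewrite subr_le0 => /(_ st).
    by rewrite distrC ger0_norm.
  have rs : ramp T s = 0 by rewrite /ramp max_r ?(ltW s0)// mul0r expr0n.
  have lip0 := ramp_lip T0 t0 (introT andP (conj t0 tT)).
  have r0' : ramp T 0 = 0 by rewrite /ramp maxxx mul0r expr0n.
  rewrite r0' !subr0 in lip0; rewrite rs subr0.
  have hs := hist_norm_ub tx (ltW s0); rewrite subr0 in hs.
  have hs' : expR (eta * s) * `|x s| <= M * expR (b * t).
    apply: (le_trans hs); apply: (le_trans (hM 0 _)); first by rewrite lexx ltW.
    apply: ler_wpM2l; first exact: M0.
    by rewrite ler_expR mulr0; apply: mulr_ge0.
  have nt : - t <= 0 by rewrite oppr_le0.
  have e1 := expR_mul_le eta0 nt; rewrite normrN ger0_norm// in e1.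
  have -> : expR (eta * (s - t)) * (`|ramp T t| * `|x s|) =
    (expR (eta * - t) * `|ramp T t|) * (expR (eta * s) * `|x s|).
    by rewrite mulrDr expRD; ring.
  apply: ler_pM; [| | |exact: hs'].
  - by apply: mulr_ge0; [exact: expR_ge0|exact: normr_ge0].
  - by apply: mulr_ge0; [exact: expR_ge0|exact: normr_ge0].
  apply: (le_trans (ler_wpM2l (expR_ge0 _) lip0)); rewrite mulrCA.
  apply: ler_wpM2l; first by apply: divr_ge0; [exact: ler0n|exact: ltW].
  exact: e1.
have rM : 0 < r0 * M by rewrite mulr_gt0.
have := forced bB db (ltW T0) H0 rM tz z0 ch h0 hz hH.
have zT : z T = x T by rewrite /z /ramp max_l ?(ltW T0)// divff ?gt_eqF// expr1n scale1r.
rewrite zT => hfin; apply: (le_trans hfin).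
rewrite mulrC ler_wpM2r ?expR_ge0//.
have -> : C * (r0 * M + H ^+ 2 * (T + 1) / (r0 * M)) =
  M * (C * r0 + 4 * C * c ^+ 2 / r0 * ((T + 1) / T ^+ 2)).
  by rewrite /H; field; rewrite !gt_eqF.
rewrite [leRHS]mulrC ler_wpM2l//.
have -> : C * r0 = k / 2 by rewrite r0E; field; rewrite gt_eqF.
have tt : (T + 1) / T ^+ 2 <= 2 / T.
  rewrite ler_pdivrMr ?exprn_gt0// (_ : 2 / T * T ^+ 2 = T + T); last by field; rewrite gt_eqF.
  by rewrite lerD2l.
have q0 : 0 <= 4 * C * c ^+ 2 / r0.
  by rewrite divr_ge0 ?mulr_ge0 ?exprn_ge0 ?(ltW C0) ?(ltW c0)// ltW.
rewrite [leRHS](splitr k) lerD2l (le_trans (ler_wpM2l q0 tt))//.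
have -> : 4 * C * c ^+ 2 / r0 * (2 / T) = (16 * C * c ^+ 2 / (r0 * k)) * (k / 2) / T.
  by field; rewrite !gt_eqF.
rewrite ler_pdivrMr// [leRHS]mulrC ler_wpM2r ?divr_ge0 ?(ltW k0)//.
by rewrite (le_trans _ T1T)// lerDl.
Qed.

(** For s between T1 and T the pointwise estimate applies; the earlier part of the
    history is weighted by at most exp(- eta (T - T1)). *)
Lemma ramp_history k : 0 < k -> exists2 T2, 1 <= T2 & forall b x M T,
  0 <= b <= B -> decaying b -> solves_linear L x -> 0 <= M -> T2 <= T ->
  (forall t, 0 <= t <= T -> `|hist x t| <= M * expR (b * t)) ->
  `|hist x T| <= k * M * expR (b * T).
Proof.
move=> k0; have [T1 T11 H1] := ramp_estimate k0.
pose T3 := (k * eta)^-1.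
have T30 : 0 < T3 by rewrite invr_gt0 mulr_gt0.
exists (T1 + T3); first by rewrite (le_trans T11)// lerDl ltW.
move=> b x M T bB db lx M0 TT hM; have [tx hx] := lx; have /andP[b0 _] := bB.
have T10 : 0 <= T1 by rewrite (le_trans ler01).
have T1T : T1 <= T by rewrite (le_trans _ TT)// lerDl ltW.
apply: hist_norm_le => // s sT.
have [T1s|sT1] := leP T1 s.
  apply: (@le_trans _ _ (`|x s|)).
    by rewrite ler_piMl// -expR0 ler_expR mulr_ge0_le0 ?(ltW eta0)// subr_le0.
  apply: (le_trans (H1 b x M s bB db lx M0 T1s _)).
    by move=> t /andP[t0 ts]; apply: hM; rewrite t0 (le_trans ts).
  by rewrite ler_wpM2l ?mulr_ge0 ?(ltW k0)// ler_expR ler_wpM2l.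
have h1 := hist_norm_ub tx (ltW sT1).
have -> : expR (eta * (s - T)) * `|x s| = expR (eta * (T1 - T)) * (expR (eta * (s - T1)) * `|x s|).
  by rewrite mulrA -expRD -mulrDr [_ + (s - T1)]addrC subrKA.
rewrite -mulrA ler_pM ?expR_ge0 ?mulr_ge0 ?expR_ge0//.
  apply: (@le_trans _ _ (expR (- (eta * T3)))).
    by rewrite ler_expR -mulrN ler_pM2l//; lra.
  apply: (le_trans (expRN_le_inv eta0 T30)).
  by rewrite /T3 (_ : (eta * (k * eta)^-1)^-1 = k)//; field; rewrite !gt_eqF.
apply: (le_trans h1); apply: (le_trans (hM T1 _)); first by rewrite T10.
by rewrite ler_wpM2l// ler_expR ler_wpM2l.
Qed.

(** Let s maximize exp(-bt) |x_t| on [0, t]. If s >= T2, the maximum is at most half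
    of itself, hence 0; if s < T2, the growth estimate applies. The point is that D
    does not depend on b. *)
Lemma uniform_growth : exists2 D, 0 < D & forall b x, 0 <= b <= B -> decaying b ->
  solves_linear L x -> forall t, 0 <= t -> `|hist x t| <= D * `|hist x 0| * expR (b * t).
Proof.
have [T2 T21 H2] := ramp_history (halfR_gt0 (@ltr01 R)).
exists (2 * expR (2 * l * T2)); first by rewrite mulr_gt0 ?expR_gt0.
move=> b x bB db lx t t0; have [tx hx] := lx; have /andP[b0 _] := bB.
have ch : continuous (fun s => expR (- b * s) * `|hist x s|).
  move=> s; apply: cvgM; first exact: expR_lin_continuous.
  by apply: cvg_norm; exact: hist_continuous.
have [s sI Hs] := EVT_max t0 (continuous_subspaceT ch).
set M := expR (- b * s) * `|hist x s| in Hs.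
have M0 : 0 <= M by rewrite mulr_ge0 ?expR_ge0.
rewrite in_itv/= in sI; have /andP[s0 st] := sI.
have hM u : 0 <= u <= t -> `|hist x u| <= M * expR (b * u).
  move=> ut; have := Hs u; rewrite in_itv/= => /(_ ut).
  by rewrite mulNr expRN mulrC ler_pdivrMr ?expR_gt0.
have ME : `|hist x s| = M * expR (b * s).
  by rewrite /M mulNr expRN mulrAC mulVf ?mul1r// gt_eqF ?expR_gt0.
have Mle : M <= `|hist x s|.
  by rewrite /M ler_piMl// -expR0 ler_expR mulNr oppr_le0 mulr_ge0.
clearbody M.
have D0 : 0 <= 2 * expR (2 * l * T2) * `|hist x 0|.
  apply: mulr_ge0; last exact: normr_ge0.
  apply: mulr_ge0; last exact: expR_ge0.
  exact: ler0n.
suff MD : M <= 2 * expR (2 * l * T2) * `|hist x 0|.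
  by rewrite (le_trans (hM t _)) ?t0 ?lexx// ler_wpM2r ?expR_ge0.
have [T2s|sT2] := leP T2 s.
  have hMs u : 0 <= u <= s -> `|hist x u| <= M * expR (b * u).
    by move=> /andP[u0 us]; apply: hM; rewrite u0 (le_trans us).
  have := H2 b x M s bB db lx M0 T2s hMs; rewrite ME ler_pM2r ?expR_gt0// => h.
  apply: le_trans D0; move: h; exact: half_absorb.
apply: (le_trans Mle); apply: (le_trans (linear_growth eta0 l0 Ll lx s0)).
have l2 : 0 <= 2 * l by rewrite mulr_ge0// ltW.
apply: ler_wpM2r; first exact: normr_ge0.
apply: ler_wpM2l; first exact: ler0n.
by rewrite ler_expR; apply: ler_wpM2l => //; exact: ltW.
Qed.

Lemma decays_iter b m j : 0 <= m -> decays b (1 / 2) m -> decays b ((1 / 2) ^+ j) (j%:R * m).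
Proof.
move=> m0 H; elim: j => [|j IH] x lx.
  by rewrite expr0 !mul0r mulr0 expR0 !mul1r.
have jm : 0 <= j%:R * m by rewrite mulr_ge0.
have := H _ (solves_linear_shift jm lx); rewrite !hist_shift addr0.
have -> : j%:R * m + m = j.+1%:R * m by rewrite -natr1 mulrDl mul1r.
move=> h; apply: (le_trans h).
have p0 : 0 <= 1 / 2 * expR (b * m) by rewrite mulr_ge0 ?expR_ge0.
apply: (le_trans (ler_wpM2l p0 (IH x lx))).
rewrite le_eqVlt; apply/orP; left; apply/eqP.
have -> : b * (j.+1%:R * m) = b * m + b * (j%:R * m) by rewrite -natr1; ring.
rewrite expRD exprS.
move: (expR (b * m)) (expR (b * (j%:R * m))) `|hist x 0| ((1 / 2) ^+ j) => p q r s.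
ring.
Qed.

Lemma decaying_of_half b m : 1 <= m -> decays b (1 / 2) m -> decaying b.
Proof.
move=> m1 H k k0; have m0 : 0 <= m by rewrite (le_trans ler01).
have h : ((1 / 2 : R) ^+ j @[j --> \oo]) --> (0 : R).
  by apply: cvg_expr; rewrite ger0_norm// mul1r invf_lt1// ltr1n.
have /cvgrPdist_lt /(_ k k0) [j _ Hj] := h.
exists (j.+1%:R * m).
  by rewrite (le_trans m1)// ler_peMl// ler1n.
move=> x lx; apply: (le_trans (decays_iter j.+1 m0 H lx)).
rewrite ler_wpM2r// ler_wpM2r ?expR_ge0//.
have := Hj j.+1 (leqnSn j); rewrite sub0r normrN => h'.
by apply/ltW/(le_lt_trans _ h'); exact: ler_norm.
Qed.

(** By ramp_history the flow shrinks by any factor relative to exp(bT), at a time T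
    that is independent of b. The spare factor 1/2 allows the rate to be lowered by
    ln 2 / T. *)
Lemma decaying_step : exists2 d, 0 < d & forall b a, 0 <= b <= B -> decaying b ->
  b - d <= a -> decaying a.
Proof.
have [D D0 HD] := uniform_growth.
have k0 : 0 < (4 * D)^-1 by rewrite invr_gt0 mulr_gt0.
have [T T1 HT] := ramp_history k0.
have T0 : 0 < T by rewrite (lt_le_trans ltr01).
have ln2 : 0 < ln 2 :> R by rewrite ln_gt0// ltr1n.
exists (ln 2 / T); first exact: divr_gt0.
move=> b a bB db ab; apply: (decaying_of_half T1) => x lx.
have := HT b x (D * `|hist x 0|) T bB db lx (mulr_ge0 (ltW D0) (normr_ge0 _)) (lexx T)
  (fun t tT => HD b x bB db lx t (proj1 (andP tT))).
move=> h; apply: (le_trans h).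
have -> : (4 * D)^-1 * (D * `|hist x 0|) * expR (b * T) = 1 / 2 * (expR (b * T) / 2) * `|hist x 0|.
  by field; rewrite gt_eqF.
have e2 : 2 = expR (ln 2) :> R by rewrite lnK ?posrE.
rewrite ler_wpM2r// ler_wpM2l// ler_pdivrMr// [2 in leRHS]e2 -expRD ler_expR.
by move: ab; rewrite lerBlDr => /(ler_wpM2r (ltW T0)); rewrite mulrDl divfK ?gt_eqF//; lra.
Qed.

Hypothesis lB : 2 * l + 1 <= B.

(** Start from the rate B > 2l of Gronwall's inequality and lower it by fixed steps
    until 0 is reached. *)
Lemma linear_decay : decaying 0.
Proof.
have B0 : 0 <= B by rewrite (le_trans _ lB)// addr_ge0// mulr_ge0// ltW.
have [d d0 Hd] := decaying_step.
(* B >= 2l + 1 leaves a factor exp(m) >= m to beat the constant 2 / k. *)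
have start : decaying B.
  move=> k k0; exists (Num.max 1 (2 / k)); first by rewrite le_max lexx.
  set m := Num.max _ _; have m0 : 0 <= m by rewrite le_max ler01.
  move=> x lx; apply: (le_trans (linear_growth eta0 l0 Ll lx m0)); rewrite ler_wpM2r//.
  apply: (@le_trans _ _ (k * (expR (2 * l * m) * expR m))).
    rewrite mulrCA mulrC ler_wpM2l ?expR_ge0// -ler_pdivrMl// mulrC.
    apply: (@le_trans _ _ m); first by rewrite le_max lexx orbT.
    by apply: le_trans (expR_ge1Dx m); rewrite lerDr.
  rewrite ler_wpM2l ?(ltW k0)// -expRD ler_expR -[m in _ + m]mul1r -mulrDl.
  by rewrite ler_wpM2r.
have all j : decaying (Num.max 0 (B - j%:R * d)).
  elim: j => [|j IH]; first by rewrite mul0r subr0 max_r.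
  apply: (Hd _ _ _ IH).
    by rewrite le_max lexx /= ge_max B0 gerBl mulr_ge0// ltW.
  rewrite lerBlDr ge_max; apply/andP; split; first by rewrite addr_ge0 ?(ltW d0)// le_max lexx.
  by rewrite -lerBlDr le_max -natr1 mulrDl mul1r opprD addrA lexx orbT.
have [j Hj] : exists j : nat, B / d <= j%:R.
  by exists (Num.truncn (B / d)).+1; apply/ltW/truncnS_gt.
have := all j; rewrite max_l// subr_le0.
by rewrite -ler_pdivrMr.
Qed.

End Decay.

(** * Decay of the nonlinear flow *)

Lemma quarters {R : realType} : 1 / 2 / 2 + 1 / 4 <= 1 / 2 :> R.
Proof. by lra. Qed.

Section Truncation.
Context {R : realType} {V : normedModType R}.

(** The radial retraction onto the unit ball. *)
Definition retract (u : V) : V := (Num.max 1 `|u|)^-1 *: u.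

Lemma retract_id u : `|u| <= 1 -> retract u = u.
Proof. by move=> u1; rewrite /retract max_l// invr1 scale1r. Qed.

Lemma max1_gt0 (u : V) : 0 < Num.max 1 `|u|.
Proof. by rewrite lt_max ltr01. Qed.

Lemma retract_le1 u : `|retract u| <= 1.
Proof.
rewrite /retract normrZ normfV gtr0_norm ?max1_gt0// mulrC ler_pdivrMr ?max1_gt0//.
by rewrite mul1r le_max lexx orbT.
Qed.

(** The change of the vector and the change of the scaling factor contribute at
    most |u - v| each. *)
Lemma retract_lip u v : `|retract u - retract v| <= 2 * `|u - v|.
Proof.
have -> : retract u - retract v = (Num.max 1 `|u|)^-1 *: (u - v) +
   ((Num.max 1 `|v| - Num.max 1 `|u|) / Num.max 1 `|u|) *: retract v.
  rewrite /retract scalerA scalerBr -addrA; congr (_ + _).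
  rewrite -!scaleNr -scalerDl; congr (_ *: _).
  by field; rewrite !gt_eqF ?max1_gt0.
have a1 : (Num.max 1 `|u|)^-1 <= 1 by rewrite invf_le1 ?max1_gt0// le_max lexx.
have a0 : 0 <= (Num.max 1 `|u|)^-1 by rewrite invr_ge0 ltW ?max1_gt0.
have mm : `|Num.max 1 `|v| - Num.max 1 `|u| | <= `|u - v|.
  have h1 := ler_dist_dist u v; move: h1; rewrite ler_norml => /andP[h1 h2].
  have d0 := normr_ge0 (u - v); rewrite ler_norml.
  by case: (leP 1 `|v|) => hv; case: (leP 1 `|u|) => hu; apply/andP; split; lra.
rewrite (le_trans (ler_normD _ _))// mulr_natl mulr2n lerD// normrZ.
  by rewrite ger0_norm// ler_piMl.
rewrite -[leRHS]mulr1; apply: ler_pM; [exact: normr_ge0|exact: normr_ge0| |exact: retract_le1].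
rewrite normrM (ger0_norm a0) -[leRHS]mulr1; apply: ler_pM => //; exact: normr_ge0.
Qed.

End Truncation.

Section Nonlinear.
Context {R : realType} {n : nat} (eta : R) (eta0 : 0 < eta).
Notation hist := (hist eta).
Notation traj := (@traj R n eta).
Variable f : BUC n eta -> 'cV[R]_n.

Definition solves x := traj x /\ forall t, 0 < t -> has_deriv x t (f (hist x t)).

Lemma differentiable_little_o : differentiable f 0 -> f 0 = 0 -> forall e, 0 < e ->
  exists2 r, 0 < r & forall u, `|u| <= r -> `|f u - 'd f 0 u| <= e * `|u|.
Proof.
move=> df f0 e e0; have := diff_locally df => /eqaddoP /(_ e e0) /nbhs_ballP[d d0 Hd].
exists (d / 2); first exact: halfR_gt0.
move=> u ud; have ub : ball (0 : BUC n eta) d u.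
  by rewrite -ball_normE /= sub0r normrN (le_lt_trans ud)// ltr_pdivrMr// ltr_pMr// ltr1n.
by have := Hd u ub; rewrite /shift /= !fctE /= addr0 f0 add0r.
Qed.

Hypothesis f0 : f 0 = 0.
Hypothesis flip : lipschitz_on_bounded_sets f.

Lemma truncated_lipschitz : exists2 K, 0 < K & forall u v : BUC n eta,
  `|f (retract u) - f (retract v)| <= K * `|u - v|.
Proof.
have [k Hk] := flip (@ltr01 R).
exists (2 * `|k| + 1); first by rewrite ltr_wpDl// mulr_ge0.
move=> u v; apply: (le_trans (Hk _ _ (retract_le1 _) (retract_le1 _))).
apply: (@le_trans _ _ (`|k| * (2 * `|u - v|))).
  apply: (@le_trans _ _ (`|k| * `|retract u - retract v|)).
    by apply: ler_wpM2r; [exact: normr_ge0|exact: ler_norm].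
  by apply: ler_wpM2l; [exact: normr_ge0|exact: retract_lip].
rewrite mulrA [`|k| * 2]mulrC; apply: ler_wpM2r; first exact: normr_ge0.
by rewrite lerDl.
Qed.

Variable L : {linear BUC n eta -> 'cV[R]_n}.
Variable l : R.
Hypothesis l0 : 0 < l.
Hypothesis Ll : forall phi, `|L phi| <= l * `|phi|.
Hypothesis Ldecay : decaying L 0.
Hypothesis fL : forall e, 0 < e ->
  exists2 r, 0 < r & forall u, `|u| <= r -> `|f u - L u| <= e * `|u|.

(** The linear flow contracts by 1/4 over the time N. The radius r keeps the
    solution where f differs from L by at most e |u|, with e so small that the
    accumulated difference is at most another quarter. *)
Lemma nonlinear_contraction : exists N D r : R, [/\ 0 < N, 1 <= D, 0 < r, D * r <= 1 &
  forall x, traj x -> (forall t, 0 < t -> has_deriv x t (f (retract (hist x t)))) ->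
  `|hist x 0| <= r ->
  `|hist x N| <= 1 / 2 * `|hist x 0| /\ forall t, 0 <= t <= N -> `|hist x t| <= D * `|hist x 0|].
Proof.
have [K K0 HK] := truncated_lipschitz.
have [N N1 HN] := Ldecay (halfR_gt0 (halfR_gt0 (@ltr01 R))).
have N0 : 0 < N by rewrite (lt_le_trans ltr01).
pose D := 2 * expR (2 * K * N).
have D1 : 1 <= D.
  have : 1 <= expR (2 * K * N) by rewrite -expR0 ler_expR !mulr_ge0// ltW.
  by rewrite /D; lra.
have D0 : 0 < D by rewrite (lt_le_trans ltr01).
pose G := 2 * expR (2 * l * N).
have G0 : 0 < G by rewrite mulr_gt0 ?expR_gt0.
pose e := (4 * G * D * N)^-1.
have e0 : 0 < e by rewrite invr_gt0; apply: mulr_gt0 => //; apply: mulr_gt0 => //; apply: mulr_gt0.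
have eE : e * D * N * G = 1 / 4 by rewrite /e; clearbody D G; field; rewrite !gt_eqF.
have DE : D = 2 * expR (2 * K * N) by [].
have GE : G = 2 * expR (2 * l * N) by [].
clearbody D G e.
have [r0 r00 Hr0] := fL e0.
pose r := Num.min r0 1 / D.
have m0 : 0 < Num.min r0 1 by rewrite lt_min r00 ltr01.
have r_gt0 : 0 < r by exact: divr_gt0.
have Dr : D * r = Num.min r0 1 by rewrite /r mulrC divfK// gt_eqF.
exists N, D, r; split => //; first by rewrite Dr ge_min lexx orbT.
move=> x tx hx xr.
have grow t : 0 <= t <= N -> `|hist x t| <= D * `|hist x 0|.
  move=> /andP[t0 tN].
  have bd s : 0 < s < N -> `|f (retract (hist x s))| <= K * `|hist x s| + 0.
    move=> _; have := HK (hist x s) 0; rewrite (retract_id (u := 0)) ?normr0// f0 !subr0.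
    by rewrite addr0.
  have := gronwall eta0 K0 (lexx 0) (ltW N0) tx (fun s h => hx s (proj1 (andP h))) bd.
  move=> /(_ t); rewrite t0 tN mul0r addr0 => /(_ isT) h; apply: (le_trans h).
  apply: ler_wpM2r; first exact: normr_ge0.
  rewrite DE ler_pM2l// ler_expR ler_pM2l ?mulr_gt0//.
split => //.
have small t : 0 <= t <= N -> `|hist x t| <= Num.min r0 1.
  move=> tN; rewrite -Dr; apply: (le_trans (grow t tN)).
  by rewrite ler_pM2l.
have close t : 0 < t < N -> `|f (retract (hist x t)) - L (hist x t)| <= e * D * `|hist x 0|.
  move=> /andP[t0 tN]; have tN' : 0 <= t <= N by rewrite !ltW.
  have := small t tN'; rewrite le_min => /andP[h1 h2].
  rewrite retract_id//; apply: (le_trans (Hr0 _ h1)).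
  by rewrite -mulrA ler_pM2l//; exact: grow.
have eD : 0 <= e * D * `|hist x 0|.
  by apply: mulr_ge0; [apply: mulr_ge0; exact: ltW|exact: normr_ge0].
have [z [lz z0 hz]] := forced_vs_linear eta0 l0 Ll (ltW N0) eD tx (fun s h => hx s (proj1 (andP h))) close.
have := HN z lz; rewrite z0 mul0r expR0 mulr1 => hzN.
apply: (le_trans hz); apply: (le_trans (lerD hzN (lexx _))).
rewrite -GE.
have -> : G * (e * D * `|hist x 0| * N) = (e * D * N * G) * `|hist x 0|.
  by move: `|hist x 0| => a; ring.
rewrite eE -mulrDl; apply: ler_wpM2r; first exact: normr_ge0.
exact: quarters.
Qed.

(** Iterating the contraction gives the rate ln 2 / N. The solution of the truncated
    equation stays in the unit ball, where the truncation is invisible. *)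
Lemma nonlinear_decay : exists M d eps : R, [/\ 1 <= M, 0 < d, 0 < eps &
  forall phi : BUC n eta, `|phi| <= eps -> exists x,
  [/\ solves x, hist x 0 = phi & forall t, 0 <= t -> `|hist x t| <= M * expR (- d * t) * `|phi|]].
Proof.
have [N [D [r [N0 D1 r0 Dr1 HN]]]] := nonlinear_contraction.
have [K K0 HK] := truncated_lipschitz.
have ln2 : 0 < ln 2 :> R by rewrite ln_gt0// ltr1n.
have D0 : 0 < D by rewrite (lt_le_trans ltr01).
exists (2 * D), (ln 2 / N), r; split => //; first lra; first exact: divr_gt0.
move=> phi phir.
have [x [tx xphi hx]] := picard_solution eta0 K0 HK phi.
have x0 : hist x 0 = phi by exact: hist_glue.
have iter (k : nat) : `|hist x (k%:R * N)| <= (1 / 2) ^+ k * `|phi| /\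
    forall t, 0 <= t <= N -> `|hist x (k%:R * N + t)| <= D * ((1 / 2) ^+ k * `|phi|).
  have step (a : R) c : 0 <= a -> `|hist x a| <= c -> c <= `|phi| ->
      `|hist x (a + N)| <= 1 / 2 * c /\ forall t, 0 <= t <= N -> `|hist x (a + t)| <= D * c.
    move=> a0 hc cphi.
    have [|||h1 h2] := HN (fun s => x (a + s)).
    - exact: traj_shift.
    - by move=> t t0; apply: has_deriv_shift; rewrite hist_shift; apply: hx; rewrite ltr_wpDl.
    - by rewrite hist_shift addr0 (le_trans hc)// (le_trans cphi).
    rewrite !hist_shift addr0 in h1 h2; split; first by rewrite (le_trans h1)// ler_pM2l.
    by move=> t tN; have := h2 t tN; rewrite hist_shift => /le_trans; apply; rewrite ler_pM2l.
  have half_le j : (1 / 2) ^+ j * `|phi| <= `|phi|.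
    rewrite -[leRHS]mul1r; apply: ler_wpM2r; first exact: normr_ge0.
    by rewrite exprn_ile1// ler_pdivrMr// mul1r ler1n.
  have first_part : `|hist x (k%:R * N)| <= (1 / 2) ^+ k * `|phi|.
    elim: k => [|k IH]; first by rewrite mul0r x0 expr0 mul1r.
    have kN : 0 <= k%:R * N by rewrite mulr_ge0// ltW.
    have [h _] := step _ _ kN IH (half_le k).
    by rewrite -natr1 mulrDl mul1r exprS -[leRHS]mulrA.
  split => //; have kN : 0 <= k%:R * N by rewrite mulr_ge0// ltW.
  by have [_] := step _ _ kN first_part (half_le k).
have block t : 0 <= t -> exists2 k : nat, t / N <= k.+1%:R &
    `|hist x t| <= D * ((1 / 2) ^+ k * `|phi|).
  move=> t0; have tN0 : 0 <= t / N by rewrite divr_ge0// ltW.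
  have /andP[k1 k2] := truncn_itv tN0; set k := Num.truncn (t / N) in k1 k2.
  exists k; first exact: ltW.
  have [_ /(_ (t - k%:R * N))] := iter k; rewrite subrKC; apply.
  rewrite subr_ge0 -ler_pdivlMr// k1 lerBlDr.
  by move: k2; rewrite ltr_pdivrMr// -natr1 mulrDl mul1r addrC => /ltW.
have decay t : 0 <= t -> `|hist x t| <= 2 * D * expR (- (ln 2 / N) * t) * `|phi|.
  move=> t0; have [k k2 H] := block t t0.
  apply: (le_trans H); rewrite mulrA; apply: ler_wpM2r; first exact: normr_ge0.
  rewrite [2 * D]mulrC -mulrA ler_pM2l//.
  have -> : (1 / 2 : R) = expR (- ln 2) by rewrite expRN lnK ?posrE// div1r.
  have -> : 2 * expR (- (ln 2 / N) * t) = expR (ln 2 + - (ln 2 / N) * t).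
    by rewrite expRD lnK ?posrE.
  rewrite -expRM_natl ler_expR.
  have h : t * (ln 2 / N) <= k.+1%:R * ln 2.
    have -> : t * (ln 2 / N) = t / N * ln 2 by rewrite mulrCA mulrC.
    by rewrite ler_pM2r.
  have e2 : k.+1%:R * ln 2 = k%:R * ln 2 + ln 2 :> R by rewrite -natr1 mulrDl mul1r.
  move: h; rewrite e2 mulNr mulrN [ln 2 / N * t]mulrC.
  by move: (t * _) (k%:R * _) => a b; lra.
exists x; split => //; split => // t t0.
have := hx t t0; rewrite retract_id//; have [k _ H] := block t (ltW t0).
apply: (le_trans H); apply: le_trans Dr1; rewrite ler_pM2l//; apply: le_trans phir.
rewrite -[leRHS]mul1r; apply: ler_wpM2r; first exact: normr_ge0.
by rewrite exprn_ile1// ler_pdivrMr// mul1r ler1n.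
Qed.

End Nonlinear.

(** * Riemann integrals of vector-valued functions *)

Section RiemannIntegral.
Context {R : realType}.

Lemma partition_mono (N : nat) (s : nat -> R) :
  (forall i, (i < N)%N -> s i <= s i.+1) -> forall i j, (i <= j <= N)%N -> s i <= s j.
Proof.
move=> H i j /andP[ij jN]; rewrite -(subnKC ij); move: (subnKC ij) => e.
move: (j - i)%N e => k e; subst j.
elim: k {ij} jN => [|k IH] jN; first by rewrite addn0.
rewrite addnS in jN *; apply: (le_trans (IH (ltnW jN))); exact: H.
Qed.

(** An interval function that is approximated by (b - a) g(xi) up to e (b - a)
    telescopes over every fine partition. *)
Lemma riemann_of_increments (V : normedModType R) (g G : R -> V) T : 0 <= T ->
  (forall e, 0 < e -> exists2 d, 0 < d & forall a xi b, 0 <= a -> a <= xi -> xi <= b ->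
     b <= T -> b - a < d -> `|(b - a) *: g xi - (G b - G a)| <= e * (b - a)) ->
  is_Riemann_integral g 0 T (G T - G 0).
Proof.
move=> T0 H e e0.
have T1 : 0 < T + 1 by rewrite ltr_wpDl.
have [d d0 Hd] := H (e / (T + 1)) (divr_gt0 e0 T1).
exists d => // N s xi s0 sN Hs.
have mono : forall i j, (i <= j <= N)%N -> s i <= s j.
  by apply: partition_mono => i /Hs[h1 h2 _]; exact: le_trans h2.
have tel (W : zmodType) (u : nat -> W) : \sum_(i < N) (u i.+1 - u i) = u N - u 0%N.
  by rewrite -(big_mkord xpredT (fun i => u i.+1 - u i)) telescope_sumr.
rewrite -sN -s0 -(tel _ (fun i => G (s i))) -sumrB.
apply: (le_lt_trans (ler_norm_sum _ _ _)).
apply: (@le_lt_trans _ _ (\sum_(i < N) e / (T + 1) * (s i.+1 - s i))).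
  apply: ler_sum => i _; have [h1 h2 h3] := Hs i (ltn_ord i); apply: Hd => //.
    by rewrite -s0; apply: mono; rewrite /= ltnW.
  by rewrite -sN; apply: mono; rewrite ltn_ord leqnn.
rewrite -mulr_sumr (tel _ s) sN s0 subr0 mulrAC ltr_pdivrMr// ltr_pM2l//.
by rewrite ltrDl.
Qed.

Lemma sum_pair (V W : nmodType) (F : nat -> V * W) N :
  \sum_(i < N) F i = (\sum_(i < N) (F i).1, \sum_(i < N) (F i).2).
Proof.
by elim: N => [|N IH]; rewrite ?big_ord0// !big_ord_recr /= IH.
Qed.

Lemma riemann_pair (V W : normedModType R) (g : R -> V * W) a b (v : V) (w : W) :
  is_Riemann_integral (fun t => (g t).1) a b v ->
  is_Riemann_integral (fun t => (g t).2) a b w -> is_Riemann_integral g a b (v, w).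
Proof.
move=> H1 H2 e e0; have [d1 d10 h1] := H1 e e0; have [d2 d20 h2] := H2 e e0.
exists (Num.min d1 d2); first by rewrite lt_min d10.
move=> N s xi s0 sN Hs.
rewrite (sum_pair (fun i => (s i.+1 - s i) *: g (xi i))) prod_normE /= gt_max; apply/andP; split.
  by apply: h1 => // i /Hs[? ?]; rewrite lt_min => /andP[].
by apply: h2 => // i /Hs[? ?]; rewrite lt_min => /andP[].
Qed.

Lemma riemann_fst (V W : normedModType R) (g : R -> V * W) a b v :
  is_Riemann_integral g a b v -> is_Riemann_integral (fun t => (g t).1) a b v.1.
Proof.
move=> H e e0; have [d d0 h] := H e e0; exists d => // N s xi s0 sN Hs.
apply: le_lt_trans (h N s xi s0 sN Hs).
by rewrite (sum_pair (fun i => (s i.+1 - s i) *: g (xi i))) [leRHS]prod_normE /= le_max lexx.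
Qed.

Lemma riemann_snd (V W : normedModType R) (g : R -> V * W) a b v :
  is_Riemann_integral g a b v -> is_Riemann_integral (fun t => (g t).2) a b v.2.
Proof.
move=> H e e0; have [d d0 h] := H e e0; exists d => // N s xi s0 sN Hs.
apply: le_lt_trans (h N s xi s0 sN Hs).
by rewrite (sum_pair (fun i => (s i.+1 - s i) *: g (xi i))) [leRHS]prod_normE /= le_max lexx orbT.
Qed.

Lemma riemann_cst0 (V : normedModType R) a b : is_Riemann_integral (fun=> 0 : V) a b 0.
Proof.
by move=> e e0; exists 1 => // N s xi _ _ _; rewrite big1 ?subrr ?normr0// => i _; rewrite scaler0.
Qed.

(** The mean value inequality for y(s) - s c. *)
Lemma increment_close n (y dy : R -> 'cV[R]_n) a b c e : a <= b -> continuous y ->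
  (forall t, a < t < b -> has_deriv y t (dy t)) -> (forall t, a < t < b -> `|dy t - c| <= e) ->
  `|(b - a) *: c - (y b - y a)| <= e * (b - a).
Proof.
move=> ab cy hy hc.
have hl t : has_deriv (fun s => s *: c) t (1 *: c).
  apply: (@has_deriv_scaler R _ (fun s => s) c t 1).
  have := has_deriv_id 1 t; rewrite (_ : (fun s => 1 * s) = id)//.
  by apply/funext => s; rewrite mul1r.
have cyl : continuous (fun s => y s - s *: c).
  by move=> t; apply: cvgB; [exact: cy|exact: (deriv_continuous hl)].
have := norm_increment_le ab cyl (deriv_continuous (has_deriv_id e))
  (fun t tab => has_derivB (hy t tab) (hl t)) (fun t _ => has_deriv_id e t).
rewrite -mulrBr => H; rewrite distrC scalerBl !opprD addrACA -!opprD; apply: H.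
by move=> t tab; rewrite scale1r; exact: hc.
Qed.

Lemma riemann_primitive n (g G : R -> 'cV[R]_n) T : 0 <= T -> continuous g -> continuous G ->
  (forall t, 0 < t < T -> has_deriv G t (g t)) -> is_Riemann_integral g 0 T (G T - G 0).
Proof.
move=> T0 cg cG hG; apply: riemann_of_increments => // e e0.
have [d d0 Hd] := segment_unif_continuous 0 T cg e0.
exists d => // a xi b a0 axi xib bT ba.
have ab : a <= b by exact: le_trans xib.
apply: (@increment_close _ _ g) => // [t /andP[at_ tb]|t /andP[at_ tb]].
  by apply: hG; rewrite (le_lt_trans a0)// (lt_le_trans tb).
apply/ltW/Hd; first by rewrite (le_trans a0 (ltW at_)) (le_trans (ltW tb)).
by rewrite ltr_norml; apply/andP; split; lra.
Qed.

End RiemannIntegral.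

(** * Solutions of the delay equation are mild solutions *)

Lemma lipschitz_bounded_continuous {R : realType} (V W : normedModType R) (f : V -> W) :
  lipschitz_on_bounded_sets f -> continuous f.
Proof.
move=> H; apply/continuousP_eps => u e e0.
have r0 : 0 < `|u| + 1 by rewrite ltr_wpDl.
have [k Hk] := H _ r0.
have k0 : 0 < `|k| + 1 by rewrite ltr_wpDl.
exists (Num.min 1 (e / (`|k| + 1))); first by rewrite lt_min ltr01 divr_gt0.
move=> v; rewrite lt_min => /andP[v1 v2].
have uv : `|v| <= `|u| + 1 by rewrite (le_trans (norm_le_dist (ltW v1))).
have uu : `|u| <= `|u| + 1 by rewrite lerDl.
apply: (le_lt_trans (Hk v u uv uu)); rewrite ltr_pdivlMr// in v2.
apply: le_lt_trans v2; rewrite mulrC; apply: ler_wpM2l; first exact: normr_ge0.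
by rewrite (le_trans (ler_norm k))// lerDl.
Qed.

Section DerivNonpos.
Context {R : realType} {n : nat}.
Implicit Types phi psi : R -> 'cV[R]_n.

Lemma deriv_nonposP phi psi : is_deriv_nonpos phi psi <->
  forall th, th <= 0 -> forall e, 0 < e -> exists2 d, 0 < d & forall h, `|h| < d ->
    th + h <= 0 -> `|phi (th + h) - phi th - h *: psi th| <= e * `|h|.
Proof.
split=> H th th0.
  move=> e e0; have /cvgrPdist_le/(_ e e0)[d /= d0 Hd] := H th th0.
  exists d => // h hd thh; have [->|h0] := eqVneq h 0.
    by rewrite addr0 subrr scale0r subrr !normr0 mulr0.
  have := Hd h; rewrite /ball_ /= sub0r normrN => /(_ hd h0 thh) k.
  have -> : phi (th + h) - phi th - h *: psi th =
    - (h *: (psi th - h^-1 *: (phi (th + h) - phi th))).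
    by rewrite scalerBr scalerA divff// scale1r opprB.
  by rewrite normrN normrZ mulrC ler_pM2r ?normr_gt0.
apply/cvgrPdist_le => e e0; have [d d0 Hd] := H th th0 e e0.
exists d => //= h; rewrite /ball_ /= sub0r normrN => hd h0 thh.
rewrite -(ler_pM2r (_ : 0 < `|h|)) ?normr_gt0// mulrC -normrZ.
by rewrite scalerBr scalerA divff// scale1r distrC; exact: Hd.
Qed.

(** A one-sided derivative at th involves only the values to the left of th, so it
    is enough that the two functions agree there after translation. *)
Lemma left_deriv_unique phi psi phi' psi' th th' : is_deriv_nonpos phi psi ->
  is_deriv_nonpos phi' psi' -> th <= 0 -> th' <= 0 ->
  (forall h, h <= 0 -> phi (th + h) = phi' (th' + h)) -> psi th = psi' th'.
Proof.
move=> /deriv_nonposP H /deriv_nonposP H' th0 th'0 E.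
apply/eqP; rewrite -subr_eq0 -normr_le0; apply/ler_addgt0Pl => e e0; rewrite addr0.
have [d d0 Hd] := H th th0 _ (halfR_gt0 e0); have [d' d'0 Hd'] := H' th' th'0 _ (halfR_gt0 e0).
pose h := - (Num.min d d' / 2).
have m0 : 0 < Num.min d d' by rewrite lt_min d0.
have hN : `|h| = Num.min d d' / 2 by rewrite normrN gtr0_norm// halfR_gt0.
have hm : `|h| < Num.min d d' by rewrite hN ltr_pdivrMr// ltr_pMr// ltr1n.
have h0 : 0 < `|h| by rewrite hN halfR_gt0.
have hle : h <= 0 by rewrite oppr_le0 ltW// halfR_gt0.
move: hm; rewrite lt_min => /andP[hd hd'].
have t1 : th + h <= 0 by rewrite -[leRHS]addr0 lerD.
have t2 : th' + h <= 0 by rewrite -[leRHS]addr0 lerD.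
have k := Hd h hd t1; have k' := Hd' h hd' t2.
rewrite -E// (_ : phi' th' = phi th) in k'; last by have := E 0 (lexx 0); rewrite !addr0.
rewrite -(ler_pM2l h0) -normrZ scalerBr mulrC [in leRHS](splitr e) mulrDl.
set A := phi (th + h) - phi th in k k'.
have -> : h *: psi th - h *: psi' th' = (A - h *: psi' th') - (A - h *: psi th).
  by rewrite opprB [RHS]addrC subrKA.
by rewrite (le_trans (ler_normB _ _))// lerD.
Qed.

Lemma deriv_nonpos0 : is_deriv_nonpos (fun=> 0 : 'cV[R]_n) (fun=> 0).
Proof.
apply/deriv_nonposP => th _ e e0; exists 1 => // h _ _.
by rewrite scaler0 !subr0 normr0 mulr_ge0// ltW.
Qed.

Lemma deriv_nonposB phi psi phi' psi' :
  is_deriv_nonpos phi psi -> is_deriv_nonpos phi' psi' ->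
  is_deriv_nonpos (fun t => phi t - phi' t) (fun t => psi t - psi' t).
Proof.
move=> H H' th th0.
have E h : h^-1 *: (phi (th + h) - phi' (th + h) - (phi th - phi' th)) =
    h^-1 *: (phi (th + h) - phi th) - h^-1 *: (phi' (th + h) - phi' th).
  by rewrite -scalerBr; congr (_ *: _); move: (phi _) (phi' _) (phi _) (phi' _) => a b c d; rewrite !opprB [LHS]addrACA [RHS]addrACA; congr (_ + _); exact: addrC.
by under eq_fun do rewrite E; exact: cvgB (H th th0) (H' th th0).
Qed.

Lemma deriv_nonpos_unique phi psi psi' : is_deriv_nonpos phi psi -> is_deriv_nonpos phi psi' ->
  forall th, th <= 0 -> psi th = psi' th.
Proof. by move=> H H' th th0; exact: (left_deriv_unique H H'). Qed.

End DerivNonpos.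

Section MildExistence.
Context {R : realType} {n : nat} (eta : R) (eta0 : 0 < eta).
Notation hist := (hist eta).
Notation traj := (@traj R n eta).

Lemma buc_derivE (phi psi : BUC n eta) : is_deriv_nonpos phi psi -> buc_deriv phi = psi.
Proof.
move=> H; apply: eq_buc; apply: (@deriv_nonpos_unique _ _ phi) => //.
by rewrite /buc_deriv; case: xgetP => [y _ //|/(_ psi)].
Qed.

Lemma hist_deriv_nonpos y (psi : BUC n eta) : traj y ->
  (forall th, th <= 0 -> has_deriv y th (psi th)) -> is_deriv_nonpos (hist y 0) psi.
Proof.
move=> ty H; apply/deriv_nonposP => th th0 e e0.
have [d d0 Hd] := H th th0 e e0; exists d => // h hd thh.
by rewrite !histE// !add0r !min_l//; exact: Hd.
Qed.

Section HistoryIntegral.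
Variables (x X : R -> 'cV[R]_n).
Hypothesis tx : traj x.
Hypothesis hX : forall s, has_deriv X s (x s).

Lemma shift_increment_deriv t s : has_deriv (fun s => X (t + s) - X s) s (x (t + s) - x s).
Proof. by apply: has_derivB => //; exact: has_deriv_shift. Qed.

(** The mean value inequality bounds exp(eta s) (X(t + s) - X(s)) by a multiple of
    t, since exp(eta r) x(r) is bounded for r <= t. *)
Lemma shift_increment_traj t : 0 <= t -> traj (fun s => X (t + s) - X s).
Proof.
move=> t0; have [[M HM] _] := tx t.
have M0 : 0 <= M by apply: le_trans (HM t (lexx t)); exact: normr_ge0.
have xb r : r <= t -> `|x r| <= M * expR (- (eta * r)).
  move=> rt; have := HM r rt; rewrite /weighted normrZ ger0_norm ?expR_ge0// => h.
  by rewrite expRN ler_pdivlMr ?expR_gt0// mulrC.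
have cX := deriv_continuous hX.
apply: (@traj_of_bounded_deriv R n eta eta0 _ (fun s => x (t + s) - x s) (M * t) (M + M)).
- by move=> s; exact: shift_increment_deriv.
- move=> s s0; rewrite /weighted normrZ ger0_norm ?expR_ge0//.
  have st : s <= t + s by rewrite lerDr.
  have ts : t + s <= t by rewrite gerDl.
  have := norm_increment_le st cX (deriv_continuous (has_deriv_id (M * expR (- (eta * s)))))
    (fun r _ => hX r) (fun r _ => has_deriv_id _ r).
  rewrite -mulrBr addrK => H.
  apply: (le_trans (ler_wpM2l (expR_ge0 _) (H _))).
    move=> r /andP[sr rt]; apply: (le_trans (xb r _)); first by rewrite (le_trans (ltW rt)).
    by apply: ler_wpM2l => //; rewrite ler_expR lerN2 ler_pM2l// ltW.
  by rewrite expRN [M * _]mulrC mulrA mulrA divff ?mul1r// gt_eqF// expR_gt0.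
- move=> s s0; rewrite /weighted scalerBr (le_trans (ler_normB _ _))// lerD//.
    rewrite normrZ ger0_norm ?expR_ge0//.
    have ts : t + s <= t by rewrite gerDl.
    apply: (le_trans (ler_wpM2l (expR_ge0 _) (xb _ ts))).
    rewrite mulrCA ler_piMr// -expRD -expR0 ler_expR.
    by rewrite mulrDr opprD addrCA subrr addr0 oppr_le0 mulr_ge0// ltW.
  by apply: HM; rewrite (le_trans s0).
Qed.

Lemma shift_increment_eq a b : 0 <= a -> a <= b ->
  hist (fun s => X (b + s) - X s) 0 - hist (fun s => X (a + s) - X s) 0 =
  hist (fun s => X (b + s) - X (a + s)) 0.
Proof.
move=> a0 ab; have b0 : 0 <= b by exact: le_trans ab.
rewrite -histB; [|exact: shift_increment_traj..].
by congr (hist _ 0); apply/funext => s; rewrite opprB addrA subrK.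
Qed.

(** The integral over [0, t] of x(r + s) with respect to r is X(t + s) - X(s). The
    Riemann sums converge in the norm of BUC, because the estimate for the
    increments is uniform in s after weighting by exp(eta s): it follows from the
    uniform continuity of r |-> x_r as a curve in BUC. *)
Lemma hist_riemann t : 0 <= t ->
  is_Riemann_integral (hist x) 0 t (hist (fun s => X (t + s) - X s) 0).
Proof.
move=> t0.
have z : hist (fun s => X (0 + s) - X s) 0 = 0.
  rewrite (_ : (fun s => _) = fun=> 0); last by apply/funext => s; rewrite add0r subrr.
  apply: eq_buc => th _; rewrite histE//; exact: traj0.
rewrite -[hist _ 0]subr0 -z.
apply: (@riemann_of_increments _ _ (hist x) (fun t => hist (fun s => X (t + s) - X s) 0)) => // e e0.
have [d d0 Hd] := segment_unif_continuous 0 t (hist_continuous (eta := eta) tx) e0.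
exists d => // a xi b a0 axi xib bt ba.
have ab : a <= b by exact: le_trans xib.
rewrite shift_increment_eq//.
have ta : traj (fun s => X (b + s) - X (a + s)).
  rewrite (_ : (fun s => _) = fun s => (X (b + s) - X s) - (X (a + s) - X s)).
    by apply: trajB; apply: shift_increment_traj => //; exact: le_trans ab.
  by apply/funext => s; rewrite opprB addrA subrK.
have tl : traj (fun s => (b - a) *: x (xi + s)) by apply: trajZ; exact: traj_shift.
have -> : (b - a) *: hist x xi = hist (fun s => (b - a) *: x (xi + s)) 0.
  by rewrite histZ; [rewrite hist_shift addr0|exact: traj_shift].
rewrite -histB//; apply: hist_norm_le; first exact: trajB.
move=> s s0; rewrite subr0.
have hs r : 0 <= r <= t -> `|r - xi| < d -> `|x (r + s) - x (xi + s)| <= expR (- (eta * s)) * e.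
  move=> rt rd; have h := ltW (Hd r xi rt rd).
  have tr : traj (fun s => x (r + s) - x (xi + s)) by apply: trajB; exact: traj_shift.
  have e1 : hist x r - hist x xi = hist (fun s => x (r + s) - x (xi + s)) 0.
    by rewrite histB; [rewrite !hist_shift !addr0|exact: traj_shift|exact: traj_shift].
  rewrite e1 in h; have := le_trans (hist_norm_ub tr s0) h; rewrite subr0 => h2.
  by rewrite expRN mulrC ler_pdivlMr ?expR_gt0// mulrC.
have cX := deriv_continuous hX.
have cXs : continuous (fun r => X (r + s)).
  by move=> r; apply: (@continuous_comp _ _ _ (fun r => r + s) X);
    [apply: cvgD; [exact: cvg_id|exact: cst_continuous]|exact: cX].
have hXs r : has_deriv (fun r => X (r + s)) r (x (r + s)).
  move=> e1 e10; have [d1 d10 H1] := hX (r + s) e10.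
  by exists d1 => // h hd; rewrite [r + h + s]addrAC; exact: H1.
have H r : a < r < b -> `|x (r + s) - x (xi + s)| <= expR (- (eta * s)) * e.
  move=> /andP[ar rb]; apply: hs.
    by rewrite (le_trans a0 (ltW ar)) (le_trans (ltW rb)).
  by rewrite ltr_norml; apply/andP; split; lra.
have H2 := increment_close ab cXs (fun r _ => hXs r) H.
apply: (le_trans (ler_wpM2l (expR_ge0 _) H2)).
by rewrite !mulrA -expRD subrr expR0 mul1r.
Qed.

Lemma hist_integral_deriv t : 0 <= t ->
  is_deriv_nonpos (hist (fun s => X (t + s) - X s) 0) (hist x t - hist x 0).
Proof.
move=> t0; apply: hist_deriv_nonpos; first exact: shift_increment_traj.
move=> th th0; rewrite bucBE !histE// min_l// add0r.
exact: shift_increment_deriv.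
Qed.

End HistoryIntegral.

Variable f : BUC n eta -> 'cV[R]_n.
Hypothesis cf : continuous f.

(** The first component of the mild equation says that the derivative of the
    integrated history at 0, which is x(t) - x(0), equals the integral of f(x_s). *)
Lemma solves_mild_integrals x : solves f x -> forall t, 0 <= t -> exists I J,
  [/\ is_Riemann_integral (fun t => (0, hist x t) : Xspace R n eta) 0 t I,
      is_Riemann_integral (opF f \o (fun t => (0, hist x t) : Xspace R n eta)) 0 t J,
      domA I, buc_deriv I.2 = hist x t - hist x 0 &
      (0, hist x t) = (0, hist x 0) + opA I + J].
Proof.
move=> [tx hx] t t0; have [X _ hX] := vector_primitive (traj_continuous tx).
have cfh : continuous (fun t => f (hist x t)).
  by move=> s; apply: (@continuous_comp _ _ _ (hist x) f); [exact: hist_continuous|exact: cf].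
have RJ := riemann_primitive t0 cfh (traj_continuous tx)
  (fun s h => hx s (proj1 (andP h))).
have D := hist_integral_deriv tx hX t0.
have dE := buc_derivE D.
exists (0, hist (fun s => X (t + s) - X s) 0), (x t - x 0, 0); split => //.
- by apply: riemann_pair; [exact: riemann_cst0|exact: hist_riemann].
- by apply: riemann_pair; [exact: RJ|exact: riemann_cst0].
- by split => //; exists (hist x t - hist x 0).
rewrite /opA /= dE bucBE !histE// minxx !addr0.
by congr pair; rewrite /= ?add0r ?addNr// addr0 subrKC.
Qed.

End MildExistence.

(** * Uniqueness of mild solutions *)

Section RiemannIncrement.
Context {R : realType} {V : normedModType R}.

Lemma riemann_point (g : R -> V) a v : is_Riemann_integral g a a v -> v = 0.
Proof.
move=> H; apply/eqP; rewrite -normr_le0; apply/ler_addgt0Pl => e e0; rewrite addr0.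
have [d d0 Hd] := H e e0; have := Hd 0%N (fun=> a) (fun=> a) erefl erefl.
by rewrite big_ord0 sub0r normrN => h; apply/ltW/h.
Qed.

Lemma riemannB (g g' : R -> V) a b v v' : is_Riemann_integral g a b v ->
  is_Riemann_integral g' a b v' -> is_Riemann_integral (fun t => g t - g' t) a b (v - v').
Proof.
move=> H H' e e0; have [d d0 Hd] := H _ (halfR_gt0 e0); have [d' d'0 Hd'] := H' _ (halfR_gt0 e0).
exists (Num.min d d'); first by rewrite lt_min d0.
move=> N s xi s0 sN Hs.
have h : `|\sum_(i < N) (s i.+1 - s i) *: g (xi i) - v| < e / 2.
  by apply: Hd => // i /Hs[? ?]; rewrite lt_min => /andP[].
have h' : `|\sum_(i < N) (s i.+1 - s i) *: g' (xi i) - v'| < e / 2.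
  by apply: Hd' => // i /Hs[? ?]; rewrite lt_min => /andP[].
under eq_bigr do rewrite scalerBr.
rewrite sumrB opprD addrACA -opprD (le_lt_trans (ler_normB _ _))// [ltRHS](splitr e).
by rewrite ltrD.
Qed.

Lemma eq_riemann (g g' : R -> V) b v : (forall t, 0 <= t <= b -> g t = g' t) ->
  is_Riemann_integral g 0 b v -> is_Riemann_integral g' 0 b v.
Proof.
move=> E H e e0; have [d d0 Hd] := H e e0; exists d => // N s xi s0 sN Hs.
have mono : forall i j, (i <= j <= N)%N -> s i <= s j.
  by apply: partition_mono => i /Hs[h1 h2 _]; exact: le_trans h2.
have := Hd N s xi s0 sN Hs; congr (`|_ - _| < _).
apply: eq_bigr => i _; rewrite E//; have [h1 h2 _] := Hs i (ltn_ord i).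
apply/andP; split.
  by apply: le_trans h1; rewrite -s0; apply: mono; rewrite /= ltnW.
by apply: (le_trans h2); rewrite -sN; apply: mono; rewrite ltn_ord leqnn.
Qed.

(** Additivity of the integral, in the form of an estimate on [a, b]: comparing the
    sums over a partition of [0, b] that contains a with their parts over [0, a]. *)
Lemma riemann_increment (g : R -> V) a b va vb c w : 0 <= a -> a <= b ->
  is_Riemann_integral g 0 a va -> is_Riemann_integral g 0 b vb ->
  (forall t, a <= t <= b -> `|g t - c| <= w) ->
  `|vb - va - (b - a) *: c| <= w * (b - a).
Proof.
move=> a0 ab Ha Hb Hc.
have w0 : 0 <= w by apply: le_trans (Hc a _); rewrite ?normr_ge0// lexx.
have ba0 : 0 <= b - a by rewrite subr_ge0.
apply/ler_addgt0Pr => e e0.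
have [d1 d10 H1] := Ha _ (halfR_gt0 e0); have [d2 d20 H2] := Hb _ (halfR_gt0 e0).
pose d := Num.min d1 d2.
have d0 : 0 < d by rewrite lt_min d10.
pose N := (Num.truncn ((a + (b - a)) / d)).+1.
have N0 : 0 < N%:R :> R by rewrite ltr0n.
have NN := lt0r_neq0 N0.
have fine (r : R) : 0 <= r -> r <= a + (b - a) -> r / N%:R < d.
  move=> r0 rb; rewrite ltr_pdivrMr// mulrC -ltr_pdivrMr//.
  apply: le_lt_trans (truncnS_gt ((a + (b - a)) / d)).
  by rewrite ler_pM2r ?invr_gt0.
have fa := fine a a0 (_ : a <= a + (b - a)); rewrite lerDl in fa; have {}fa := fa ba0.
have fb := fine (b - a) ba0 (_ : b - a <= a + (b - a)); rewrite lerDr in fb; have {}fb := fb a0.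
clearbody N.
(* N equal steps on [0, a] followed by N equal steps on [a, b]. *)
pose s (i : nat) := if (i <= N)%N then a * i%:R / N%:R else a + (b - a) * (i - N)%:R / N%:R.
have sN i : s (N + i)%N = a + (b - a) * i%:R / N%:R.
  rewrite /s; case: i => [|i]; first by rewrite addn0 leqnn mulfK// mulr0 mul0r addr0.
  by rewrite addnS ltnNge leq_addr /= -addnS addKn.
have sl i : (i <= N)%N -> s i = a * i%:R / N%:R by rewrite /s => ->.
have stepl i : (i < N)%N -> s i.+1 - s i = a / N%:R.
  by move=> iN; rewrite !sl// ?(ltnW iN)// -natr1; field.
have stepr i : s (N + i).+1 - s (N + i)%N = (b - a) / N%:R.
  by rewrite -addnS !sN -natr1; field.
have s0 : s 0%N = 0 by rewrite sl// mulr0 mul0r.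
have sNa : s N = a by rewrite sl// mulfK.
have sNN : s (N + N)%N = b by rewrite sN mulfK// subrKC.
have Hl i : (i < N)%N -> s i <= s i /\ s i <= s i.+1 /\ s i.+1 - s i < d.
  move=> iN; split => //; rewrite -[_ <= s i.+1]subr_ge0 stepl//; split => //.
  by rewrite divr_ge0// ltW.
have Hr i : s (N + i)%N <= s (N + i).+1 /\ s (N + i).+1 - s (N + i)%N < d.
  by rewrite -[_ <= s (N + i).+1]subr_ge0 stepr; split => //; rewrite divr_ge0// ltW.
have h1 : `|\sum_(i < N) (s i.+1 - s i) *: g (s i) - va| < e / 2.
  apply: H1 => // i iN; have [_ [h h']] := Hl i iN; split => //.
  by move: h'; rewrite lt_min => /andP[].
have h2 : `|\sum_(i < N + N) (s i.+1 - s i) *: g (s i) - vb| < e / 2.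
  apply: H2 => // i iNN; have [iN|Ni] := ltnP i N.
    have [_ [h h']] := Hl i iN; split => //.
    by move: h'; rewrite lt_min => /andP[].
  rewrite -(subnKC Ni); have [h h'] := Hr (i - N)%N; split => //.
  by move: h'; rewrite lt_min => /andP[].
rewrite big_split_ord/= in h2.
set S1 := \sum_(i < N) _ in h1 h2; set S2 := \sum_(i < N) _ in h2.
have h3 : `|S2 - (b - a) *: c| <= w * (b - a).
  have -> : (b - a) *: c = \sum_(i < N) ((b - a) / N%:R) *: c.
    by rewrite sumr_const card_ord scalerMnl -mulr_natr divfK.
  rewrite /S2 -sumrB; apply: (le_trans (ler_norm_sum _ _ _)).
  have -> : w * (b - a) = \sum_(i < N) w * ((b - a) / N%:R).
    by rewrite sumr_const card_ord -[RHS]mulr_natr -mulrA divfK.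
  apply: ler_sum => i _; rewrite stepr -scalerBr normrZ ger0_norm; last by rewrite divr_ge0// ltW.
  rewrite mulrC; apply: ler_wpM2r; first by rewrite divr_ge0// ltW.
  apply: Hc; rewrite sN lerDl divr_ge0 ?mulr_ge0 ?(ltW N0)//=.
  rewrite -lerBrDl ler_pdivrMr//; apply: ler_wpM2l => //.
  by rewrite ler_nat ltnW.
have -> : vb - va - (b - a) *: c = (S1 - va) - (S1 + S2 - vb) + (S2 - (b - a) *: c).
  move: S1 S2 ((b - a) *: c) {h1 h2 h3} => x y z; rewrite (opprB _ vb) opprD.
  by rewrite [RHS](AC (2*(1*2)*2) (((3*2)*7)*((1*4)*(5*6)))) -[RHS]/(vb - va - z + ((x - x) + (- y + y))) subrr addNr !addr0.
rewrite (le_trans (ler_normD _ _))// [leRHS]addrC lerD// [leRHS](splitr e).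
by rewrite (le_trans (ler_normB _ _))// lerD// ltW.
Qed.

Lemma riemann_zero (b : R) (v : V) : 0 <= b ->
  is_Riemann_integral (fun=> 0 : V) 0 b v -> v = 0.
Proof.
move=> b0 H; have w0 t : 0 <= t <= b -> `|0 - 0 : V| <= 0 by rewrite subrr normr0.
have := riemann_increment (lexx 0) b0 (riemann_cst0 _ 0 0) H w0.
by rewrite scaler0 !subr0 mul0r normr_le0 => /eqP.
Qed.

End RiemannIncrement.

Section CharacteristicLines.
Context {R : realType} {n : nat} (eta : R) (eta0 : 0 < eta).
Notation hist := (hist eta).
Notation traj := (@traj R n eta).

Lemma buc_eval_le (u : BUC n eta) th : th <= 0 -> `|u th| <= expR (- (eta * th)) * `|u|.
Proof.
move=> th0; have := buc_norm_ub u th0 => h.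
by rewrite expRN mulrC ler_pdivlMr ?expR_gt0// mulrC.
Qed.

(** Evaluation at a point th is bounded by exp(- eta th), uniformly for th in a
    bounded set. *)
Lemma eval_continuous (g : R -> BUC n eta) (m : R -> R) : continuous g -> continuous m ->
  (forall r, m r <= 0) -> continuous (fun r => g r (m r)).
Proof.
move=> cg cm m0; apply/continuousP_eps => r e e0.
pose E := expR (- (eta * (m r - 1))).
have E0 : 0 < E by exact: expR_gt0.
have /continuousP_eps /(_ r _ (divr_gt0 (halfR_gt0 e0) E0))[d1 d10 H1] := cg.
have /continuousP_eps /(_ (m r) _ (halfR_gt0 e0))[d2 d20 H2] := @buc_continuous _ _ _ (g r).
have m12 : 0 < Num.min 1 d2 by rewrite lt_min ltr01.
have /continuousP_eps /(_ r _ m12)[d3 d30 H3] := cm.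
exists (Num.min d1 d3); first by rewrite lt_min d10.
move=> s; rewrite lt_min => /andP[s1 /H3]; rewrite lt_min => /andP[h3 h4].
have -> : g s (m s) - g r (m r) = (g s - g r) (m s) + (g r (m s) - g r (m r)).
  by rewrite bucBE addrA subrK.
rewrite (le_lt_trans (ler_normD _ _))// [ltRHS](splitr e) ltrD//; last exact: H2.
apply: (le_lt_trans (buc_eval_le _ (m0 s))).
have := H1 s s1; rewrite ltr_pdivlMr// mulrC; apply: le_lt_trans.
apply: ler_wpM2r; first exact: normr_ge0.
rewrite ler_expR lerN2 ler_pM2l//.
by move: h3; rewrite ltr_norml => /andP[? _]; lra.
Qed.

(** In this section w and W stand for the difference of two mild solutions and for
    its integral, k and q for the difference of the values of f and for its
    integral. The estimates HW and Hq are what additivity of the integral gives. *)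
Section Difference.
Variables (T l : R) (w W : R -> BUC n eta) (q k : R -> 'cV[R]_n).
Hypothesis T0 : 0 < T.
Hypothesis l0 : 0 < l.
Hypothesis cw : continuous w.
Hypothesis ck : continuous k.
Hypothesis HW : forall a b c e, 0 <= a -> a <= b -> b <= T ->
  (forall t, a <= t <= b -> `|w t - c| <= e) -> `|W b - W a - (b - a) *: c| <= e * (b - a).
Hypothesis Hq : forall a b c e, 0 <= a -> a <= b -> b <= T ->
  (forall t, a <= t <= b -> `|k t - c| <= e) -> `|q b - q a - (b - a) *: c| <= e * (b - a).
Hypothesis W0 : W 0 = 0.
Hypothesis q0 : q 0 = 0.
Hypothesis Hd : forall s, 0 <= s <= T -> is_deriv_nonpos (W s) (w s).
Hypothesis Hwq : forall s, 0 <= s <= T -> w s 0 = q s.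
Hypothesis Hk : forall s, 0 <= s <= T -> `|k s| <= l * `|w s|.

Let c (s : R) := Num.min (Num.max s 0) T.

Let c_id s : 0 <= s <= T -> c s = s.
Proof. by move=> /andP[s0 sT]; rewrite /c max_l// min_l. Qed.

Let c_nonpos s : s <= 0 -> c s = 0.
Proof. by move=> s0; rewrite /c max_r// min_l// ltW. Qed.

Let c_in s : 0 <= c s <= T.
Proof. by rewrite /c le_min (ltW T0) andbT le_max lexx orbT ge_min lexx orbT. Qed.

Let c_lip s t : `|c s - c t| <= `|s - t|.
Proof.
have T0' := T0; have h1 := ler_norm (s - t); have h2 := ler_norm (t - s); rewrite distrC in h2.
rewrite ler_norml /c; case: (leP s 0) => a; case: (leP t 0) => b.
- by rewrite subrr lerNl oppr0 !normr_ge0.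
- by case: (leP t T) => d; rewrite (min_l (ltW T0)); apply/andP; split; lra.
- by case: (leP s T) => d; rewrite (min_l (ltW T0)); apply/andP; split; lra.
- by case: (leP s T) => d; case: (leP t T) => d'; apply/andP; split; lra.
Qed.

(** The argument is clamped to [0, T], so that continuity holds on the whole
    line. *)
Lemma increments_lipschitz (V : normedModType R) (g G : R -> V) : continuous g ->
  (forall a b c e, 0 <= a -> a <= b -> b <= T ->
    (forall t, a <= t <= b -> `|g t - c| <= e) -> `|G b - G a - (b - a) *: c| <= e * (b - a)) ->
  continuous (fun s => G (c s)).
Proof.
move=> cg HG; have [M M0 HM] := segment_bounded 0 T cg.
have lip a b : 0 <= a -> a <= b -> b <= T -> `|G b - G a| <= M * (b - a).
  move=> a0 ab bT; have := HG a b 0 M a0 ab bT; rewrite scaler0 subr0; apply.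
  move=> t /andP[at_ tb]; rewrite subr0; apply: HM.
  by rewrite (le_trans a0 at_) (le_trans tb).
apply: (@lipschitz_continuous _ _ _ _ M) => s t.
have := c_in s; have := c_in t => /andP[t0 tT] /andP[s0 sT].
apply: (@le_trans _ _ (M * `|c s - c t|)); last by apply: ler_wpM2l; [exact: ltW|exact: c_lip].
case: (leP (c t) (c s)) => [le|/ltW le].
  by rewrite [X in M * X]ger0_norm ?subr_ge0// lip.
by rewrite distrC [X in M * X]distrC [X in M * X]ger0_norm ?subr_ge0// lip.
Qed.

Lemma increments_deriv (V : normedModType R) (g G : R -> V) : continuous g ->
  (forall a b c e, 0 <= a -> a <= b -> b <= T ->
    (forall t, a <= t <= b -> `|g t - c| <= e) -> `|G b - G a - (b - a) *: c| <= e * (b - a)) ->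
  forall t, 0 < t < T -> has_deriv G t (g t).
Proof.
move=> /continuousP_eps cg HG t /andP[t0 tT] e e0; have [d d0 Hd'] := cg t e e0.
exists (Num.min d (Num.min t (T - t))); first by rewrite !lt_min d0 t0 subr_gt0.
move=> h; rewrite !lt_min !ltr_norml => /and3P[/andP[h1 h2] /andP[h3 h4] /andP[h5 h6]].
have close r : `|r - t| <= `|h| -> `|h| < d -> `|g r - g t| <= e.
  by move=> rh hd; apply/ltW/Hd'; exact: le_lt_trans hd.
have hd : `|h| < d by rewrite ltr_norml h1.
case: (leP 0 h) => hs.
  have := HG t (t + h) (g t) e (ltW t0) (_ : t <= t + h) (_ : t + h <= T) _.
  rewrite lerDl hs [_ <= T](_ : _ = true); last by apply/idP; lra.
  move=> /(_ isT isT); rewrite [t + h - t]addrAC subrr add0r ger0_norm//; apply.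
  move=> r /andP[tr rt]; apply: close => //; rewrite !ger0_norm ?subr_ge0//; lra.
have := HG (t + h) t (g t) e (_ : 0 <= t + h) (_ : t + h <= t) (ltW tT) _.
rewrite gerDl (ltW hs) [0 <= _](_ : _ = true); last by apply/idP; lra.
move=> /(_ isT isT) H.
have e1 : t - (t + h) = - h by rewrite opprD addrA subrr add0r.
rewrite e1 scaleNr opprK in H.
have -> : G (t + h) - G t - h *: g t = - (G t - G (t + h) + h *: g t).
  by rewrite opprD opprB.
rewrite normrN ltr0_norm//; apply: H => r /andP[tr rt]; apply: close => //.
rewrite ler0_norm ?subr_le0// ltr0_norm//; lra.
Qed.

Let z s := q (c s).

Let z_traj : traj z.
Proof.
have cz : continuous z by exact: (increments_lipschitz ck Hq).
apply: trajP => // [|e e0].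
  by exists 0 => s s0; rewrite /weighted /z c_nonpos// q0 scaler0 normr0.
by exists 1 => // s t s0 t0 _; rewrite /weighted /z !c_nonpos// q0 !scaler0 subrr normr0.
Qed.

(** Along s + th = const the contributions w(s)(th) of the derivatives in s and in th
    cancel. The line is followed back to th = 0, or to s = 0 where W vanishes. *)
Lemma characteristic s th : 0 <= s <= T -> th <= 0 -> W s th = W (c (s + th)) 0.
Proof.
move=> /andP[s0 sT] th0; pose sg := s + th.
have sgs : sg <= s by rewrite gerDl.
pose r0 := Num.max sg 0.
have r00 : 0 <= r0 by rewrite le_max lexx orbT.
have r0s : r0 <= s by rewrite ge_max sgs.
have sgr0 : sg <= r0 by rewrite le_max lexx.
(* W along the line through (s, th), parametrized by time. *)
pose K r := W (c r) (Num.min (sg - r) 0).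
have Ks : K s = W s th.
  by rewrite /K c_id ?s0// /sg [s + th]addrC addrK min_l.
have Kr0 : K r0 = W (c sg) 0.
  rewrite /K c_id; last by rewrite r00 (le_trans r0s).
  have [g0|g0] := leP 0 sg.
    by rewrite /r0 max_l// subrr minxx c_id// g0 (le_trans sgs).
  by rewrite /r0 max_r ?(ltW g0)// c_nonpos ?(ltW g0)// W0.
rewrite -/sg -Ks -Kr0; apply/eqP; rewrite -subr_eq0 -normr_le0.
have cK : continuous K.
  apply: (eval_continuous (g := fun r => W (c r)) (m := fun r => Num.min (sg - r) 0)).
  - exact: (increments_lipschitz cw HW).
  - move=> r; apply: (@continuous_comp _ _ _ (fun r => sg - r) (fun r : R => Num.min r 0)).
      by apply: cvgB; [exact: cst_continuous|exact: cvg_id].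
    exact: minr_continuous.
  - by move=> r; rewrite ge_min lexx orbT.
have z0 : continuous (fun _ : R => 0 : R) by move=> t; exact: cst_continuous.
have := @norm_increment_le R n K (fun=> 0) (fun=> 0) (fun=> 0) r0 s r0s cK z0.
rewrite subrr; apply; last by move=> r _; rewrite normr0.
  move=> r /andP[r0r rs] e e0.
  have rT : 0 < r < T by rewrite (le_lt_trans r00)//= (lt_le_trans rs).
  have th_r0 : sg - r < 0 by rewrite subr_lt0 (le_lt_trans sgr0).
  have rT' : 0 <= r <= T by case/andP: rT => ? ?; rewrite !ltW.
  have e3 : 0 < e / 3 by rewrite divr_gt0.
  pose E := expR (- (eta * (sg - r - 1))).
  have E0 : 0 < E by exact: expR_gt0.
  have [d1 d10 H1] := increments_deriv cw HW rT (divr_gt0 e3 E0).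
  have /deriv_nonposP /(_ _ (ltW th_r0) _ e3)[d2 d20 H2] := Hd rT'.
  have /continuousP_eps /(_ (sg - r) _ e3)[d3 d30 H3] := @buc_continuous _ _ _ (w r).
  have p1 : 0 < r - sg by rewrite subr_gt0 (le_lt_trans sgr0).
  have [/andP[p2 p3]] := conj rT I; move=> _.
  have p4 : 0 < T - r by rewrite subr_gt0.
  exists (Num.min 1 (Num.min (Num.min d1 (Num.min d2 d3)) (Num.min (r - sg) (Num.min r (T - r))))).
    by rewrite !lt_min ltr01 d10 d20 d30 p1 p2 p4.
  move=> h; rewrite !lt_min => /and3P[h1 /and3P[hd1 hd2 hd3] /and3P[hp1 hp2 hp3]].
  have b1 : - 1 < h < 1 by rewrite -ltr_norml.
  have b2 : - (r - sg) < h < r - sg by rewrite -ltr_norml.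
  have b3 : - r < h < r by rewrite -ltr_norml.
  have b4 : - (T - r) < h < T - r by rewrite -ltr_norml.
  have /andP[b11 b12] := b1; have /andP[b21 b22] := b2.
  have /andP[b31 b32] := b3; have /andP[b41 b42] := b4.
  rewrite scaler0 subr0 /K.
  rewrite (c_id rT') c_id; last by apply/andP; split; lra.
  rewrite min_l; last by lra.
  rewrite (min_l (ltW th_r0)).
  have thh : sg - (r + h) = (sg - r) + - h by rewrite opprD addrA.
  have thh0 : (sg - r) + - h <= 0 by lra.
  rewrite thh.
  have q1 := H1 h hd1; have q2 := H2 (- h); rewrite normrN in q2; have {}q2 := q2 hd2 thh0.
  have q3 : `|w r ((sg - r) - h) - w r (sg - r)| < e / 3.
    by apply: H3; rewrite addrAC subrr add0r normrN.
  have q1' : `|(W (r + h) - W r - h *: w r) ((sg - r) - h)| <= e / 3 * `|h|.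
    apply: (le_trans (buc_eval_le _ thh0)).
    have EE : expR (- (eta * ((sg - r) - h))) <= E.
      by rewrite ler_expR lerN2 ler_pM2l//; lra.
    apply: (@le_trans _ _ (E * (e / 3 / E * `|h|))).
      by apply: ler_pM.
    by rewrite mulrA [E * _]mulrC divfK// gt_eqF.
  have -> : W (r + h) ((sg - r) - h) - W r (sg - r) =
     (W (r + h) - W r - h *: w r) ((sg - r) - h) + h *: (w r ((sg - r) - h) - w r (sg - r)) +
     (W r ((sg - r) - h) - W r (sg - r) - - h *: w r (sg - r)).
    rewrite !bucBE bucZE scaleNr opprK scalerBr.
    move: (W (r + h) ((sg - r) - h)) (W r ((sg - r) - h)) (W r (sg - r)) (h *: w r ((sg - r) - h)) (h *: w r (sg - r)) => A B C D F.
    rewrite [A - B - D + _]addrA subrK [RHS]addrA.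
    by rewrite [RHS](AC ((3*2)*1) ((1*5)*((2*4)*(3*6)))) -[RHS]/((A - C) + ((- B + B) + (- F + F))) !addNr !addr0.
  have e3E : e * `|h| = e / 3 * `|h| + `|h| * (e / 3) + e / 3 * `|h| by field.
  rewrite e3E (le_trans (ler_normD _ _))// lerD// (le_trans (ler_normD _ _))// lerD//.
  by rewrite normrZ; apply: ler_wpM2l; [exact: normr_ge0|exact: ltW].
by move=> r _; exact: has_deriv_cst.
Qed.

(** w is the derivative of W in th, and W is constant along characteristics, so
    w is constant along them too; its boundary value w(s)(0) is q(s). *)
Lemma difference_is_history s : 0 <= s <= T -> w s = hist z s.
Proof.
move=> sT; apply: eq_buc => th th0; rewrite histE// min_l// /z.
have [s0 s1] := andP sT.
have [g0|g0] := leP 0 (s + th).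
  have gT : 0 <= s + th <= T by rewrite g0 (le_trans _ s1)// gerDl.
  rewrite c_id// -Hwq//; apply: (left_deriv_unique (Hd sT) (Hd gT)) => // h h0.
  rewrite add0r characteristic//; last by rewrite -[leRHS]addr0 lerD.
  by rewrite (characteristic gT)// addrA.
have z0T : 0 <= (0 : R) <= T by rewrite lexx ltW.
rewrite c_nonpos ?(ltW g0)// q0.
have zd : is_deriv_nonpos (0 : BUC n eta) (0 : BUC n eta).
  exact: deriv_nonpos0.
rewrite -[RHS]/((0 : BUC n eta) th).
apply: (left_deriv_unique (Hd sT) zd) => // h h0.
rewrite characteristic//; last by rewrite -[leRHS]addr0 lerD.
by rewrite c_nonpos ?W0// addrA -[leRHS]addr0 lerD// ltW.
Qed.

(** z has derivative k, which is bounded by a multiple of its history w, and it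
    starts with zero history. *)
Lemma difference_eq0 : w T = 0.
Proof.
have TT : 0 <= T <= T by rewrite lexx ltW.
rewrite difference_is_history//; apply/eqP; rewrite -normr_le0.
have hz t : 0 < t < T -> has_deriv z t (k t).
  move=> tT; have /andP[t0 t1] := tT.
  have m0 : 0 < Num.min t (T - t) by rewrite lt_min t0 subr_gt0.
  apply: (@has_deriv_near _ _ q _ t _ _ m0); last exact: (increments_deriv ck Hq).
  move=> s; rewrite lt_min !ltr_norml => /andP[/andP[h1 h2] /andP[h3 h4]].
  by rewrite /z c_id//; apply/andP; split; lra.
have bd t : 0 < t < T -> `|k t| <= l * `|hist z t| + 0.
  move=> /andP[t0 t1]; have tT : 0 <= t <= T by rewrite !ltW.
  by rewrite addr0 -difference_is_history//; exact: Hk.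
have := gronwall eta0 l0 (lexx 0) (ltW T0) z_traj hz bd TT.
have -> : hist z 0 = 0.
  by apply: eq_buc => th th0; rewrite histE// add0r min_l// /z c_nonpos// q0.
by rewrite normr0 mul0r addr0 mulr0.
Qed.

End Difference.
End CharacteristicLines.

Lemma pair0_continuous {R : realType} (V W : normedModType R) (g : R -> W) :
  continuous g -> continuous (fun t => (0 : V, g t)).
Proof.
move=> cg t.
apply: (@cvg_pair R _ _ (nbhs t) (nbhs (0 : V)) (nbhs (g t)) _ _ _ (fun=> 0) g).
  exact: cvg_cst.
exact: cg.
Qed.

Section MildSolutions.
Context {R : realType} {n : nat} (eta : R) (eta0 : 0 < eta).
Variable f : BUC n eta -> 'cV[R]_n.
Hypothesis flip : lipschitz_on_bounded_sets f.
Notation hist := (hist eta).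

(** The first component of the mild equation is the boundary condition: the
    derivative of the integrated state at 0 equals the integral of f. *)
Lemma mild_integrals phi tau (u : R -> Xspace R n eta) : is_mild_solution f (0, phi) tau u ->
  forall s, 0 <= s -> (s%:E < tau)%E -> exists P : BUC n eta * 'cV[R]_n,
    [/\ is_Riemann_integral (fun t => (u t).2) 0 s P.1,
        is_Riemann_integral (fun t => f (u t).2) 0 s P.2,
        is_deriv_nonpos P.1 ((u s).2 - phi) & ((u s).2 - phi) 0 = P.2].
Proof.
move=> [_ HX0 _ H] s s0 st; have [I [J [RI RJ [_ [psi Dpsi]] E]]] := H s s0 st.
have J20 : J.2 = 0 by exact: (riemann_zero s0 (riemann_snd RJ)).
have X1 := HX0 s s0 st; rewrite /X0 /= in X1.
have dE := buc_derivE Dpsi.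
have e2 : (u s).2 - phi = psi by rewrite E /= dE J20 addr0 [phi + _]addrC addrK.
exists (I.2, J.1); rewrite e2.
split; [exact: riemann_snd RI|exact: riemann_fst RJ|exact: Dpsi|].
by move: X1; rewrite E /= dE add0r => /eqP; rewrite addrC subr_eq0 => /eqP ->.
Qed.

Lemma mild_within phi tau (u : R -> Xspace R n eta) (c : R -> R) :
  is_mild_solution f (0, phi) tau u -> continuous c ->
  (forall s, 0 <= c s /\ ((c s)%:E < tau)%E) -> continuous (fun s => (u (c s)).2).
Proof.
move=> [_ _ /subspace_continuousP cu _] cc cS s.
move=> B HB; have HB' : nbhs (u (c s)) [set p | B p.2].
  by exists (setT, B); [split => //; exact: filterT|move=> [p1 p2] []].
have nb : nbhs (c s) (fun r => 0 <= r /\ (r%:E < tau)%E -> B (u r).2) by exact: cu HB'.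
have nc : nbhs s (c @^-1` (fun r => 0 <= r /\ (r%:E < tau)%E -> B (u r).2)) by exact: cc nb.
by apply: filterS nc => r hr; exact: hr (cS r).
Qed.

(** On [0, t] both solutions are bounded, so f is Lipschitz there; clamping time to
    [0, t] extends them continuously to the line. *)
Lemma mild_solution_unique phi tau tau' u u' :
  is_mild_solution f (0, phi) tau u -> is_mild_solution f (0, phi) tau' u' ->
  forall t, 0 <= t -> (t%:E < tau)%E -> (t%:E < tau')%E -> u t = u' t.
Proof.
move=> Hu Hu' t t0 tt tt'.
have X1 : (u t).1 = 0 by case: Hu => _ h _ _; exact: h.
have X2 : (u' t).1 = 0 by case: Hu' => _ h _ _; exact: h.
suff E : (u t).2 - (u' t).2 = 0.
  move/eqP: E; rewrite subr_eq0 => /eqP E.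
  by rewrite [u t]surjective_pairing [u' t]surjective_pairing X1 X2 E.
have [t_gt0|t_le0] := ltP 0 t; last first.
  have tE : t = 0 by apply/eqP; rewrite eq_le t_le0.
  have initial (v : R -> Xspace R n eta) sg : is_mild_solution f (0, phi) sg v ->
      (t%:E < sg)%E -> (v t).2 = phi.
    move=> Hv ts; have [P [RP _ DP _]] := mild_integrals Hv t0 ts.
    rewrite tE in RP; have P0 := riemann_point RP; rewrite P0 in DP.
    have zd : is_deriv_nonpos (0 : BUC n eta) (0 : BUC n eta).
      exact: deriv_nonpos0.
    apply/eqP; rewrite -subr_eq0; apply/eqP/eq_buc; exact: deriv_nonpos_unique DP zd.
  by rewrite (initial _ _ Hu tt) (initial _ _ Hu' tt') subrr.
pose c (s : R) := Num.min (Num.max s 0) t.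
have cc : continuous c.
  by move=> s; exact: (continuous_comp (@maxr_continuous R 0 s) (@minr_continuous R t _)).
have c_id s : 0 <= s <= t -> c s = s by move=> /andP[s0 st]; rewrite /c max_l// min_l.
have c_in s : 0 <= c s <= t by rewrite /c le_min t0 andbT le_max lexx orbT ge_min lexx orbT.
have below s sg : s <= t -> (t%:E < sg)%E -> (s%:E < sg)%E.
  by move=> st; apply: le_lt_trans; rewrite lee_fin.
have cS s : 0 <= c s /\ ((c s)%:E < tau)%E.
  by have /andP[h1 h2] := c_in s; split => //; exact: below h2 tt.
have cS' s : 0 <= c s /\ ((c s)%:E < tau')%E.
  by have /andP[h1 h2] := c_in s; split => //; exact: below h2 tt'.
have [P HP] := choice (fun s => mild_integrals Hu (cS s).1 (cS s).2).
have [P' HP'] := choice (fun s => mild_integrals Hu' (cS' s).1 (cS' s).2).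
have cv := mild_within Hu cc cS; have cv' := mild_within Hu' cc cS'.
set v := fun s => (u (c s)).2 in cv; set v' := fun s => (u' (c s)).2 in cv'.
have [M M0 HM] := segment_bounded 0 t cv; have [M' M'0 HM'] := segment_bounded 0 t cv'.
have MM : 0 < M + M' by exact: addr_gt0.
have [kap Hkap] := flip MM.
have kap0 : 0 < `|kap| + 1 by rewrite ltr_wpDl.
have cf := lipschitz_bounded_continuous flip.
have RP s : 0 <= s <= t -> is_Riemann_integral (fun r => v r - v' r) 0 s ((P s).1 - (P' s).1).
  move=> /[dup] st /andP[s0 s1]; have [h _ _ _] := HP s; have [h' _ _ _] := HP' s.
  rewrite c_id// in h h'; apply: eq_riemann (riemannB h h') => r /andP[r0 r1].
  by rewrite /v /v' c_id// r0 (le_trans r1).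
have RQ s : 0 <= s <= t -> is_Riemann_integral (fun r => f (v r) - f (v' r)) 0 s ((P s).2 - (P' s).2).
  move=> /[dup] st /andP[s0 s1]; have [_ h _ _] := HP s; have [_ h' _ _] := HP' s.
  rewrite c_id// in h h'; apply: eq_riemann (riemannB h h') => r /andP[r0 r1].
  by rewrite /v /v' c_id// r0 (le_trans r1).
have t00 : 0 <= (0 : R) <= t by rewrite lexx.
have vt : (u t).2 - (u' t).2 = v t - v' t by rewrite /v /v' c_id// t0 lexx.
rewrite vt; apply: (difference_eq0 eta0 (w := fun r => v r - v' r)
  (W := fun s => (P s).1 - (P' s).1) (q := fun s => (P s).2 - (P' s).2)
  (k := fun r => f (v r) - f (v' r)) t_gt0 kap0).
- by move=> r; apply: cvgB; [exact: cv|exact: cv'].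
- move=> r; apply: cvgB.
    by apply: (@continuous_comp _ _ _ v f); [exact: cv|exact: cf].
  by apply: (@continuous_comp _ _ _ v' f); [exact: cv'|exact: cf].
- move=> a b d e a0 ab bt; apply: riemann_increment => //; apply: RP.
    by rewrite a0 (le_trans ab).
  by rewrite (le_trans a0).
- move=> a b d e a0 ab bt; apply: riemann_increment => //; apply: RQ.
    by rewrite a0 (le_trans ab).
  by rewrite (le_trans a0).
- exact: riemann_point (RP 0 t00).
- exact: riemann_point (RQ 0 t00).
- move=> s st; have [_ _ h _] := HP s; have [_ _ h' _] := HP' s.
  have := deriv_nonposB h h'; congr is_deriv_nonpos; apply/funext => th.
  by rewrite !bucBE opprB addrA subrK.
- move=> s st; have [_ _ _ h] := HP s; have [_ _ _ h'] := HP' s.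
  by rewrite -h -h' !bucBE opprB addrA subrK.
- move=> s st; have Mv : `|v s| <= M + M' by rewrite (le_trans (HM s st))// lerDl ltW.
  have Mv' : `|v' s| <= M + M' by rewrite (le_trans (HM' s st))// lerDr ltW.
  apply: (le_trans (Hkap _ _ Mv Mv')); apply: ler_wpM2r; first exact: normr_ge0.
  by rewrite (le_trans (ler_norm kap))// lerDl.
Qed.

Lemma solves_maximal_mild x : solves f x ->
  is_maximal_mild_solution f (0, hist x 0) +oo%E (fun t => (0, hist x t)).
Proof.
move=> sx; have cf := lipschitz_bounded_continuous flip; have [tx _] := sx.
have H : is_mild_solution f (0, hist x 0) +oo%E (fun t => (0, hist x t)).
  split => //.
  - apply: continuous_subspaceT; apply: pair0_continuous; exact: hist_continuous.
  - move=> t t0 _; have [I [J [h1 h2 h3 _ h5]]] := solves_mild_integrals eta0 cf sx t0.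
    by exists I, J.
split=> // tau' u' H'; split; first exact: leey.
by move=> t t0 tt; apply: (mild_solution_unique H' H) => //; exact: ltry.
Qed.

End MildSolutions.

(** * Exponential stability of the equilibrium *)

Section Stability.
Context {R : realType} {n : nat} (eta : R) (eta0 : 0 < eta).

(** The rate 2l + 1 is the one at which the descent of linear_decay starts. *)
Lemma linear_part_decays (L : {linear BUC n eta -> 'cV[R]_n}) l : 0 < l ->
  (forall phi, `|L phi| <= l * `|phi|) ->
  (forall a xi, 0 <= a -> \det (Delta L (Complex a xi)) != 0) -> decaying L 0.
Proof.
move=> l0 Ll detN0.
have B0 : 0 <= 2 * l + 1 by rewrite addr_ge0// mulr_ge0// ltW.
have [K K0 HK] := char_uniform_bound eta0 l0 Ll detN0 B0.
have C0 : 0 < K * 4 * (n%:R + 1) by rewrite !mulr_gt0// ltr_wpDl// ler0n.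
have P b T W H r e p := @periodic_forcing R n eta eta0 L _ K K0 HK (char_surj eta0 detN0) b T W H r e p.
set C := K * 4 * (n%:R + 1) in C0 P.
have F := forced_estimate eta0 l0 Ll C0 P.
have C1 : 0 < 3 * C + 1 by lra.
apply: (linear_decay eta0 l0 Ll C1 _ (lexx (2 * l + 1))).
move=> b T H r z h bB D T0 H0 r0 tz z0 ch h0 hz hH.
apply: (le_trans (F b T H r z h bB D T0 H0 r0 tz z0 ch h0 hz hH)).
apply: ler_wpM2l; first exact: expR_ge0.
rewrite [leRHS]mulrDl mul1r mulrA lerD2l lerDl.
by rewrite divr_ge0 ?(ltW r0)// mulr_ge0 ?sqr_ge0// addr_ge0.
Qed.

End Stability.

Theorem theorem8p1 (R : realType) (n : nat) (hn : (1 <= n)%N)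
    (eta : R) (heta : 0 < eta) (f : BUC n eta -> 'cV[R]_n)
    (hlip : lipschitz_on_bounded_sets f)
    (hf0 : f 0 = 0)
    (hC1 : continuously_differentiable_near f 0)
    (hroots : forall lambda : R[i], - eta < complex.Re lambda ->
       \det (Delta ('d f (0 : BUC n eta)) lambda) = 0 ->
       complex.Re lambda < 0) :
  is_equilibrium f 0 /\
  asymptotically_stable f 0 /\
  exists M delta eps : R,
    [/\ 1 <= M, 0 < delta, 0 < eps &
      forall x : Xspace R n eta, X0 x -> normX x <= eps ->
        exists2 U, is_maximal_mild_solution f x +oo%E U &
          forall t, 0 <= t -> normX (U t) <= M * expR (- delta * t) * normX x].
Proof.
have [df _] := nbhs_singleton hC1.
have cd : continuous ('d f (0 : BUC n eta)) by exact: diff_continuous.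
have [l l0 Ll] := linear_lipschitz cd.
have detN0 (a xi : R) : 0 <= a -> \det (Delta ('d f (0 : BUC n eta)) (Complex a xi)) != 0.
  move=> a0; apply/eqP => /hroots /= h.
  have : - eta < a by rewrite (lt_le_trans _ a0)// oppr_lt0.
  by move=> /h; rewrite ltNge a0.
have D := linear_part_decays heta l0 Ll detN0.
have [M [d [eps [M1 d0 eps0 Hx]]]] :=
  nonlinear_decay heta hf0 hlip l0 Ll D (differentiable_little_o df hf0).
have decay (x : Xspace R n eta) : X0 x -> normX x <= eps ->
    exists2 U, is_maximal_mild_solution f x +oo%E U &
      forall t, 0 <= t -> normX (U t) <= M * expR (- d * t) * normX x.
  case: x => x1 phi; rewrite /X0 /= => ->; rewrite /normX /= normr0 add0r => he.
  have [x [sx x0 xd]] := Hx phi he.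
  exists (fun t => (0, hist eta x t)); first by rewrite -x0; exact: solves_maximal_mild.
  by move=> t t0 /=; rewrite normr0 add0r; exact: xd.
have zd : is_deriv_nonpos (0 : BUC n eta) (0 : BUC n eta).
  exact: deriv_nonpos0.
have M0 : 0 < M by exact: lt_le_trans M1.
have nX0 (x : Xspace R n eta) : 0 <= normX x by apply: addr_ge0; exact: normr_ge0.
split; [|split]; last by exists M, d, eps.
  split; first by split => //; exists 0.
  by rewrite /opA /opF /= (buc_derivE zd) hf0 oppr0; congr pair; rewrite addr0.
split.
  move=> e e0; exists (Num.min eps (e / M)); first by rewrite lt_min eps0 divr_gt0.
  move=> x hx; rewrite subr0 le_min => /andP[xe xM].
  have [U HU HUd] := decay x hx xe; exists U => // t t0; rewrite subr0.
  apply: (le_trans (HUd t t0)).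
  rewrite ler_pdivlMr// mulrC in xM; apply: le_trans xM.
  apply: ler_wpM2r; first exact: nX0.
  by rewrite ler_piMr ?(ltW M0)// -expR0 ler_expR mulNr oppr_le0 mulr_ge0// ltW.
exists eps => // x hx; rewrite subr0 => xe.
have [U HU HUd] := decay x hx xe; exists U => //.
have lim : M * expR (- d * t) * normX x @[t --> +oo] --> 0.
  rewrite -(mul0r (normX x)) -{1}(mulr0 M); apply: cvgMr_tmp; apply: cvgMl_tmp.
  under eq_fun do rewrite mulNr.
  apply: (cvg_comp (fun t => d * t) (fun y => expR (- y)) _ (@cvgr_expR R)).
  exact: gt0_cvgMry.
apply: squeeze_cvgr; last exact: lim; last exact: cvg_cst.
near=> t; have t0 : 0 <= t by near: t; exact: nbhs_pinfty_ge.
by rewrite subr0 nX0 HUd.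
Unshelve. all: by end_near.
Qed.
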